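(* Let $M$ be an $n$-dimensional ($n\ge3$) compact oriented Riemannian manifold without boundary, with metric $g^{TM}$ and Levi-Civita connection $\nabla^L$, let $V$ be a vector field with $|V|=1$, and let $D_V=\sqrt{-1}\,\widehat c(V)(d+\delta)$ and $D_V^*=-\sqrt{-1}\,(d+\delta)\widehat c(V)$, acting on sections of $\bigwedge^*T^*M\otimes\mathbb C$. Let $e_1,\dots,e_n$ be a local orthonormal frame of $TM$ and $K$ the scalar curvature. Then $$D_V^*D_V=-\Big[g^{ij}\big(\nabla_{\partial_i}\nabla_{\partial_j}-\nabla_{\nabla^L_{\partial_i}\partial_j}\big)\Big]-\frac18\sum_{ijkl}R_{ijkl}\,\widehat c(e_i)\widehat c(e_j)c(e_k)c(e_l)+\frac14K,$$ and $$D_V^2=-\Big[g^{ij}\big(\nabla_{\partial_i}\nabla_{\partial_j}-\nabla_{\nabla^L_{\partial_i}\partial_j}\big)\Big]-\frac18\sum_{ijkl}R_{ijkl}\,\widehat c(e_i)\widehat c(e_j)c(e_k)c(e_l)+\frac14K+\frac14\sum_{i=1}^n\Big[\widehat c(V)\sum_{q=1}^n\widehat c(\nabla^L_{e_q}V)c(e_q)c(e_i)\Big]^2-\frac12\sum_{j=1}^n\Big[\nabla^{\bigwedge^*T^*M}_{e_j}\Big(\widehat c(V)\sum_{q=1}^n\widehat c(\nabla^L_{e_q}V)c(e_q)\Big)c(e_j)\Big],$$ where in each formula $\nabla$ denotes the connection on $\bigwedge^*T^*M\otimes\mathbb C$ canonically associated with the Laplace-type operator on the left-hand side.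
   Context: With $e_j^*=g^{TM}(e_j,\cdot)$ and $\epsilon(e_j^* ),\iota(e_j^* )$ exterior and interior multiplication, set $c(e_j)=\epsilon(e_j^* )-\iota(e_j^* )$ and $\widehat c(e_j)=\epsilon(e_j^* )+\iota(e_j^* )$, extended linearly to all vectors. They satisfy $\widehat c(e_i)\widehat c(e_j)+\widehat c(e_j)\widehat c(e_i)=2\delta_{ij}$, $c(e_i)c(e_j)+c(e_j)c(e_i)=-2\delta_{ij}$, $c(e_i)\widehat c(e_j)+\widehat c(e_j)c(e_i)=0$. $d$ is the exterior derivative and $\delta$ its formal adjoint; $d+\delta=\sum_q c(e_q)\nabla^{\bigwedge^*T^*M}_{e_q}$, where $\nabla^{\bigwedge^*T^*M}$ is the connection on $\bigwedge^*T^*M\otimes\mathbb C$ induced by $\nabla^L$ (also used for the induced connection on endomorphisms; in the last term of the second formula, the derivative is applied to the endomorphism in parentheses, and the result is composed with $c(e_j)$). $\partial_i$ is a local coordinate frame, $(g^{ij})$ the inverse of the metric matrix $(g_{ij})$; repeated indices in $g^{ij}(\cdots)$ are summed. Curvature convention: $R(X,Y)=\nabla^L_X\nabla^L_Y-\nabla^L_Y\nabla^L_X-\nabla^L_{[X,Y]}$ and $R_{ijkl}=g^{TM}(R(e_i,e_j)e_k,e_l)$. Canonical connection: if a differential operator $P$ on a vector bundle $N$ is of Laplace type, i.e. locally $P=-(g^{ij}\partial_i\partial_j+A^i\partial_i+B)$ with $A^i,B$ smooth sections of $\mathrm{End}(N)$, there are a unique connection $\nabla$ on $N$ and a unique endomorphism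 $E$ of $N$ with $P=-[g^{ij}(\nabla_{\partial_i}\nabla_{\partial_j}-\nabla_{\nabla^L_{\partial_i}\partial_j})+E]$; locally $\nabla_{\partial_i}=\partial_i+\omega_i$ with $\omega_i=\frac12g_{ij}(A^j+g^{kl}\Gamma^j_{kl}\,\mathrm{id})$, where $\Gamma^j_{kl}$ are the Christoffel symbols of $\nabla^L$. *)

(* Defs.v *)
From HB Require Import structures.
From mathcomp Require Import all_boot all_order all_algebra.
From mathcomp Require Import all_classical all_reals all_analysis.
From mathcomp Require Import complex.

Set Implicit Arguments.
Unset Strict Implicit.
Unset Printing Implicit Defensive.

Import Order.TTheory GRing.Theory Num.Theory.
Import numFieldNormedType.Exports.

Local Open Scope classical_set_scope.
Local Open Scope ring_scope.
Local Open Scope complex_scope.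

Section Calculus.
Context {R : realType} {n : nat}.
Implicit Types (O : set 'rV[R]_n) (i : 'I_n).

Definition pderiv i (f : 'rV[R]_n -> R) : 'rV[R]_n -> R :=
  fun x => 'D_(delta_mx 0 i) f x.

(* C^oo on O: every iterated partial derivative is (Frechet) differentiable at
   every point of O. Only meant for open O; nothing is required off O. *)
Definition smooth_on O (f : 'rV[R]_n -> R) : Prop :=
  forall s : seq 'I_n, forall x, O x -> differentiable (foldr pderiv f s) x.

Definition smooth_mx p q O (F : 'rV[R]_n -> 'M[R]_(p, q)) : Prop :=
  forall k l, smooth_on O (fun x => F x k l).

Definition smooth_cmx p q O (F : 'rV[R]_n -> 'M[R[i]]_(p, q)) : Prop :=
  forall k l, smooth_on O (fun x => complex.Re (F x k l)) /\
              smooth_on O (fun x => complex.Im (F x k l)).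

Definition pderiv_mx p q i (F : 'rV[R]_n -> 'M[R]_(p, q)) :
    'rV[R]_n -> 'M[R]_(p, q) :=
  fun x => \matrix_(k, l) pderiv i (fun y => F y k l) x.

Definition pderiv_cmx p q i (F : 'rV[R]_n -> 'M[R[i]]_(p, q)) :
    'rV[R]_n -> 'M[R[i]]_(p, q) :=
  fun x => \matrix_(k, l)
    (pderiv i (fun y => complex.Re (F y k l)) x +i*
     pderiv i (fun y => complex.Im (F y k l)) x).

End Calculus.

(* Integral over R^n as an iterated one-dimensional Lebesgue integral; it is
   only used on continuous compactly supported integrands, where it is the
   n-dimensional Lebesgue integral. *)
Fixpoint iint {R : realType} (n : nat) : ('rV[R]_n -> R) -> R :=
  match n return ('rV[R]_n -> R) -> R with
  | 0 => fun f => f 0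
  | m.+1 => fun f =>
      Rintegral (@lebesgue_measure R) setT
        (fun t => iint (fun y : 'rV[R]_m => f (row_mx (t%:M : 'M[R]_1) y)))
  end.

Definition ciint {R : realType} (n : nat) (f : 'rV[R]_n -> R[i]) : R[i] :=
  iint (fun x => complex.Re (f x)) +i* iint (fun x => complex.Im (f x)).

(* A covector of mixed degree is the column of its coordinates in the basis
  dx^J = dx^{j_1} /\ .. /\ dx^{j_p} (j_1 < .. < j_p), J ranging over
  {set 'I_n}; [enum_val] turns a matrix index into the set J. *)

Definition dimL (n : nat) : nat := #|{set 'I_n}|.

Section Exterior.
Context {R : realType} {n : nat}.

(* exterior multiplication by dx^k:
   dx^k /\ dx^J = (-1)^#{j in J | j < k} dx^(k |: J) if k is not in J *)
Definition extm (k : 'I_n) : 'M[R[i]]_(dimL n) :=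
  \matrix_(I, J)
    (let J' : {set 'I_n} := enum_val J in
     if (k \notin J') && (enum_val I == k |: J')
     then (-1) ^+ #|[set j in J' | (j < k)%N]| else 0).

(* contraction by d/dx^k: the transpose, as dx^J |-> dx^(k |: J) up to the same
   sign *)
Definition intm (k : 'I_n) : 'M[R[i]]_(dimL n) := (extm k)^T.

(* For G = (g_ij) the metric matrix and X a tangent vector, with X^* = g(X, .):
   wedge G X = epsilon(X^* ), contr X = iota(X^* ), the contraction by X. *)
Definition wedge (G : 'M[R]_n) (X : 'rV[R]_n) : 'M[R[i]]_(dimL n) :=
  \sum_(k < n) ((X *m G) 0 k)%:C *: extm k.

Definition contr (X : 'rV[R]_n) : 'M[R[i]]_(dimL n) :=
  \sum_(k < n) (X 0 k)%:C *: intm k.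

Definition cliff (G : 'M[R]_n) (X : 'rV[R]_n) : 'M[R[i]]_(dimL n) :=
  wedge G X - contr X.

Definition cliffh (G : 'M[R]_n) (X : 'rV[R]_n) : 'M[R[i]]_(dimL n) :=
  wedge G X + contr X.

(* minor of H with rows I and columns J, 0 if I and J have different sizes *)
Definition set_minor (H : 'M[R]_n) (I J : {set 'I_n}) : R :=
  match #|I| =P #|J| with
  | ReflectT e =>
      \det (\matrix_(a < #|I|, b < #|I|) H (enum_val a) (enum_val (cast_ord e b)))
  | ReflectF _ => 0
  end.

(* The Hermitian inner product on forms (linear on the left) induced by the
   metric G: <dx^I, dx^J> = det (g^{ij})_{i in I, j in J}. *)
Definition form_ip (G : 'M[R]_n) (u v : 'cV[R[i]]_(dimL n)) : R[i] :=
  \sum_I \sum_J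
    u I 0 * conjc (v J 0) * (set_minor (invmx G) (enum_val I) (enum_val J))%:C.

End Exterior.

Record oriented_manifold (R : realType) (n : nat) := OrientedManifold {
  carrier :> topologicalType;
  chart : Type;
  chart_dom : chart -> set carrier;
  chart_map : chart -> carrier -> 'rV[R]_n;
  chart_inv : chart -> 'rV[R]_n -> carrier;
  manifold_hausdorff : hausdorff_space carrier;
  chart_cover : forall p, exists a, chart_dom a p;
  chart_dom_open : forall a, open (chart_dom a);
  chart_img_open : forall a, open (chart_map a @` chart_dom a);
  chart_mapK : forall a p, chart_dom a p -> chart_inv a (chart_map a p) = p;
  chart_map_continuous : forall a p, chart_dom a p ->
    {for p, continuous (chart_map a)};
  chart_inv_continuous : forall a x, (chart_map a @` chart_dom a) x ->
    {for x, continuous (chart_inv a)};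
  transition_smooth : forall a b,
    smooth_mx (chart_map a @` (chart_dom a `&` chart_dom b))
              (chart_map b \o chart_inv a);
  transition_oriented : forall a b x,
    (chart_map a @` (chart_dom a `&` chart_dom b)) x ->
    0 < \det (jacobian (chart_map b \o chart_inv a) x)
}.

Section Tensors.
Context {R : realType} {n : nat}.
Variable M : oriented_manifold R n.

Definition chart_img (a : chart M) : set 'rV[R]_n :=
  @chart_map R n M a @` @chart_dom R n M a.

Definition overlap (a b : chart M) : set 'rV[R]_n :=
  @chart_map R n M a @` (@chart_dom R n M a `&` @chart_dom R n M b).

Definition transition (a b : chart M) : 'rV[R]_n -> 'rV[R]_n :=
  @chart_map R n M b \o @chart_inv R n M a.

(* Tensor fields are given by their components in every chart, as functions of
   the coordinates; with row vectors, (v *m jacobian f x) = df_x(v). *)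
Record metric := Metric {
  gmat :> chart M -> 'rV[R]_n -> 'M[R]_n;
  gmat_smooth : forall a, smooth_mx (chart_img a) (gmat a);
  gmat_sym : forall a x, chart_img a x -> (gmat a x)^T = gmat a x;
  gmat_pos : forall a x, chart_img a x ->
    forall v : 'rV[R]_n, v != 0 -> 0 < (v *m gmat a x *m v^T) 0 0;
  gmat_transition : forall a b x, overlap a b x ->
    gmat a x = jacobian (transition a b) x *m gmat b (transition a b x)
               *m (jacobian (transition a b) x)^T
}.

Record vector_field := VectorField {
  vcomp :> chart M -> 'rV[R]_n -> 'rV[R]_n;
  vcomp_smooth : forall a, smooth_mx (chart_img a) (vcomp a);
  vcomp_transition : forall a b x, overlap a b x ->
    vcomp b (transition a b x) = vcomp a x *m jacobian (transition a b) x
}.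

End Tensors.

Section Geometry.
Context {R : realType} {n : nat}.
Notation pt := 'rV[R]_n.
Variable g : pt -> 'M[R]_n.

Definition gip (X Y : pt -> pt) (x : pt) : R := (X x *m g x *m (Y x)^T) 0 0.

Definition ginv (x : pt) : 'M[R]_n := invmx (g x).

Definition dvec (i : 'I_n) : pt -> pt := fun=> delta_mx 0 i.

(* christoffel k i j = Gamma^k_ij *)
Definition christoffel (k i j : 'I_n) (x : pt) : R :=
  2^-1 * \sum_(l < n) ginv x k l *
    (pderiv i (fun y => g y j l) x + pderiv j (fun y => g y i l) x
     - pderiv l (fun y => g y i j) x).

Definition nablaL (X Y : pt -> pt) : pt -> pt := fun x =>
  \row_k (\sum_(i < n) X x 0 i * pderiv i (fun y => Y y 0 k) x
          + \sum_(i < n) \sum_(j < n) christoffel k i j x * X x 0 i * Y x 0 j).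

Definition lie (X Y : pt -> pt) : pt -> pt := fun x =>
  \sum_(i < n) (X x 0 i *: pderiv_mx i Y x - Y x 0 i *: pderiv_mx i X x).

Definition curv (X Y Z : pt -> pt) : pt -> pt := fun x =>
  nablaL X (nablaL Y Z) x - nablaL Y (nablaL X Z) x - nablaL (lie X Y) Z x.

(* K = g^{jk} Ric(d_j, d_k), Ric(Y, Z) = tr (X |-> R(X, Y) Z) *)
Definition scal (x : pt) : R :=
  \sum_(j < n) \sum_(k < n) ginv x j k *
    \sum_(i < n) curv (dvec i) (dvec j) (dvec k) x 0 i.

(* R_ijkl = g(R(e_i, e_j) e_k, e_l) *)
Definition riem (e : 'I_n -> pt -> pt) (i j k l : 'I_n) (x : pt) : R :=
  gip (curv (e i) (e j) (e k)) (e l) x.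

Definition orthonormal_frame (W : set pt) (e : 'I_n -> pt -> pt) : Prop :=
  (forall i, smooth_mx W (e i)) /\
  (forall i j x, W x -> gip (e i) (e j) x = (i == j)%:R).

(* Forms over a coordinate domain are given by their components; d, delta, D_V
   and D_V^* are local operators and act on all of them, in particular on the
   restrictions of the global sections of the bundle. *)
Notation sect := (pt -> 'cV[R[i]]_(dimL n)).
Notation endo := (pt -> 'M[R[i]]_(dimL n)).

(* The connection induced by nabla^L on forms is d_i + lcform i: the derivation
   extending nabla_{d_i} dx^k = - Gamma^k_ij dx^j. *)
Definition lcform (i : 'I_n) : endo := fun x =>
  - \sum_(j < n) \sum_(k < n) (christoffel k i j x)%:C *: (extm j *m intm k).

(* ... and the connection it induces on endomorphisms *)
Definition nablaEnd (X : pt -> pt) (F : endo) : endo := fun x =>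
  \sum_(i < n) (X x 0 i)%:C *:
    (pderiv_cmx i F x + (lcform i x *m F x - F x *m lcform i x)).

Definition dR (u : sect) : sect := fun x =>
  \sum_(i < n) extm i *m pderiv_cmx i u x.

(* L^2 product with respect to the Riemannian volume sqrt(det g) dx, for
   sections one of which has compact support in the chart *)
Definition l2 (u v : sect) : R[i] :=
  ciint (fun x => form_ip (g x) (u x) (v x) * (Num.sqrt (\det (g x)))%:C).

(* delta is the formal adjoint of d over the coordinate domain O: it acts on
   the smooth forms on O, and (d alpha, beta) = (alpha, delta beta) for every
   test form alpha (smooth with compact support in O, extended by 0). Test
   forms supported in a chart suffice, by a partition of unity. *)
Definition formal_adjoint_d (O : set pt) (delta : sect -> sect) : Prop :=
  forall beta : sect, smooth_cmx O beta ->
    smooth_cmx O (delta beta) /\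
    forall (alpha : sect) (S : set pt),
      smooth_cmx setT alpha -> compact S -> S `<=` O ->
      (forall x, ~ S x -> alpha x = 0) ->
      l2 (dR alpha) beta = l2 alpha (delta beta).

(* D_V = i c^(V)(d + delta), D_V^* = - i (d + delta) c^(V) *)

Definition DV (delta : sect -> sect) (V : pt -> pt) (u : sect) : sect := fun x =>
  (0 +i* 1) *: (cliffh (g x) (V x) *m (dR u x + delta u x)).

Definition DVstar (delta : sect -> sect) (V : pt -> pt) (u : sect) : sect :=
  let w : sect := fun y => cliffh (g y) (V y) *m u y in
  fun x => - ((0 +i* 1) *: (dR w x + delta w x)).

(* P = - (g^{ij} d_i d_j + A^i d_i + B) on O *)
Definition laplace_form (O : set pt) (P : sect -> sect)
    (A : 'I_n -> endo) (B : endo) : Prop :=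
  [/\ forall i, smooth_cmx O (A i), smooth_cmx O B &
      forall u x, smooth_cmx O u -> O x ->
        P u x = - (\sum_(i < n) \sum_(j < n)
                     (ginv x i j)%:C *: pderiv_cmx i (pderiv_cmx j u) x
                   + \sum_(i < n) A i x *m pderiv_cmx i u x
                   + B x *m u x)].

Definition laplace_type (O : set pt) (P : sect -> sect) : Prop :=
  exists A B, laplace_form O P A B.

(* omega is the family of connection forms of the connection on forms
   canonically associated with the Laplace type operator P on O:
   omega_i = 1/2 g_ij (A^j + g^{kl} Gamma^j_kl id) *)
Definition canonical_connection (O : set pt) (P : sect -> sect)
    (omega : 'I_n -> endo) : Prop :=
  exists A B, laplace_form O P A B /\
    forall i x, O x ->
      omega i x = 2^-1 *: \sum_(j < n) (g x i j)%:C *: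
        (A j x + (\sum_(k < n) \sum_(l < n)
                    ginv x k l * christoffel j k l x)%:C%:M).

(* nabla_X u for the connection d_i + omega_i *)
Definition nabla (omega : 'I_n -> endo) (X : pt -> pt) (u : sect) : sect :=
  fun x => \sum_(i < n) (X x 0 i)%:C *: (pderiv_cmx i u x + omega i x *m u x).

(* g^{ij} (nabla_{d_i} nabla_{d_j} - nabla_{nabla^L_{d_i} d_j}) *)
Definition rough_laplacian (omega : 'I_n -> endo) (u : sect) : sect := fun x =>
  \sum_(i < n) \sum_(j < n) (ginv x i j)%:C *:
    (nabla omega (dvec i) (nabla omega (dvec j) u) x
     - nabla omega (nablaL (dvec i) (dvec j)) u x).

(* sum_ijkl R_ijkl c^(e_i) c^(e_j) c(e_k) c(e_l) *)
Definition curv_term (e : 'I_n -> pt -> pt) : endo := fun x =>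
  \sum_(i < n) \sum_(j < n) \sum_(k < n) \sum_(l < n)
    (riem e i j k l x)%:C *:
      (cliffh (g x) (e i x) *m cliffh (g x) (e j x)
       *m cliff (g x) (e k x) *m cliff (g x) (e l x)).

(* c^(V) sum_q c^(nabla^L_{e_q} V) c(e_q) *)
Definition twist_term (V : pt -> pt) (e : 'I_n -> pt -> pt) : endo := fun x =>
  cliffh (g x) (V x) *m
    \sum_(q < n) (cliffh (g x) (nablaL (e q) V x) *m cliff (g x) (e q x)).

End Geometry.

(* Main.v *)
Require Import Defs.
From HB Require Import structures.
From mathcomp Require Import all_boot all_order all_algebra.
From mathcomp Require Import all_classical all_reals all_analysis.
From mathcomp Require Import complex.
From mathcomp Require Import ring lra.

Set Implicit Arguments.
Unset Strict Implicit.
Unset Printing Implicit Defensive.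

Import Order.TTheory GRing.Theory Num.Theory.
Import numFieldNormedType.Exports.

Local Open Scope classical_set_scope.
Local Open Scope ring_scope.
Local Open Scope complex_scope.

(** Since c^(V) squares to 1, and since moving it through D = d + delta costs
   a sign and a derivative of V, the two operators are D^2 and D^2 + F D, where
   F = c^(V) sum_k c^(nabla_k V) c^k and c^k is Clifford multiplication by dx^k
   ([DVstar_DV], [DV_DV]). Both are treated as one: F = 0 is the first case.

   The operator D is a Dirac operator, D = sum_k c^k nabla_k, for the connection
   nabla on forms ([dR_dirac]). For d this says that the connection is torsion
   free. For delta only the adjunction with d is given, so its formula
   delta = - sum_k i(dx^k) nabla_k has to be extracted from it
   ([codifferentialE]). Testing against phi dx^J, for smooth phi with compact
   support, turns the adjunction into a weak equation for the divergence of the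
   density sqrt(det g) H beta, where H is the Gram matrix of the inner product
   of forms. A weak equation between smooth functions holds pointwise
   ([weak_divergence]), which requires integration by parts for iterated
   integrals and bump functions. The derivatives of H and of sqrt(det g) are
   then needed. As H is the matrix of the algebra map induced by the inverse
   metric, it is determined by how it intertwines exterior multiplications
   ([intertwiner_uniq]), and its derivative is obtained by differentiating that
   relation; the derivative of the volume density is its top degree part.

   As the connection is compatible with Clifford multiplication,
   D^2 = sum_kl c^k c^l nabla^2_kl. The anticommutator of c^k and c^l is the
   scalar - 2 g^kl, so the symmetric part gives the Laplacian of the connection
   and the antisymmetric part the curvature endomorphism ([dirac_dirac]). The
   term F D is of first order; replacing nabla_k by nabla_k - 1/2 F c_k absorbs
   it, and completing the square leaves the two terms in F of the second formula
   ([dirac_twisted]). A second order operator determines its coefficients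
   ([laplace_form_uniq]), so the connection found in this way is the canonical
   one ([dirac_twisted_canonical]).

   It remains to compare with the expressions in an orthonormal frame. The
   curvature of forms is the derivation attached to the Riemann tensor; by the
   symmetries of the latter it is a quadratic expression in the c^(e_i) minus
   the same expression in the c(e_i) ([deriv_op_frame_skew]). Multiplied by
   c(e_k) c(e_l), the first gives the curvature term of the theorem by pair
   symmetry, and the second collapses to the scalar curvature by the Bianchi
   identity ([clifford_curvature_trace], [weitzenboeck_frame]). *)

(** * Partial derivatives and functions of class C^k *)

Section PartialDerivatives.
Context {R : realType} {n : nat}.
Notation pt := 'rV[R]_n.
Implicit Types (O : set pt) (i : 'I_n) (f g : pt -> R) (x : pt).

Lemma pderiv_near i f g x : {near x, f =1 g} -> pderiv i f x = pderiv i g x.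
Proof. by move=> fg; exact: near_eq_derive. Qed.

Lemma differentiable_expansion f x (e : R) : differentiable f x -> 0 < e ->
  \forall h \near (0 : pt), `|f (h + x) - (f x + 'd f x h)| <= e * `|h|.
Proof. by move=> /diff_locally /eqaddoP + e0 => /(_ _ e0). Qed.

Lemma differentiable_near f g x :
  {near x, f =1 g} -> differentiable f x -> differentiable g x.
Proof.
move=> fg df; have fgx : f x = g x by exact: nbhs_singleton fg.
have cd : continuous ('d f x) by exact: diff_continuous.
have E : g \o shift x = cst (g x) + 'd f x +o_ (0 : pt) id.
  apply/eqaddoP => _/posnumP[e].
  have fg0 : \forall h \near (0 : pt), f (h + x) = g (h + x).
    by move: fg; rewrite [X in X -> _](near_shift 0) subr0.
  near=> h; rewrite /= -fgx.
  have -> : (g \o shift x - (cst (f x) + 'd f x)) h = f (h + x) - (f x + 'd f x h).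
    by rewrite !fctE /=; congr (_ - _); symmetry; near: h.
  by near: h; exact: differentiable_expansion.
by apply/diff_locallyP; rewrite (diff_unique cd E).
Unshelve. all: by end_near. Qed.

Lemma pderivE i f x : differentiable f x -> pderiv i f x = 'd f x (delta_mx 0 i).
Proof. exact: deriveE. Qed.

Lemma pderiv_cst i (c : R) x : pderiv i (cst c) x = 0.
Proof. exact: derive_cst. Qed.

Lemma pderivD i f g x : differentiable f x -> differentiable g x ->
  pderiv i (fun y => f y + g y) x = pderiv i f x + pderiv i g x.
Proof. by move=> df dg; apply: deriveD; exact: diff_derivable. Qed.

Lemma pderivM i f g x : differentiable f x -> differentiable g x ->
  pderiv i (fun y => f y * g y) x = pderiv i f x * g x + f x * pderiv i g x.
Proof.
move=> df dg; rewrite [LHS]deriveM; try exact: diff_derivable.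
by rewrite addrC mulrC.
Qed.

Lemma pderiv_comp i (h : R -> R) f x : differentiable f x ->
  derivable h (f x) 1 -> pderiv i (h \o f) x = 'D_1 h (f x) * pderiv i f x.
Proof.
move=> df /derivable1_diffP dh.
rewrite !pderivE//; last exact: differentiable_comp.
by rewrite diff_comp//= (diff1E dh) derive1E [RHS]mulrC.
Qed.

Lemma differentiable_coordinate (x : pt) (j : 'I_n) :
  differentiable (fun y : pt => y 0 j) x.
Proof. exact: differentiable_coord. Qed.

Lemma pderiv_coordinate i (j : 'I_n) x :
  pderiv i (fun y : pt => y 0 j) x = (i == j)%:R.
Proof.
apply: cvg_lim => //; apply: (@cvg_trans _ (cst ((i == j)%:R : R) @ (0^' : set_system R))); last exact: cvg_cst.
apply: near_eq_cvg; near=> h; rewrite /= !mxE eqxx/= addrK [_ *: _]mulKf.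
  by rewrite eq_sym.
by near: h; exact: nbhs_dnbhs_neq.
Unshelve. all: by end_near. Qed.

(** Smoothness is reached by induction on the number of derivatives: the Leibniz
   and chain rules express a derivative through functions of one order less. *)
Fixpoint Ck k O f : Prop :=
  (forall x, O x -> differentiable f x) /\
  if k is k'.+1 then forall i, Ck k' O (pderiv i f) else True.

Lemma Ck_differentiable k O f x : Ck k O f -> O x -> differentiable f x.
Proof. by case: k => [|k] [df _]; exact: df. Qed.

Lemma Ck_pderiv k O f i : Ck k.+1 O f -> Ck k O (pderiv i f).
Proof. by move=> Cf; exact: (Cf.2 i). Qed.

Lemma Ck_intro k O f : (forall x, O x -> differentiable f x) ->
  (forall k', k = k'.+1 -> forall i, Ck k' O (pderiv i f)) -> Ck k O f.
Proof. by case: k => [|k] df dk; split=> //; exact: dk. Qed.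

Lemma CkW k O f : Ck k.+1 O f -> Ck k O f.
Proof. by elim: k f => [|k IH] f [df dk]//=; split=> // i; exact: IH. Qed.

Lemma Ck_le k m O f : (k <= m)%N -> Ck m O f -> Ck k O f.
Proof.
elim: m => [|m IH]; first by rewrite leqn0 => /eqP->.
by rewrite leq_eqVlt ltnS => /predU1P[->//|/IH + /CkW]; exact.
Qed.

Lemma smooth_onP O f : smooth_on O f <-> forall k, Ck k O f.
Proof.
split=> [sf k|Cf s].
  elim: k f sf => [|k IH] f sf /=; split => //; try exact: (sf [::]).
  by move=> i; apply: IH => s x Ox; have := sf (rcons s i) x Ox; rewrite foldr_rcons.
elim/last_ind: s f Cf => [|s i IH] f Cf x Ox /=; first exact: (Cf 0%N).1.
by rewrite foldr_rcons; apply: IH => // k; exact: (Cf k.+1).2.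
Qed.

Lemma open_near_eq O f g x : open O -> (forall y, O y -> f y = g y) -> O x ->
  {near x, f =1 g}.
Proof. by move=> oO fg Ox; near=> y; apply: fg; near: y; exact: open_nbhs_nbhs.
Unshelve. all: by end_near. Qed.

Lemma pderiv_open O i f g x : open O -> (forall y, O y -> f y = g y) -> O x ->
  pderiv i f x = pderiv i g x.
Proof. by move=> oO fg Ox; apply/pderiv_near/(open_near_eq oO). Qed.

Lemma Ck_eq k O f g : open O -> (forall y, O y -> f y = g y) ->
  Ck k O f -> Ck k O g.
Proof.
move=> oO; elim: k f g => [|k IH] f g fg Cf; apply: Ck_intro => [x Ox|k' // [<-] i];
  try by apply: differentiable_near (Ck_differentiable Cf Ox); exact: open_near_eq oO fg Ox.
by apply: IH (Ck_pderiv i Cf) => y Oy; exact: pderiv_open oO fg Oy.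
Qed.

Lemma Ck_sub k O O' f : O' `<=` O -> Ck k O f -> Ck k O' f.
Proof.
move=> OO'; elim: k f => [|k IH] f Cf; apply: Ck_intro => [x /OO' Ox|k' // [<-] i];
  try exact: Ck_differentiable Cf Ox.
exact: IH (Ck_pderiv i Cf).
Qed.

Lemma Ck_cst k O (c : R) : Ck k O (cst c).
Proof.
elim: k c => [|k IH] c; apply: Ck_intro => [x _|k' // [<-] i]; try exact: differentiable_cst.
by rewrite (_ : pderiv i (cst c) = cst 0)//; apply/funext => x; exact: pderiv_cst.
Qed.

Lemma Ck_coordinate k O (j : 'I_n) : Ck k O (fun x : pt => x 0 j).
Proof.
apply: Ck_intro => [x _|k' _ i]; first exact: differentiable_coordinate.
rewrite (_ : pderiv i _ = cst (i == j)%:R); first exact: Ck_cst.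
by apply/funext => x; exact: pderiv_coordinate.
Qed.

Lemma CkD k O f g : open O -> Ck k O f -> Ck k O g ->
  Ck k O (fun x => f x + g x).
Proof.
move=> oO; elim: k f g => [|k IH] f g Cf Cg; apply: Ck_intro => [x Ox|k' // [<-] i];
  try exact: differentiableD (Ck_differentiable Cf Ox) (Ck_differentiable Cg Ox).
apply: Ck_eq oO _ (IH _ _ (Ck_pderiv i Cf) (Ck_pderiv i Cg)) => y Oy.
by rewrite pderivD//; [exact: Ck_differentiable Cf Oy|exact: Ck_differentiable Cg Oy].
Qed.

Lemma CkM k O f g : open O -> Ck k O f -> Ck k O g ->
  Ck k O (fun x => f x * g x).
Proof.
move=> oO; elim: k f g => [|k IH] f g Cf Cg; apply: Ck_intro => [x Ox|k' // [<-] i];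
  try exact: differentiableM (Ck_differentiable Cf Ox) (Ck_differentiable Cg Ox).
have C1 := IH _ _ (Ck_pderiv i Cf) (CkW Cg).
have C2 := IH _ _ (CkW Cf) (Ck_pderiv i Cg).
apply: Ck_eq oO _ (CkD oO C1 C2) => y Oy.
by rewrite pderivM//; [exact: Ck_differentiable Cf Oy|exact: Ck_differentiable Cg Oy].
Qed.

(** The derivative of h may be controlled with the help of the regularity of
   h o f itself, one order lower: for the inverse and the square root, the
   derivative is an expression in the function, and the induction closes. *)
Lemma Ck_comp k O f (h : R -> R) : open O ->
  (forall x, O x -> derivable h (f x) 1) -> Ck k O f ->
  (forall k', (k' < k)%N -> Ck k' O (h \o f) -> Ck k' O ('D_1 h \o f)) ->
  Ck k O (h \o f).
Proof.
move=> oO dh; elim: k => [|k IH] Cf Ch.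
  split=> // x Ox; apply: differentiable_comp; first exact: Cf.1.
  by apply/derivable1_diffP/dh.
have Chf : Ck k O (h \o f) by apply: IH (CkW Cf) _ => k' k'k; apply: Ch; exact: ltnW.
split=> [x Ox|i].
  apply: differentiable_comp; first exact: Cf.1.
  by apply/derivable1_diffP/dh.
have C1 := CkM oO (Ch k (ltnSn k) Chf) (Ck_pderiv i Cf).
apply: Ck_eq oO _ C1 => y Oy; rewrite pderiv_comp//; last exact: dh.
exact: Ck_differentiable Cf Oy.
Qed.

Lemma CkV k O f : open O -> (forall x, O x -> f x != 0) -> Ck k O f ->
  Ck k O (fun x => (f x)^-1).
Proof.
move=> oO f0 Cf; apply: (@Ck_comp k O f GRing.inv) => // [x Ox|k' k'k Ci].
  by apply: derivableV; [exact: f0|exact: derivable_id].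
apply: Ck_eq oO _ (CkM oO (Ck_cst k' O (-1)) (CkM oO Ci Ci)) => y Oy /=.
rewrite [RHS](deriveV (f0 _ Oy) (@derivable_id _ _ _ _)) derive_id.
by rewrite [_ *: _]mulr1 mulN1r -exprVn expr2.
Qed.

Lemma Ck_sqrt k O f : open O -> (forall x, O x -> 0 < f x) -> Ck k O f ->
  Ck k O (fun x => Num.sqrt (f x)).
Proof.
move=> oO f0 Cf; apply: (@Ck_comp k O f Num.sqrt) => // [x Ox|k' k'k Ci].
  by have [] := is_derive1_sqrt (f0 _ Ox).
have Cs : Ck k' O (fun x => (2 * Num.sqrt (f x))^-1).
  apply: CkV => // [x Ox|]; last exact: CkM oO (Ck_cst k' O 2) Ci.
  by rewrite mulf_neq0// gt_eqF// sqrtr_gt0 f0.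
by apply: Ck_eq oO _ Cs => y Oy /=; rewrite derive_sqrt// f0.
Qed.

End PartialDerivatives.

Section SymmetryOfSecondDerivatives.
Context {R : realType} {n : nat}.
Notation pt := 'rV[R]_n.
Implicit Types (O : set pt) (i : 'I_n) (f g : pt -> R) (x : pt).

Lemma is_derive_line f (p v : pt) (s : R) : derivable f (s *: v + p) v ->
  is_derive s 1 (fun t : R => f (t *: v + p)) ('D_v f (s *: v + p)).
Proof.
move=> df; have E : (fun h : R => h^-1 *: (((fun t : R => f (t *: v + p)) \o shift s) (h *: 1) - f (s *: v + p)))
   = (fun h : R => h^-1 *: ((f \o shift (s *: v + p)) (h *: v) - f (s *: v + p))).
  by apply/funext => h /=; rewrite [_%:A]mulr1 scalerDl addrA.
apply: DeriveDef; first by rewrite /derivable E.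
by rewrite /derive E.
Qed.

Lemma rv_norm_le x (C : R) : 0 <= C -> (forall i, `|x 0 i| <= C) -> `|x| <= C.
Proof.
move=> C0 xC; rewrite [leLHS]/Num.norm/= mx_normrE.
by apply: bigmax_le => // -[a b] _ /=; rewrite (ord1 a).
Qed.

Lemma coord_le_norm x i : `|x 0 i| <= `|x|.
Proof.
rewrite [leRHS]/Num.norm/= mx_normrE.
by apply/bigmax_geP; right; exists (0, i).
Qed.

Lemma norm_delta_le1 i : `|delta_mx 0 i : pt| <= 1.
Proof.
apply: rv_norm_le => // j.
by rewrite mxE; case: (_ && _); rewrite ?normr1 ?normr0.
Qed.

(** The second difference of f over the parallelogram spanned by h e_i and
   h e_j. It is symmetric in i and j, and the mean value theorem turns it into
   a first difference of a first partial derivative. *)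
Let second_difference f x (i j : 'I_n) (h : R) :=
  f (h *: delta_mx 0 i + (h *: delta_mx 0 j + x))
  - f (h *: delta_mx 0 i + x) - (f (h *: delta_mx 0 j + x) - f x).

Let second_differenceC f x i j h :
  second_difference f x i j h = second_difference f x j i h.
Proof.
rewrite /second_difference [_ + (_ + x)]addrCA.
ring.
Qed.

Let second_difference_approx O f x i j (e : R) : open O -> Ck 2 O f -> O x ->
  0 < e -> exists2 r : R, 0 < r & forall h : R, 0 < h -> h < r ->
  `|second_difference f x i j h - h ^+ 2 * pderiv j (pderiv i f) x|
    <= 3 * e * h ^+ 2.
Proof.
move=> oO Cf Ox e0.
set a : pt := delta_mx 0 i; set b : pt := delta_mx 0 j; set A := pderiv i f.
have dA : differentiable A x by exact: Ck_differentiable (Ck_pderiv i Cf) Ox.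
have [r /= r0 Hr] : exists2 r : R, 0 < r & forall y : pt, `|y| < r ->
    O (x + y) /\ `|A (y + x) - (A x + 'd A x y)| <= e * `|y|.
  have n0O : \forall y \near (0 : pt), O (x + y).
    by rewrite -(nbhs0P O); exact: open_nbhs_nbhs.
  have /nbhs_norm0P[r r0 Hr] : \forall y \near (0 : pt),
      O (x + y) /\ `|A (y + x) - (A x + 'd A x y)| <= e * `|y|.
    near=> y; split; first by near: y.
    by near: y; exact: differentiable_expansion.
  by exists r.
have a1 : `|a| <= 1 by exact: norm_delta_le1.
have b1 : `|b| <= 1 by exact: norm_delta_le1.
exists (r / 2); first by rewrite divr_gt0.
move=> h h0; rewrite ltr_pdivlMr// => hr.
have nab (s t : R) : 0 <= s -> s <= h -> 0 <= t -> t <= h -> `|s *: a + t *: b| <= s + t.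
  move=> s0 sh t0 th; apply: le_trans (ler_normD _ _) _.
  by rewrite !normrZ !ger0_norm// lerD// ler_piMr.
have inO (s t : R) : 0 <= s -> s <= h -> 0 <= t -> t <= h -> O (s *: a + (t *: b + x)).
  move=> s0 sh t0 th; rewrite addrA addrC; apply: (Hr _ _).1.
  by apply: le_lt_trans (nab _ _ s0 sh t0 th) _; apply: le_lt_trans hr; lra.
pose phi := fun s : R => f (s *: a + (h *: b + x)) - f (s *: a + (0 *: b + x)).
pose dphi := fun s : R => A (s *: a + (h *: b + x)) - A (s *: a + (0 *: b + x)).
have dline (s t : R) : 0 <= s -> s <= h -> 0 <= t -> t <= h ->
    is_derive s 1 (fun s : R => f (s *: a + (t *: b + x))) (A (s *: a + (t *: b + x))).
  move=> s0 sh t0 th; apply: is_derive_line; apply: diff_derivable.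
  exact: Ck_differentiable Cf (inO s t s0 sh t0 th).
have dphiP (s : R) : 0 <= s -> s <= h -> is_derive s 1 phi (dphi s).
  by move=> s0 sh; apply: is_deriveB; apply: dline => //; exact: ltW.
have [||s] := @MVT R phi dphi 0 h h0.
- by move=> s; rewrite in_itv/= => /andP[/ltW s0 /ltW sh]; exact: dphiP.
- apply: derivable_within_continuous => s; rewrite in_itv/= => /andP[s0 sh].
  by have [] := dphiP s s0 sh.
rewrite in_itv/= subr0 => /andP[/ltW s0 /ltW sh] phiE.
have -> : second_difference f x i j h = dphi s * h.
  by rewrite -phiE /phi /second_difference !scale0r !add0r.
have h0' := ltW h0.
have nsh := nab _ _ s0 sh h0' (lexx h).
have ns0 := nab _ _ s0 sh (lexx 0) h0'.
have [_ B1] := Hr (s *: a + h *: b) ltac:(apply: le_lt_trans nsh _; lra).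
have [_ B2] := Hr (s *: a + 0 *: b) ltac:(apply: le_lt_trans ns0 _; lra).
have dE : 'd A x (s *: a + h *: b) = 'd A x (s *: a) + h * 'd A x b.
  by rewrite linearD [X in _ + X]linearZ.
move: B1 B2; rewrite dE scale0r addr0 => B1 B2.
rewrite pderivE// -/b /dphi scale0r add0r [s *: a + (_ + _)]addrA.
move: B1 B2; set X := A (_ + _ + _); set Y := A (_ + x); set D := 'd A x b.
set E := 'd A x (s *: a) => B1 B2.
have -> : (X - Y) * h - h ^+ 2 * D =
    h * ((X - (A x + (E + h * D))) - (Y - (A x + E))) by ring.
rewrite normrM (gtr0_norm h0) expr2 mulrA [leRHS]mulrC ler_wpM2l//.
apply: le_trans (ler_normB _ _) _.
have e1 := ler_wpM2l (ltW e0) nsh; have e2 := ler_wpM2l (ltW e0) ns0.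
rewrite !addr0 scale0r addr0 in e2.
have e3 := ler_wpM2l (ltW e0) sh.
apply: le_trans (lerD (le_trans B1 e1) (le_trans B2 e2)) _.
by rewrite mulrDr -mulrA; move: (e * s) (e * h) e3 => p q pq; clear -pq; lra.
Unshelve. all: by end_near. Qed.

(** Both mixed derivatives are the limit of the symmetric second difference
   divided by h^2. *)
Lemma pderivC O f x i j : open O -> Ck 2 O f -> O x ->
  pderiv i (pderiv j f) x = pderiv j (pderiv i f) x.
Proof.
move=> oO Cf Ox; apply/eqP; rewrite -subr_eq0 -normr_le0; apply/ler_addgt0Pr => e e0.
have e6 : 0 < e / 6 by rewrite divr_gt0.
have [r r0 Hr] := second_difference_approx i j oO Cf Ox e6.
have [s s0 Hs] := second_difference_approx j i oO Cf Ox e6.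
pose h := Num.min r s / 2; have m0 : 0 < Num.min r s by rewrite lt_min r0.
have h0 : 0 < h by rewrite divr_gt0.
have hm : h < Num.min r s by rewrite /h; lra.
move: (hm); rewrite lt_min => /andP[hr hs].
have := Hr h h0 hr; have := Hs h h0 hs; rewrite second_differenceC.
set S := second_difference _ _ _ _ _; set A := pderiv i _ _; set B := pderiv j _ _.
have h2 : 0 < h ^+ 2 by rewrite exprn_gt0.
move=> H1 H2; rewrite add0r -(ler_pM2r h2) -[X in _ * X <= _](gtr0_norm h2) -normrM.
have -> : (A - B) * h ^+ 2 = (S - h ^+ 2 * B) - (S - h ^+ 2 * A) by ring.
apply: le_trans (ler_normB _ _) _; apply: le_trans (lerD H2 H1) _.
suff -> : 3 * (e / 6) * h ^+ 2 + 3 * (e / 6) * h ^+ 2 = e * h ^+ 2 by [].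
by field.
Qed.

End SymmetryOfSecondDerivatives.

Section SmoothFunctions.
Context {R : realType} {n : nat}.
Notation pt := 'rV[R]_n.
Implicit Types (O : set pt) (i : 'I_n) (f g : pt -> R) (x : pt).

Lemma smooth_differentiable O f x : smooth_on O f -> O x -> differentiable f x.
Proof. by move=> sf; exact: (sf [::]). Qed.

Lemma smooth_pderiv O f i : smooth_on O f -> smooth_on O (pderiv i f).
Proof. by move=> /smooth_onP sf; apply/smooth_onP => k; exact: Ck_pderiv. Qed.

Lemma smooth_eq O f g : open O -> (forall y, O y -> f y = g y) ->
  smooth_on O f -> smooth_on O g.
Proof. by move=> oO fg /smooth_onP sf; apply/smooth_onP => k; exact: Ck_eq fg _. Qed.

Lemma smooth_sub O O' f : O' `<=` O -> smooth_on O f -> smooth_on O' f.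
Proof. by move=> OO' /smooth_onP sf; apply/smooth_onP => k; exact: Ck_sub (sf k). Qed.

Lemma smooth_cst O (c : R) : smooth_on O (fun=> c).
Proof. by apply/smooth_onP => k; exact: Ck_cst. Qed.

Lemma smooth_coordinate O (j : 'I_n) : smooth_on O (fun x : pt => x 0 j).
Proof. by apply/smooth_onP => k; exact: Ck_coordinate. Qed.

Lemma smoothD O f g : open O -> smooth_on O f -> smooth_on O g ->
  smooth_on O (fun x => f x + g x).
Proof.
by move=> oO /smooth_onP sf /smooth_onP sg; apply/smooth_onP => k; exact: CkD.
Qed.

Lemma smoothM O f g : open O -> smooth_on O f -> smooth_on O g ->
  smooth_on O (fun x => f x * g x).
Proof.
by move=> oO /smooth_onP sf /smooth_onP sg; apply/smooth_onP => k; exact: CkM.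
Qed.

Lemma smoothN O f : open O -> smooth_on O f -> smooth_on O (fun x => - f x).
Proof.
move=> oO sf; apply: (smooth_eq oO _ (smoothM oO (@smooth_cst O (-1)) sf)) => y _.
by rewrite mulN1r.
Qed.

Lemma smoothB O f g : open O -> smooth_on O f -> smooth_on O g ->
  smooth_on O (fun x => f x - g x).
Proof. by move=> oO sf sg; apply: smoothD => //; exact: smoothN. Qed.

Lemma smoothV O f : open O -> (forall x, O x -> f x != 0) -> smooth_on O f ->
  smooth_on O (fun x => (f x)^-1).
Proof. by move=> oO f0 /smooth_onP sf; apply/smooth_onP => k; exact: CkV. Qed.

Lemma smooth_sqrt O f : open O -> (forall x, O x -> 0 < f x) -> smooth_on O f ->
  smooth_on O (fun x => Num.sqrt (f x)).
Proof. by move=> oO f0 /smooth_onP sf; apply/smooth_onP => k; exact: Ck_sqrt. Qed.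

Lemma smooth_sum O I (s : seq I) (P : pred I) (F : I -> pt -> R) : open O ->
  (forall j, P j -> smooth_on O (F j)) ->
  smooth_on O (fun x => \sum_(j <- s | P j) F j x).
Proof.
move=> oO sF; elim: s => [|j s IH].
  by apply: (smooth_eq oO _ (@smooth_cst O 0)) => y _; rewrite big_nil.
have [Pj|/negbTE nPj] := boolP (P j); last first.
  by apply: (smooth_eq oO _ IH) => y _; rewrite big_cons nPj.
by apply: (smooth_eq oO _ (smoothD oO (sF j Pj) IH)) => y _; rewrite big_cons Pj.
Qed.

Lemma smooth_prod O I (s : seq I) (F : I -> pt -> R) : open O ->
  (forall j, smooth_on O (F j)) -> smooth_on O (fun x => \prod_(j <- s) F j x).
Proof.
move=> oO sF; elim: s => [|j s IH].
  by apply: (smooth_eq oO _ (@smooth_cst O 1)) => y _; rewrite big_nil.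
by apply: (smooth_eq oO _ (smoothM oO (sF j) IH)) => y _; rewrite big_cons.
Qed.

Lemma differentiable_sum_seq I (s : seq I) (F : I -> pt -> R) x :
  (forall j, differentiable (F j) x) ->
  differentiable (fun y => \sum_(j <- s) F j y) x.
Proof.
move=> dF; elim: s => [|j s IH].
  rewrite (_ : (fun _ => _) = cst 0); first exact: differentiable_cst.
  by apply/funext => y; rewrite big_nil.
rewrite (_ : (fun _ => _) = (F j \+ (fun y => \sum_(j <- s) F j y))).
  exact: differentiableD (dF j) IH.
by apply/funext => y; rewrite big_cons.
Qed.

Lemma pderiv_sum I (s : seq I) (F : I -> pt -> R) i x :
  (forall j, differentiable (F j) x) ->
  pderiv i (fun y => \sum_(j <- s) F j y) x = \sum_(j <- s) pderiv i (F j) x.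
Proof.
move=> dF; elim: s => [|j s IH].
  rewrite (_ : (fun _ => _) = cst 0) ?pderiv_cst ?big_nil//.
  by apply/funext => y; rewrite big_nil.
rewrite (_ : (fun _ => _) = (fun y => F j y + \sum_(j <- s) F j y)).
  by rewrite pderivD// ?IH ?big_cons//; exact: differentiable_sum_seq.
by apply/funext => y; rewrite big_cons.
Qed.

End SmoothFunctions.

Section BumpFunctions.
Context {R : realType}.

Definition flat (m : nat) (t : R) : R :=
  if 0 < t then t^-1 ^+ m * expR (- t^-1) else 0.

Lemma flat_gt0 m t : 0 < t -> 0 < flat m t.
Proof. by move=> t0; rewrite /flat t0 mulr_gt0 ?expR_gt0 ?exprn_gt0 ?invr_gt0. Qed.

Lemma flat_ge0 m t : 0 <= flat m t.
Proof. by have [/(flat_gt0 m)/ltW//|t0] := ltP 0 t; rewrite /flat ltNge t0. Qed.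

(** The exponential dominates t^-(m+2), so that flat functions vanish to second
   order at 0 and are differentiable there. *)
Lemma flat_le_square m t : flat m t <= (m.+2)`!%:R * t ^+ 2.
Proof.
rewrite /flat; case: ifPn => t0; last by rewrite mulr_ge0 ?sqr_ge0.
have i0 : 0 <= t^-1 by rewrite invr_ge0 ltW.
have := expR_ge1Dxn m.+1 i0; rewrite expRN -(ler_pM2r (exprn_gt0 2 t0)) => H.
rewrite ler_pdivrMr ?expR_gt0//.
have f0 : (0 : R) < (m.+2)`!%:R by rewrite ltr0n fact_gt0.
have : t^-1 ^+ m <= (m.+2)`!%:R * ((1 + t^-1 ^+ m.+2 / (m.+2)`!%:R) * t ^+ 2).
  rewrite !exprS; move: (t^-1 ^+ m) (_`!%:R) f0 => u F f0.
  have -> : F * ((1 + t^-1 * (t^-1 * u) / F) * (t * (t * 1))) = F * t ^+ 2 + u.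
    by field; rewrite !gt_eqF.
  by rewrite lerDr mulr_ge0 ?sqr_ge0 ?ltW.
move=> /le_trans; apply; rewrite -[leRHS]mulrA ler_pM2l//.
by rewrite [leRHS]mulrC.
Qed.

Lemma is_derive_square_bound (f : R -> R) (C : R) : 
  (forall t, `|f t| <= C * t ^+ 2) -> is_derive (0 : R) (1 : R) f 0.
Proof.
move=> fC; have C0 : 0 <= C by have := fC 1; rewrite expr1n mulr1; exact: le_trans.
have f0 : f 0 = 0.
  by apply/eqP; rewrite -normr_le0 (le_trans (fC 0))// expr0n mulr0.
have L : h^-1 *: ((f \o shift 0) (h *: 1) - f 0) @[h --> (0 : R)^'] --> (0 : R).
  apply/cvgr0Pnorm_le => e e0; near=> h.
  have h0 : h != 0 by near: h; exact: nbhs_dnbhs_neq.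
  rewrite /= f0 subr0 addr0 [_%:A]mulr1 normrZ normfV.
  rewrite ler_pdivrMl ?normr_gt0//; apply: le_trans (fC h) _.
  rewrite -(real_normK (num_real h)) expr2 mulrA mulrC ler_wpM2l//.
  have : `|h| <= e / (C + 1).
    by near: h; apply: dnbhs0_le; rewrite divr_gt0// ltr_wpDl.
  rewrite ler_pdivlMr ?ltr_wpDl//; apply: le_trans.
  by rewrite mulrDr mulr1 mulrC lerDl.
by apply: DeriveDef; [apply/cvg_ex; exists 0|exact: cvg_lim].
Unshelve. all: by end_near. Qed.

(** Differentiation maps the span of the functions [flat m] to itself; this is
   why they are considered together with exp(-1/t), which is [flat 0]. *)
Lemma is_derive_flat m (t : R) :
  is_derive t (1 : R) (flat m) (flat m.+2 t - m%:R * flat m.+1 t).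
Proof.
have [t0|t0|->] := ltgtP t 0.
- have ft k : flat k t = 0 by rewrite /flat ltNge (ltW t0).
  rewrite !ft mulr0 subr0.
  have : {near t, cst 0 =1 flat m}.
    by near=> s; rewrite /flat ltNge ltW//; near: s; exact: lt_nbhsl.
  by move=> /near_eq_is_derive; apply; exact: is_derive_cst.
- have : {near t, (fun s : R => s^-1 ^+ m * expR (- s^-1)) =1 flat m}.
    near=> s; have s0 : 0 < s by near: s; exact: lt_nbhsr.
    by rewrite /flat s0.
  move=> /near_eq_is_derive; apply; rewrite /flat t0.
  have tn0 : t != 0 by rewrite gt_eqF.
  have dV := is_deriveV tn0 (is_derive_id t 1).
  have dE := @is_derive1_comp R expR (fun s => - s^-1) t _ _ (is_derive_expR (- t^-1)) (is_deriveN dV).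
  have dX := is_deriveX m dV.
  have := is_deriveM dX dE.
  have -> : ([eta GRing.inv] : R -> R) ^+ m * (expR \o (fun s : R => - s^-1)) =
      (fun s => s^-1 ^+ m * expR (- s^-1)).
    by apply/funext => s; rewrite !fctE.
  move=> H; apply: (is_derive_eq H); rewrite exprfctE /=.
  rewrite ![_%:A]mulr1 opprK /GRing.scale/=; case: m {dX H} => [|m] /=.
    by rewrite -exprVn !expr0; ring.
  by rewrite -exprVn !exprS; ring.
- have f0 k : flat k 0 = 0 by rewrite /flat ltxx.
  rewrite !f0 mulr0 subr0.
  apply: (@is_derive_square_bound _ (m.+2)`!%:R) => s.
  by rewrite ger0_norm ?flat_ge0 ?flat_le_square.
Unshelve. all: by end_near. Qed.

Context {n : nat}.
Notation pt := 'rV[R]_n.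
Implicit Types (O : set pt) (f : pt -> R) (x p : pt).

Lemma Ck_flat k O f m : open O -> Ck k O f -> Ck k O (flat m \o f).
Proof.
move=> oO; have dflat m' x : derivable (flat m') (f x) 1.
  by have [] := is_derive_flat m' (f x).
elim: k m => [|k IH] m Cf; apply: Ck_comp => // k' + _.
rewrite ltnS => k'k; apply: (Ck_le k'k).
have C1 := CkM oO (Ck_cst k O (- m%:R)) (IH m.+1 (CkW Cf)).
apply: (Ck_eq oO _ (CkD oO (IH m.+2 (CkW Cf)) C1)) => y Oy /=.
by have [_ ->] := is_derive_flat m (f y); rewrite mulNr.
Qed.

Definition sq_dist p x : R := \sum_i (x 0 i - p 0 i) ^+ 2.

Definition bumpf p (r : R) x : R := flat 0 (r ^+ 2 - sq_dist p x).

Lemma smooth_bumpf O p r : open O -> smooth_on O (bumpf p r).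
Proof.
move=> oO; have sd : smooth_on O (fun x => r ^+ 2 - sq_dist p x).
  apply: smoothB => //; first exact: smooth_cst.
  apply: smooth_sum => // i _.
  have sB : smooth_on O (fun x => x 0 i - p 0 i).
    by apply: smoothB => //; [exact: smooth_coordinate|exact: smooth_cst].
  exact: smoothM.
by apply/smooth_onP => k; apply: Ck_flat => //; move/smooth_onP: sd.
Qed.

Lemma bumpf_ge0 p r x : 0 <= bumpf p r x.
Proof. exact: flat_ge0. Qed.

Lemma bumpf_gt0 p r : 0 < r -> 0 < bumpf p r p.
Proof.
move=> r0; apply: flat_gt0; rewrite /sq_dist big1 ?subr0 ?exprn_gt0// => i _.
by rewrite subrr expr0n.
Qed.

Lemma bumpf_support p r x : 0 < r -> bumpf p r x != 0 -> `|x - p| <= r.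
Proof.
move=> r0; rewrite /bumpf /flat; case: ifPn; last by rewrite eqxx.
rewrite subr_gt0 => /ltW sr _; apply: rv_norm_le (ltW r0) _ => i.
rewrite !mxE -(ler_pXn2r (n := 2))// ?nnegrE ?(ltW r0)// real_normK ?num_real//.
apply: le_trans sr; rewrite /sq_dist (bigD1 i)//= lerDl.
by apply: sumr_ge0 => j _; exact: sqr_ge0.
Qed.

End BumpFunctions.
(** * Iterated integrals of compactly supported functions *)

Section IntegralOnTheLine.
Context {R : realType}.
Notation mu := (@lebesgue_measure R).
Implicit Types (h k : R -> R) (B C : R).

Definition vanishes_off B h := forall t, B < `|t| -> h t = 0.

Lemma vanishes_off_itv B h t : vanishes_off B h -> t \notin `[- B, B] -> h t = 0.
Proof.
by move=> hB; rewrite in_itv/= -ler_norml -ltNge; exact: hB.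
Qed.

Lemma Rintegral_restrict B h : vanishes_off B h ->
  Rintegral mu setT h = Rintegral mu `[- B, B] h.
Proof.
move=> hB; rewrite [RHS]Rintegral_mkcond; congr Rintegral; apply/funext => t.
rewrite patchE; case: ifPn => //.
by rewrite notin_setE/= => /negP tB; exact: vanishes_off_itv tB.
Qed.

Lemma vanishes_off_integrable B h : continuous h -> vanishes_off B h ->
  mu.-integrable setT (EFin \o h).
Proof.
move=> ch hB; have -> : EFin \o h = (EFin \o h) \_ `[- B, B].
  apply/funext => t; rewrite patchE; case: ifPn => //.
  by rewrite notin_setE/= => /negP tB; rewrite (vanishes_off_itv hB tB).
apply: (iffLR (integrable_mkcond _ _)) => //; apply: continuous_compact_integrable.
  exact: segment_compact.
exact: continuous_subspaceT.
Qed.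

Lemma Rintegral_cst_itv (a b c : R) : a <= b ->
  Rintegral mu `[a, b] (cst c) = c * (b - a).
Proof.
move=> ab; rewrite Rintegral_cst//; congr (_ * _).
rewrite [X in fine X](_ : _ = (b - a)%:E)//.
apply: (etrans (lebesgue_measure_itv `[a, b])); rewrite /= lte_fin.
by case: ltP => // ba; rewrite (_ : a = b) ?subrr//; apply/eqP; rewrite eq_le ab.
Qed.

Lemma norm_Rintegral_le B C h : 0 <= B -> continuous h -> vanishes_off B h ->
  (forall t, `|h t| <= C) -> `|Rintegral mu setT h| <= C * (2 * B).
Proof.
move=> B0 ch hB hC; rewrite (Rintegral_restrict hB).
have ih : mu.-integrable `[- B, B] (EFin \o h).
  apply: continuous_compact_integrable; first exact: segment_compact.
  exact: continuous_subspaceT.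
apply: le_trans (le_normr_Rintegral _ ih) _ => //.
have : Rintegral mu `[- B, B] (fun t => `|h t|) <= Rintegral mu `[- B, B] (cst C).
  apply: le_Rintegral => //.
    apply: continuous_compact_integrable; first exact: segment_compact.
    apply: continuous_subspaceT => t; apply: continuous_comp; first exact: ch.
    exact: norm_continuous.
  apply: continuous_compact_integrable; first exact: segment_compact.
  by apply: continuous_subspaceT => t; exact: cst_continuous.
move=> /le_trans; apply; rewrite Rintegral_cst_itv ?opprK ?mulrDl ?mul1r//.
by rewrite (le_trans _ B0)// oppr_le0.
Qed.

Lemma Rintegral_gt0 B h t0 : continuous h -> vanishes_off B h ->
  (forall t, 0 <= h t) -> 0 < h t0 -> 0 < Rintegral mu setT h.
Proof.
move=> ch hB h0 ht0.
have [d d0 Hd] : exists2 d : R, 0 < d & forall t, `|t - t0| <= d -> h t0 / 2 <= h t.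
  have lt2 : h t0 / 2 < h t0 by rewrite ltr_pdivrMr// ltr_pMr// ltr1n.
  have /nbhs_ballP[d d0 Hd] : \forall t \near t0, h t0 / 2 < h t.
    exact: (cvgr_gt _ (ch t0)).
  exists (d / 2); first by rewrite divr_gt0.
  move=> t tt0; apply/ltW/Hd; rewrite /ball/= distrC (le_lt_trans tt0)//.
  by rewrite ltr_pdivrMr// ltr_pMr// ltr1n.
have ih := vanishes_off_integrable ch hB.
have iD : mu.-integrable `[t0 - d, t0 + d] (EFin \o h).
  by apply: (integrableS _ _ _ ih).
have : Rintegral mu `[t0 - d, t0 + d] h <= Rintegral mu setT h.
  rewrite Rintegral_mkcond; apply: le_Rintegral => //.
    by rewrite -restrict_EFin; apply: (iffLR (integrable_mkcond _ _)).
  by move=> t _; rewrite patchE; case: ifP.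
apply: lt_le_trans.
have : Rintegral mu `[t0 - d, t0 + d] (cst (h t0 / 2)) <= Rintegral mu `[t0 - d, t0 + d] h.
  apply: le_Rintegral => //.
    apply: continuous_compact_integrable; first exact: segment_compact.
    by apply: continuous_subspaceT => t; exact: cst_continuous.
  move=> t; rewrite /= in_itv/= => /andP[a b]; apply: Hd.
  by rewrite ler_distl a b.
have dd : t0 - d < t0 + d by rewrite ltrBlDr -addrA ltrDl addr_gt0.
apply: lt_le_trans; rewrite Rintegral_cst_itv ?ltW// mulr_gt0 ?divr_gt0//.
by rewrite subr_gt0.
Qed.

Lemma Rintegral_derive B h k : vanishes_off B h -> vanishes_off B k ->
  continuous k -> (forall t : R, is_derive t (1 : R) h (k t)) ->
  Rintegral mu setT k = 0.
Proof.
move=> hB kB ck dh; pose A := `|B| + 1.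
have BA : B < A by rewrite (le_lt_trans (ler_norm B))// ltrDl.
have A0 : 0 < A by rewrite ltr_wpDl.
have kA : vanishes_off A k by move=> t At; apply: kB; exact: lt_trans At.
rewrite (Rintegral_restrict kA) /Rintegral (@continuous_FTC2 _ k h)//.
- by rewrite !hB ?normrN ?gtr0_norm// subee.
- by rewrite gtrN.
- exact: continuous_subspaceT.
- have ch : continuous h.
    move=> t; apply/differentiable_continuous/derivable1_diffP.
    by have [] := dh t.
  split.
  + by move=> t _; have [] := dh t.
  + exact/cvg_at_right_filter/ch.
  + exact/cvg_at_left_filter/ch.
- by move=> t _; rewrite derive1E; have [] := dh t.
Qed.

End IntegralOnTheLine.

Section CompactlySupported.
Context {R : realType}.

Lemma compact_norm_le n (p : 'rV[R]_n) (r : R) : 0 <= r ->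
  compact [set x | `|x - p| <= r].
Proof.
move=> r0; have -> : [set x | `|x - p| <= r] =
    [set x : 'rV[R]_n | forall i, `[p 0 i - r, p 0 i + r]%classic (x 0 i)].
  apply/seteqP; split=> [x /= xp i|x xp].
    rewrite in_itv/= -ler_distl; apply: le_trans xp.
    by have := coord_le_norm (x - p) i; rewrite !mxE.
  apply: rv_norm_le => // i; have := xp i.
  by rewrite /= in_itv/= -ler_distl !mxE.
apply: (@rV_compact _ _ (fun i => `[p 0 i - r, p 0 i + r]%classic)) => i.
exact: segment_compact.
Qed.

(** Uniform continuity, rather than continuity, is what passes to partial
   integrals, with a modulus that does not depend on the remaining variables. *)
Definition uc_supp n (B : R) (f : 'rV[R]_n -> R) : Prop :=
  (forall x : 'rV[R]_n, B < `|x| -> f x = 0) /\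
  (forall e : R, 0 < e -> exists2 d : R, 0 < d &
     forall x y : 'rV[R]_n, `|x - y| < d -> `|f x - f y| <= e).

Lemma continuous_uc_supp n (B : R) (f : 'rV[R]_n -> R) : continuous f ->
  (forall x : 'rV[R]_n, B < `|x| -> f x = 0) -> uc_supp B f.
Proof.
move=> cf fB; split=> // e e0.
have B1 : 0 <= `|B| + 1 by rewrite addr_ge0.
have /compact_near_coveringP cK := @compact_norm_le n 0 _ B1.
pose P (d : R) (x : 'rV[R]_n) := forall y : 'rV[R]_n, `|x - y| < d -> `|f x - f y| <= e.
have cP (x : 'rV[R]_n) : \forall x' \near x & d \near (0 : R)^'+, P d x'.
  have e2 : 0 < e / 2 by rewrite divr_gt0.
  have /cvgr_dist_le /(_ _ e2) /nbhs_normP[r /= r0 Hr] := cf x.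
  have r2 : 0 < r / 2 by rewrite divr_gt0.
  have nx : \forall x' \near x, `|x - x'| < r / 2.
    by apply/nbhs_normP; exists (r / 2).
  near=> x' d => y x'y.
  have xx' : `|x - x'| < r / 2 by near: x'.
  have dr : d < r / 2 by near: d; exact: nbhs_right_lt.
  have h1 : `|f x - f x'| <= e / 2.
    by apply: Hr => /=; apply: lt_trans xx' _; rewrite ltr_pdivrMr// ltr_pMr// ltr1n.
  have h2 : `|f x - f y| <= e / 2.
    apply: Hr => /=; rewrite -(subrKA x') (le_lt_trans (ler_normD _ _))//.
    by rewrite [r]splitr ltrD// (lt_trans x'y).
  by rewrite [e]splitr -(subrKA (f x)) (le_trans (ler_normD _ _))// lerD// distrC.
have [] := cK _ _ P _ (fun x _ => cP x) => d /= d0 Hd.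
exists (Num.min (d / 2) 1); first by rewrite lt_min divr_gt0/=.
move=> x y; rewrite lt_min => /andP[xd x1].
have d2 : 0 < d / 2 by rewrite divr_gt0.
have [xK|xK] := leP `|x| (`|B| + 1).
  apply: (Hd (d / 2)) => //=; last by rewrite subr0.
  by rewrite sub0r normrN gtr0_norm// ltr_pdivrMr// ltr_pMr// ltr1n.
have BB := ler_norm B.
have -> : f x = 0 by apply: fB; apply: lt_trans xK; rewrite (le_lt_trans BB)// ltrDl.
have -> : f y = 0.
  apply: fB; apply: le_lt_trans BB _; rewrite -(ltrD2r 1); apply: lt_trans xK _.
  rewrite -[x](subrK y) (le_lt_trans (ler_normD _ _))// addrC ltrD2l//.
by rewrite subrr normr0 ltW.
Unshelve. all: by end_near. Qed.

Lemma uc_suppZD n B (c : R) (f g : 'rV[R]_n -> R) : uc_supp B f -> uc_supp B g ->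
  uc_supp B (fun x => c * f x + g x).
Proof.
move=> [f0 fu] [g0 gu]; split=> [x xB|e e0]; first by rewrite f0// g0// mulr0 addr0.
have c1 : 0 < `|c| + 1 by rewrite ltr_wpDl.
have [d d0 Hd] := fu (e / 2 / (`|c| + 1)) (divr_gt0 (divr_gt0 e0 (ltr0Sn R 1)) c1).
have [d' d'0 Hd'] := gu (e / 2) (divr_gt0 e0 (ltr0Sn R 1)).
exists (Num.min d d'); first by rewrite lt_min d0.
move=> x y; rewrite lt_min => /andP[/Hd xd /Hd' xd'].
rewrite opprD addrACA -mulrBr [e]splitr (le_trans (ler_normD _ _))// lerD// normrM.
have : (`|c| + 1) * `|f x - f y| <= e / 2 by rewrite mulrC -ler_pdivlMr.
by apply: le_trans; rewrite ler_wpM2r// lerDl.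
Qed.

Definition row_cons m (t : R) (y : 'rV[R]_m) : 'rV[R]_m.+1 :=
  row_mx (t%:M : 'M[R]_1) y.

Lemma row_cons0 m t (y : 'rV[R]_m) : row_cons t y 0 ord0 = t.
Proof. by rewrite /row_cons mxE; case: splitP => // j _; rewrite ord1 mxE eqxx. Qed.

Lemma row_consS m t (y : 'rV[R]_m) i : row_cons t y 0 (lift ord0 i) = y 0 i.
Proof. by rewrite -rshift1; exact: row_mxEr. Qed.

Lemma row_consP m (x z : 'rV[R]_m.+1) : x 0 ord0 = z 0 ord0 ->
  (forall i, x 0 (lift ord0 i) = z 0 (lift ord0 i)) -> x = z.
Proof. by move=> e0 eS; apply/rowP => i; have [j|] := unliftP ord0 i => [->|->]. Qed.

Lemma row_cons_eta m (x : 'rV[R]_m.+1) :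
  x = row_cons (x 0 ord0) (\row_i x 0 (lift ord0 i)).
Proof. by apply: row_consP => [|i]; rewrite ?row_cons0 ?row_consS ?mxE. Qed.

Lemma row_consB m t s (y z : 'rV[R]_m) :
  row_cons t y - row_cons s z = row_cons (t - s) (y - z).
Proof.
apply: row_consP => [|i]; rewrite [LHS]mxE [X in _ + X]mxE ?row_cons0//.
by rewrite !row_consS !mxE.
Qed.

Lemma norm_row_cons m t (y : 'rV[R]_m) : `|row_cons t y| = Num.max `|t| `|y|.
Proof.
apply/eqP; rewrite eq_le; apply/andP; split.
  apply: rv_norm_le => [|i]; first by rewrite le_max normr_ge0.
  have [j ->|->] := unliftP ord0 i; last by rewrite row_cons0 le_max lexx.
  by rewrite row_consS le_max coord_le_norm orbT.
rewrite ge_max -{1}(row_cons0 t y) coord_le_norm/=.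
by apply: rv_norm_le => // i; rewrite -(row_consS t y) coord_le_norm.
Qed.

Lemma slice_uc_supp m B t (f : 'rV[R]_m.+1 -> R) : uc_supp B f ->
  uc_supp B (fun y => f (row_cons t y)).
Proof.
move=> [f0 fu]; split=> [y yB|e e0].
  by apply: f0; rewrite norm_row_cons lt_max yB orbT.
have [d d0 Hd] := fu e e0; exists d => // x y xy; apply: Hd.
by rewrite row_consB subrr norm_row_cons normr0 gt_max d0.
Qed.

Lemma slice_eq0 m B t (f : 'rV[R]_m.+1 -> R) y : uc_supp B f -> B < `|t| ->
  f (row_cons t y) = 0.
Proof. by move=> [f0 _] Bt; apply: f0; rewrite norm_row_cons lt_max Bt. Qed.

Lemma iintS m (f : 'rV[R]_m.+1 -> R) :
  iint f = Rintegral (@lebesgue_measure R) setT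
             (fun t => iint (fun y => f (row_cons t y))).
Proof. by []. Qed.

Lemma eq_iint n (f g : 'rV[R]_n -> R) : f =1 g -> iint f = iint g.
Proof. by move=> /funext->. Qed.

End CompactlySupported.

Section IteratedIntegral.
Context {R : realType}.
Variable B : R.
Hypothesis B0 : 0 <= B.

Let iint_linear_at m := forall (c : R) (f g : 'rV[R]_m -> R),
  uc_supp B f -> uc_supp B g ->
  iint (fun x => c * f x + g x) = c * iint f + iint g.

Let iint_bounded_at m := forall (C : R) (f : 'rV[R]_m -> R), uc_supp B f ->
  (forall x, `|f x| <= C) -> `|iint f| <= C * (2 * B) ^+ m.

Let partial_iint m (f : 'rV[R]_m.+1 -> R) (t : R) : R :=
  iint (fun y => f (row_cons t y)).

Let partial_iint_continuous m (f : 'rV[R]_m.+1 -> R) : iint_linear_at m ->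
  iint_bounded_at m -> uc_supp B f ->
  continuous (partial_iint f) /\ vanishes_off B (partial_iint f).
Proof.
move=> lin bnd uf; split=> [t|t Bt]; last first.
  apply/eqP; rewrite -normr_le0 -[leRHS](mul0r ((2 * B) ^+ m)).
  apply: bnd; first exact: slice_uc_supp.
  by move=> y; rewrite (slice_eq0 _ uf Bt) normr0.
apply/cvgrPdist_le => e e0.
have K0 : 0 < (2 * B) ^+ m + 1 by rewrite ltr_wpDl// exprn_ge0// mulr_ge0.
have [d d0 Hd] := uf.2 (e / ((2 * B) ^+ m + 1)) (divr_gt0 e0 K0).
apply/nbhs_normP; exists d => //= s ts.
have -> : partial_iint f t - partial_iint f s =
    iint (fun y => -1 * f (row_cons s y) + f (row_cons t y)).
  by rewrite lin ?mulN1r 1?addrC//; exact: slice_uc_supp.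
have H : `|iint (fun y => -1 * f (row_cons s y) + f (row_cons t y))|
    <= e / ((2 * B) ^+ m + 1) * (2 * B) ^+ m.
  apply: bnd; first by apply: uc_suppZD; exact: slice_uc_supp.
  move=> y; rewrite mulN1r addrC; apply: Hd.
  by rewrite row_consB subrr norm_row_cons normr0 gt_max ts (le_lt_trans _ ts).
apply: le_trans H _; rewrite mulrAC ler_pdivrMr// ler_wpM2l ?(ltW e0)// lerDl ler01//.
Qed.

(** Linearity and the bound are proved together, as each step in the dimension
   needs both to see that partial integrals are continuous. *)
Let iint_linear_bounded m : iint_linear_at m /\ iint_bounded_at m.
Proof.
elim: m => [|m [lin bnd]]; first by split=> [c f g _ _ //|C f _ fC]; rewrite expr0 mulr1; exact: fC.
split=> [c f g uf ug|C f uf fC].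
- have [cf vf] := partial_iint_continuous lin bnd uf.
  have [cg vg] := partial_iint_continuous lin bnd ug.
  have if_ := vanishes_off_integrable cf vf.
  have ig := vanishes_off_integrable cg vg.
  have [ccf vcf] : continuous (fun t => c * partial_iint f t) /\
      vanishes_off B (fun t => c * partial_iint f t).
    split=> [t|t /vf->]; last exact: mulr0.
    by apply: continuousM; [exact: cst_continuous|exact: cf].
  have icf := vanishes_off_integrable ccf vcf.
  rewrite !iintS -RintegralZl// -RintegralD//.
  congr Rintegral; apply/funext => t.
  by rewrite lin//; exact: slice_uc_supp.
- have [cf vf] := partial_iint_continuous lin bnd uf.
  rewrite exprSr mulrA; apply: norm_Rintegral_le => // t.
  by apply: bnd => //; exact: slice_uc_supp.
Qed.

Lemma iint_linear m (c : R) (f g : 'rV[R]_m -> R) : uc_supp B f -> uc_supp B g ->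
  iint (fun x => c * f x + g x) = c * iint f + iint g.
Proof. by move: c f g; have [] := iint_linear_bounded m. Qed.

Lemma norm_iint_le m (C : R) (f : 'rV[R]_m -> R) : uc_supp B f ->
  (forall x, `|f x| <= C) -> `|iint f| <= C * (2 * B) ^+ m.
Proof. by move: C f; have [] := iint_linear_bounded m. Qed.

Lemma iint_cst0 m : iint (fun _ : 'rV[R]_m => 0 : R) = 0.
Proof.
have u0 : uc_supp B (fun _ : 'rV[R]_m => 0 : R).
  by split=> // e e0; exists 1 => // x y _; rewrite subrr normr0 ltW.
apply/eqP; rewrite -normr_le0 -[leRHS](mul0r ((2 * B) ^+ m)).
by apply: norm_iint_le => // x; rewrite normr0.
Qed.

Lemma uc_supp_sum m I (s : seq I) (F : I -> 'rV[R]_m -> R) :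
  (forall j, uc_supp B (F j)) -> uc_supp B (fun x => \sum_(j <- s) F j x).
Proof.
move=> uF; elim: s => [|j s IH].
  split=> [x _|e e0]; first by rewrite big_nil.
  by exists 1 => // x y _; rewrite !big_nil subrr normr0 ltW.
rewrite (_ : (fun _ => _) = (fun x => 1 * F j x + \sum_(j <- s) F j x)).
  exact: uc_suppZD.
by apply/funext => x; rewrite big_cons mul1r.
Qed.

Lemma iint_sum m I (s : seq I) (F : I -> 'rV[R]_m -> R) :
  (forall j, uc_supp B (F j)) ->
  iint (fun x => \sum_(j <- s) F j x) = \sum_(j <- s) iint (F j).
Proof.
move=> uF; elim: s => [|j s IH].
  rewrite big_nil -[RHS](iint_cst0 m); apply: eq_iint => x; exact: big_nil.
rewrite big_cons -IH -[iint (F j)]mul1r -iint_linear//; last exact: uc_supp_sum.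
by apply: eq_iint => x; rewrite big_cons mul1r.
Qed.

Lemma iint_ge0 m (f : 'rV[R]_m -> R) : (forall y, 0 <= f y) -> 0 <= iint f.
Proof.
elim: m f => [|m IH] f f0; first exact: f0.
by rewrite iintS; apply: Rintegral_ge0 => s _; apply: IH => y; exact: f0.
Qed.

Lemma iint_gt0 m (f : 'rV[R]_m -> R) x : uc_supp B f -> (forall y, 0 <= f y) ->
  0 < f x -> 0 < iint f.
Proof.
elim: m f x => [|m IH] f x uf f0 fx; first by rewrite /= -(thinmx0 x).
have [lin bnd] := iint_linear_bounded m.
have [cf vf] := partial_iint_continuous lin bnd uf.
rewrite iintS; apply: (@Rintegral_gt0 _ _ _ (x 0 ord0)) cf vf _ _ => [t|].
  by apply: iint_ge0 => y; exact: f0.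
apply: (IH _ (\row_i x 0 (lift ord0 i))) => //; first exact: slice_uc_supp.
by rewrite -row_cons_eta.
Qed.

Lemma increment_le (h : R -> R) (k : R -> R) (t e : R) : 
  (forall s : R, is_derive s (1 : R) h (k s)) ->
  (forall s, `|s| <= `|t| -> `|k s - k 0| <= e) ->
  `|h t - h 0 - t * k 0| <= `|t| * e.
Proof.
move=> dh ke; have ch : continuous h.
  by move=> s; apply/differentiable_continuous/derivable1_diffP; have [] := dh s.
have [s st ->] : exists2 s, `|s| <= `|t| & h t - h 0 = k s * t.
  have [t0|t0] := leP 0 t.
    have [|s] := @MVT_segment R h k 0 t t0 (fun s _ => dh s).
      exact: continuous_subspaceT.
    by rewrite in_itv/= subr0 => /andP[s0 st] ?; exists s => //; rewrite !ger0_norm.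
  have [|s] := @MVT_segment R h k t 0 (ltW t0) (fun s _ => dh s).
    exact: continuous_subspaceT.
  rewrite in_itv/= sub0r => /andP[s0 st] H; exists s.
    by rewrite !ler0_norm ?lerN2// ltW.
  by rewrite -opprB H mulrN opprK.
by rewrite [t * _]mulrC -mulrBl normrM mulrC ler_wpM2l// ke.
Qed.

(** In the direction of the outermost variable, differentiate under the integral
   sign and apply the fundamental theorem of calculus to the partial integral,
   which has compact support; the other directions follow by slicing. *)
Lemma iint_pderiv m (i : 'I_m) (f : 'rV[R]_m -> R) : uc_supp B f ->
  uc_supp B (pderiv i f) -> (forall x, derivable f x (delta_mx 0 i)) ->
  iint (pderiv i f) = 0.
Proof.
elim: m i f => [[]//|m IH] i f uf udf df.
have [j ij|i0] := unliftP ord0 i.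
  have slice_quot t y h : h *: delta_mx 0 i + row_cons t y =
      row_cons t (h *: delta_mx 0 j + y) :> 'rV[R]_m.+1.
    apply: row_consP => [|k]; rewrite [LHS]mxE ?row_cons0 ?row_consS !mxE ij.
      by rewrite mulr0 add0r.
    by rewrite (inj_eq lift_inj).
  have E t y : (fun h : R => h^-1 *: ((f \o shift (row_cons t y)) (h *: delta_mx 0 i)
       - f (row_cons t y))) =
     (fun h : R => h^-1 *: (((fun y => f (row_cons t y)) \o shift y) (h *: delta_mx 0 j)
       - f (row_cons t y))).
    by apply/funext => h /=; rewrite slice_quot.
  have E' t : (fun y => pderiv i f (row_cons t y)) = pderiv j (fun y => f (row_cons t y)).
    by apply/funext => y; rewrite /pderiv /derive E.
  rewrite iintS (_ : (fun t => _) = cst 0) ?Rintegral_cst ?mul0r//.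
  apply/funext => t /=; rewrite E'; apply: IH.
  - exact: slice_uc_supp.
  - by rewrite -E'; exact: slice_uc_supp.
  - by move=> y; have := df (row_cons t y); rewrite /derivable E.
have [lin bnd] := iint_linear_bounded m.
have [cf vf] := partial_iint_continuous lin bnd uf.
have [cdf vdf] := partial_iint_continuous lin bnd udf.
rewrite iintS; apply: (@Rintegral_derive _ B (partial_iint f)) => // t.
have shiftE s y : s *: delta_mx 0 i + row_cons t y = row_cons (s + t) y :> 'rV[R]_m.+1.
  apply: row_consP => [|k]; rewrite [LHS]mxE ?row_cons0 ?row_consS !mxE i0.
    by rewrite eqxx mulr1.
  by rewrite mulr0 add0r.
have L : h^-1 *: ((partial_iint f \o shift t) (h *: 1) - partial_iint f t)
    @[h --> (0 : R)^'] --> partial_iint (pderiv i f) t.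
  apply/cvgrPdist_le => e e0.
  have K0 : 0 < (2 * B) ^+ m + 1 by rewrite ltr_wpDl// exprn_ge0// mulr_ge0.
  have [d d0 Hd] := udf.2 (e / ((2 * B) ^+ m + 1)) (divr_gt0 e0 K0).
  near=> h; have h0 : h != 0 by near: h; exact: nbhs_dnbhs_neq.
  have hd : `|h| < d by near: h; exact: dnbhs0_lt.
  rewrite /= [_%:A]mulr1 -(ler_pM2l (_ : 0 < `|h|)) ?normr_gt0// -normrM mulrBr.
  rewrite [h^-1 *: _]/(h^-1 * _) mulrA divff// mul1r distrC.
  pose q y := - h * pderiv i f (row_cons t y)
    + (-1 * f (row_cons t y) + f (row_cons (h + t) y)).
  have uq0 : uc_supp B (fun y => -1 * f (row_cons t y) + f (row_cons (h + t) y)).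
    by apply: uc_suppZD; exact: slice_uc_supp.
  have uq : uc_supp B q by apply: uc_suppZD uq0; exact: slice_uc_supp.
  have -> : partial_iint f (h + t) - partial_iint f t
      - h * partial_iint (pderiv i f) t = iint q.
    rewrite [RHS]lin//; last exact: slice_uc_supp.
    by rewrite lin; [rewrite mulNr mulN1r [RHS]addrC; congr (_ - _); rewrite addrC|exact: slice_uc_supp..].
  have qle y : `|q y| <= `|h| * (e / ((2 * B) ^+ m + 1)).
    pose phi (s : R) := f (s *: delta_mx 0 i + row_cons t y).
    pose dphi (s : R) := pderiv i f (s *: delta_mx 0 i + row_cons t y).
    have -> : q y = phi h - phi 0 - h * dphi 0.
      by rewrite /q /phi /dphi !shiftE add0r; ring.
    apply: increment_le => s; first by apply: is_derive_line; exact: df.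
    move=> sh; apply: Hd; rewrite !shiftE row_consB subrr norm_row_cons normr0.
    by rewrite add0r addrK gt_max d0 (le_lt_trans sh).
  apply: le_trans (bnd _ _ uq qle) _.
  rewrite -mulrA ler_pM2l ?normr_gt0// mulrAC ler_pdivrMr//.
  by rewrite ler_wpM2l ?(ltW e0)// lerDl ler01.
by apply: DeriveDef; [apply/cvg_ex; exists (partial_iint (pderiv i f) t)|exact: cvg_lim].
Unshelve. all: by end_near. Qed.

End IteratedIntegral.

Section FundamentalLemma.
Context {R : realType} {n : nat}.
Notation pt := 'rV[R]_n.
Implicit Types (O S : set pt) (f q phi : pt -> R) (x p : pt).

Lemma Ck_setU k O O' f : Ck k O f -> Ck k O' f -> Ck k (O `|` O') f.
Proof.
elim: k f => [|k IH] f Cf Cf'; apply: Ck_intro => [x [] Ox|k' // [<-] i].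
- exact: Ck_differentiable Cf Ox.
- exact: Ck_differentiable Cf' Ox.
- exact: Ck_differentiable Cf Ox.
- exact: Ck_differentiable Cf' Ox.
- by apply: IH; exact: Ck_pderiv.
Qed.

(** The domain is covered by O and the complement of the closed set S, and f is
   smooth on both. *)
Lemma smooth_extend0 O S f : closed S -> S `<=` O -> smooth_on O f ->
  (forall x, ~ S x -> f x = 0) -> smooth_on setT f.
Proof.
move=> cS SO sf f0; apply/smooth_onP => k.
have -> : setT = O `|` ~` S.
  by apply/seteqP; split=> // x _; have [/SO|] := pselect (S x); [left|right].
apply: Ck_setU; first by move/smooth_onP: sf.
by apply: Ck_eq (Ck_cst k _ 0) => [|x /f0->//]; exact: closed_openC.
Qed.

Definition test_function O phi : Prop :=
  smooth_on setT phi /\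
  exists S, [/\ compact S, S `<=` O & forall x, ~ S x -> phi x = 0].

Lemma closed_norm_le p (r : R) : 0 <= r -> closed [set x : pt | `|x - p| <= r].
Proof.
by move=> r0; apply: compact_closed; [exact: norm_hausdorff|exact: compact_norm_le].
Qed.

Lemma smooth_setT_continuous f : smooth_on setT f -> continuous f.
Proof.
by move=> sf x; apply: differentiable_continuous; exact: smooth_differentiable sf _.
Qed.

(** If the equation failed at a point, the defect would have a constant sign
   near it, and a bump function supported there would give a nonzero integral
   after integration by parts. *)
Lemma weak_divergence O q (w : 'I_n -> pt -> R) : open O -> smooth_on O q ->
  (forall i, smooth_on O (w i)) ->
  (forall phi, test_function O phi ->
     iint (fun x => phi x * q x + \sum_i pderiv i phi x * w i x) = 0) ->
  forall x, O x -> q x = \sum_i pderiv i (w i) x.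
Proof.
move=> oO sq sw wk x0 Ox0; apply/eqP; rewrite -subr_eq0; apply/eqP.
pose r x := q x - \sum_i pderiv i (w i) x; rewrite -[LHS]/(r x0).
have sr : smooth_on O r.
  by apply: smoothB => //; apply: smooth_sum => // i _; exact: smooth_pderiv.
apply: contrapT => /eqP r0; pose s := Num.sg (r x0).
have sr0 : 0 < s * r x0 by rewrite -normrEsg normr_gt0.
have [d d0 Hd] : exists2 d : R, 0 < d & forall x, `|x - x0| <= d -> O x /\ 0 < s * r x.
  have cr : {for x0, continuous (fun x => s * r x)}.
    apply: differentiable_continuous; apply: differentiableM.
      exact: differentiable_cst.
    exact: smooth_differentiable sr _.
  have n1 : \forall x \near x0, 0 < s * r x by exact: (cvgr_gt _ cr).
  have n2 : \forall x \near x0, O x by exact: open_nbhs_nbhs.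
  have /nbhs_normP[e /= e0 He] : \forall x \near x0, O x /\ 0 < s * r x.
    by near=> x; split; near: x.
  exists (e / 2); first by rewrite divr_gt0.
  move=> x xx0; apply: He => /=; rewrite distrC (le_lt_trans xx0)//.
  by rewrite ltr_pdivrMr// ltr_pMr// ltr1n.
pose S := [set x | `|x - x0| <= d].
have cS : closed S by apply: closed_norm_le; exact: ltW.
have SO : S `<=` O by move=> x /Hd[].
pose phi := bumpf x0 d.
have phi0 x : ~ S x -> phi x = 0.
  by move=> nS; apply/eqP; apply: contra_notT nS => /(bumpf_support d0).
have sphi O' : open O' -> smooth_on O' phi by exact: smooth_bumpf.
have tphi : test_function O phi.
  by split; [exact: sphi openT|exists S; split=> //; apply: compact_norm_le; exact: ltW].
(* All the integrands vanish off the ball of radius B about the origin. *)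
pose B := `|x0| + d; have B0 : 0 <= B by rewrite addr_ge0// ltW.
have off x : B < `|x| -> ~ S x.
  move=> Bx Sx; move: Bx; rewrite ltNge => /negP; apply.
  by rewrite -[x in `|x|](subrK x0) (le_trans (ler_normD _ _))// addrC lerD2l.
have smphi f : smooth_on O f -> smooth_on setT (fun x => phi x * f x).
  move=> sf; apply: (smooth_extend0 cS SO) => [|x /phi0->]; last by rewrite mul0r.
  by apply: smoothM => //; exact: sphi.
have ucphi f : smooth_on O f -> uc_supp B (fun x => phi x * f x).
  move=> sf; apply: continuous_uc_supp; first exact/smooth_setT_continuous/smphi.
  by move=> x /off/phi0->; rewrite mul0r.
have ucdphi i f : smooth_on O f -> uc_supp B (pderiv i (fun x => phi x * f x)).
  move=> sf; apply: continuous_uc_supp.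
    by apply/smooth_setT_continuous/smooth_pderiv/smphi.
  move=> x /off nSx; rewrite -(pderiv_cst i 0 x).
  apply: (pderiv_open i (closed_openC cS)) nSx => y /phi0->.
  by rewrite mul0r.
have dw i : iint (pderiv i (fun x => phi x * w i x)) = 0.
  apply: (iint_pderiv B0) => [||x]; [exact: ucphi|exact: ucdphi|].
  by apply: diff_derivable; apply: smooth_differentiable (smphi _ (sw i)) _.
pose D x := \sum_i pderiv i (fun x => phi x * w i x) x.
have uD : uc_supp B D by apply: uc_supp_sum => i; exact: ucdphi.
have iD : iint D = 0.
  by rewrite (iint_sum B0)// ?big1// => i; exact: ucdphi.
have E : iint (fun x => phi x * r x) = 0.
  have := iint_linear B0 1 uD (ucphi r sr); rewrite iD mulr0 add0r => <-.
  rewrite -(wk phi tphi); apply: eq_iint => x.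
  rewrite mul1r /r mulrBr [X in _ - X]mulr_sumr addrCA; congr (_ + _).
  rewrite /D -sumrB; apply: eq_bigr => i _.
  have [Ox|nOx] := pselect (O x).
    rewrite pderivM ?addrK//; last exact: smooth_differentiable (sw i) Ox.
    by apply: smooth_differentiable (sphi _ openT) _.
  have nSx : ~ S x by move=> /SO.
  have z f : pderiv i (fun x => phi x * f x) x = 0.
    rewrite -(pderiv_cst i 0 x).
    by apply: (pderiv_open i (closed_openC cS)) nSx => y /phi0->; rewrite mul0r.
  have := z (fun=> 1); rewrite (_ : (fun _ => _) = phi); last first.
    by apply/funext => y; rewrite mulr1.
  by move=> ->; rewrite z phi0// !mul0r subrr.
have ur := ucphi r sr.
have : 0 < iint (fun x => s * (phi x * r x) + 0).
  apply: (iint_gt0 B0 (x := x0)).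
  - apply: uc_suppZD => //.
    by split=> // e e0; exists 1 => // x y _; rewrite subrr normr0 ltW.
  - move=> x; rewrite addr0 mulrCA; have [/Hd[_ /ltW rx]|/phi0->] := pselect (S x).
      by rewrite mulr_ge0// bumpf_ge0.
    by rewrite mul0r.
  - by rewrite addr0 mulrCA mulr_gt0// bumpf_gt0.
rewrite (_ : (fun _ => _) = (fun x => (s - 1) * (phi x * r x) + phi x * r x)).
  by rewrite (iint_linear B0)// E mulr0 addr0 ltxx.
by apply/funext => x; rewrite mulrBl mul1r subrK addr0.
Unshelve. all: by end_near. Qed.

End FundamentalLemma.

Section WeakDivergence.
Context {R : realType} {n : nat}.
Notation pt := 'rV[R]_n.
Implicit Types (O : set pt) (phi q f h : pt -> R).

Lemma test_function_uc_supp O f : test_function O f ->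
  exists B0 : R, forall B, B0 <= B -> uc_supp B f.
Proof.
move=> [sf [S [/compact_bounded[M [_ HM]] _ f0]]]; exists (M + 1) => B MB.
apply: continuous_uc_supp => [|x Bx]; first exact: smooth_setT_continuous.
apply: f0 => Sx; have MB' : M < B by rewrite (lt_le_trans _ MB)// ltrDl.
by have /= := HM B MB' x Sx; rewrite leNgt Bx.
Qed.

Lemma iint_testB O f h : test_function O f -> test_function O h ->
  iint (fun x => f x - h x) = iint f - iint h.
Proof.
move=> /test_function_uc_supp[B1 uf] /test_function_uc_supp[B2 uh].
pose B : R := `|B1| + `|B2|.
have B0 : 0 <= B by rewrite addr_ge0.
have uf' : uc_supp B f by apply: uf; rewrite (le_trans (ler_norm B1))// lerDl.
have uh' : uc_supp B h by apply: uh; rewrite (le_trans (ler_norm B2))// lerDr.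
have := iint_linear B0 (-1) uh' uf'; rewrite mulN1r [RHS]addrC => <-.
by apply: eq_iint => x; rewrite mulN1r addrC.
Qed.

(** Both sides are integrals of compactly supported smooth functions, as the
   coefficients may be extended by 0 off the support of phi. *)
Lemma weak_divergence_test O q (w : 'I_n -> pt -> R) : open O -> smooth_on O q ->
  (forall i, smooth_on O (w i)) ->
  (forall phi, test_function O phi ->
     iint (fun x => \sum_i pderiv i phi x * w i x) = iint (fun x => phi x * q x)) ->
  forall x, O x -> q x = - \sum_i pderiv i (w i) x.
Proof.
move=> oO sq sw wk x Ox; apply: oppr_inj; rewrite opprK.
have sq' : smooth_on O (fun y => - q y) by exact: smoothN.
apply: (weak_divergence oO sq' sw) Ox => phi tphi.
have [sphi [S [cS SO phi0]]] := tphi.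
have clS : closed S by apply: compact_closed cS; exact: norm_hausdorff.
have test k f : (forall y, ~ S y -> k y = 0) -> smooth_on O k -> smooth_on O f ->
    test_function O (fun y => k y * f y).
  move=> k0 sk sf; split; last by exists S; split=> // y /k0->; rewrite mul0r.
  apply: (smooth_extend0 clS SO) => [|y /k0->]; last by rewrite mul0r.
  exact: smoothM.
have sub f : smooth_on setT f -> smooth_on O f by exact: smooth_sub.
have dphi0 i y : ~ S y -> pderiv i phi y = 0.
  move=> nSy; rewrite -(pderiv_cst i 0 y).
  by apply: (pderiv_open i (closed_openC clS)) nSy => z /phi0->.
have tw : test_function O (fun y => \sum_i pderiv i phi y * w i y).
  split; last first.
    by exists S; split=> // y nSy; rewrite big1// => i _; rewrite dphi0// mul0r.
  apply: smooth_sum => [|i _]; first exact: openT.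
  by have [] := test _ _ (dphi0 i) (sub _ (smooth_pderiv i sphi)) (sw i).
have := iint_testB tw (test _ _ phi0 (sub _ sphi) sq).
rewrite wk// subrr => E; rewrite -[RHS]E; apply: eq_iint => y.
by rewrite mulrN addrC.
Qed.

End WeakDivergence.
(** * Exterior and interior multiplication *)

Section ExteriorAlgebra.
Context {R : realType} {n : nat}.
Notation C := R[i].
Notation endo := 'M[C]_(dimL n).
Notation ext k := (@extm R n k).
Notation int k := (@intm R n k).
Implicit Types (j k l m : 'I_n) (I J : {set 'I_n}) (A B : 'M[R]_n).
Implicit Types (v w X Y : 'rV[R]_n) (a : R).

Definition bform J : 'cV[C]_(dimL n) := delta_mx (enum_rank J) 0.

Lemma mulmx_bform p (A : 'M[C]_(p, dimL n)) J : A *m bform J = col (enum_rank J) A.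
Proof. by rewrite colE. Qed.

Lemma bformE J I : bform J (enum_rank I) 0 = (I == J)%:R.
Proof. by rewrite mxE eqxx andbT (inj_eq enum_rank_inj). Qed.

Lemma eq_on_bform p (A B : 'M[C]_(p, dimL n)) :
  (forall J, A *m bform J = B *m bform J) -> A = B.
Proof.
move=> AB; apply/matrixP => i j; have /colP/(_ i) := AB (enum_val j).
by rewrite !mulmx_bform !mxE enum_valK.
Qed.

Definition lower_sign k J : C := (-1) ^+ #|[set j in J | (j < k)%N]|.

Lemma lower_sign_sqr k J : lower_sign k J * lower_sign k J = 1.
Proof. by rewrite -expr2 sqrr_sign. Qed.

Lemma lower_signU k l J : l \notin J ->
  lower_sign k (l |: J) = (if (l < k)%N then -1 else 1) * lower_sign k J.
Proof.
move=> lJ; rewrite /lower_sign; case: ifPn => lk.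
  have -> : [set j in l |: J | (j < k)%N] = l |: [set j in J | (j < k)%N].
    by apply/setP => j; rewrite !inE; case: eqP => [->|].
  by rewrite cardsU1 !inE (negbTE lJ)/= exprS.
rewrite mul1r; congr (_ ^+ #|pred_of_set _|); apply/setP => j; rewrite !inE.
by case: eqP => [->|]//=; rewrite (negbTE lJ) (negbTE lk).
Qed.

Lemma lower_signUk k J : lower_sign k (k |: J) = lower_sign k J.
Proof.
congr (_ ^+ #|pred_of_set _|); apply/setP => j; rewrite !inE.
by case: eqP => [->|]//=; rewrite ltnn andbF.
Qed.

Lemma lower_signD1k k J : lower_sign k (J :\ k) = lower_sign k J.
Proof.
congr (_ ^+ #|pred_of_set _|); apply/setP => j; rewrite !inE.
by case: eqP => [->|]//=; rewrite ltnn andbF.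
Qed.

Lemma extm_bform k J : ext k *m bform J =
  if k \in J then 0 else lower_sign k J *: bform (k |: J).
Proof.
rewrite mulmx_bform; apply/colP => I; rewrite !mxE enum_rankK.
case: ifPn => kJ /=; rewrite ?kJ /= mxE// -[I in bform _ I]enum_valK bformE /=.
by case: eqP => _; rewrite ?mulr1 ?mulr0.
Qed.

Lemma intm_bform k J : int k *m bform J =
  if k \in J then lower_sign k J *: bform (J :\ k) else 0.
Proof.
rewrite mulmx_bform; apply/colP => I; rewrite !mxE enum_rankK.
case: ifPn => kJ; rewrite mxE /=; last first.
  case: ifP => // /andP[_ /eqP JI]; by rewrite JI finset.setU11 in kJ.
have -> : (k \notin enum_val I) && (J == k |: enum_val I) = (enum_val I == J :\ k).
  apply/andP/eqP => [[kI /eqP->]|->]; last by rewrite finset.setD11 finset.setD1K.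
  by rewrite finset.setU1K.
rewrite -[I in bform _ I]enum_valK bformE /=.
by case: eqP => [->|_]; rewrite ?mulr1 ?mulr0// -[RHS]lower_signD1k.
Qed.

Lemma extm_sqr k : ext k *m ext k = 0.
Proof.
apply: eq_on_bform => J; rewrite -mulmxA extm_bform mul0mx.
by case: ifP => _; rewrite ?mulmx0// -scalemxAr extm_bform finset.setU11 scaler0.
Qed.

Lemma ltn_sign_swap k l : k != l ->
  (if (k < l)%N then -1 else 1) = - (if (l < k)%N then -1 else 1) :> C.
Proof. by rewrite -val_eqE neq_ltn => /orP[] kl; rewrite kl ltnNge (ltnW kl) ?opprK. Qed.

(** Passing l over k changes the number of smaller indices for exactly one of the
   two orders, see [ltn_sign_swap]. *)
Lemma extmC k l : ext k *m ext l = - (ext l *m ext k).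
Proof.
have [->|kl] := eqVneq k l; first by rewrite extm_sqr oppr0.
apply: eq_on_bform => J; rewrite mulNmx -!mulmxA !extm_bform.
have [lJ|lJ] := boolP (l \in J); have [kJ|kJ] := boolP (k \in J);
  rewrite ?mulmx0 ?oppr0// -!scalemxAr !extm_bform !inE ?lJ ?kJ ?orbT ?scaler0 ?oppr0//.
rewrite (negbTE lJ) (negbTE kJ) [l == k]eq_sym (negbTE kl) /=.
rewrite !scalerA -scaleNr finset.setUCA !lower_signU// (ltn_sign_swap kl).
by congr (_ *: _); ring.
Qed.

Lemma intmC k l : int k *m int l = - (int l *m int k).
Proof. by rewrite /intm -!trmx_mul extmC linearN. Qed.

Lemma ext_int_anticomm k l : ext k *m int l + int l *m ext k = (k == l)%:R%:M.
Proof.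
apply: eq_on_bform => J; rewrite mulmxDl -!mulmxA extm_bform intm_bform mul_scalar_mx.
have [->|kl] := eqVneq k l.
  have [lJ|lJ] := boolP (l \in J); rewrite mulmx0 ?addr0 ?add0r -scalemxAr.
    by rewrite extm_bform finset.setD11 scalerA finset.setD1K// lower_signD1k lower_sign_sqr.
  by rewrite intm_bform finset.setU11 scalerA finset.setU1K// lower_signUk lower_sign_sqr.
rewrite scale0r; have lk : (l == k) = false by rewrite eq_sym (negbTE kl).
case: ifPn => lJ; case: ifPn => kJ; rewrite ?mulmx0 ?add0r ?addr0 -?scalemxAr.
- by rewrite extm_bform !inE kJ kl scaler0.
- have lK : l \notin J :\ l by rewrite finset.setD11.
  have kK : k \notin J :\ l by rewrite inE (negbTE kJ) andbF.
  have kln : k \notin l |: (J :\ l) by rewrite finset.setD1K.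
  have lkn : l \notin k |: (J :\ l) by rewrite !inE lk eqxx.
  rewrite -(finset.setD1K lJ); move: (J :\ l) lK kK kln lkn => K lK kK kln lkn.
  rewrite finset.setU1K// extm_bform (negbTE kK) finset.setUCA.
  rewrite intm_bform finset.setU11 finset.setU1K// !scalerA -scalerDl lower_signUk.
  rewrite !lower_signUk [lower_sign k (l |: K)]lower_signU//.
  rewrite [lower_sign l (k |: K)]lower_signU// (ltn_sign_swap kl).
  by rewrite (_ : _ + _ = 0) ?scale0r//; case: ifP => _; ring.
- by [].
- by rewrite intm_bform !inE lk (negbTE lJ) scaler0.
Qed.

Definition extv (v : 'rV[R]_n) : endo := \sum_k (v 0 k)%:C *: ext k.

Lemma wedgeE (G : 'M[R]_n) (X : 'rV[R]_n) : wedge G X = extv (X *m G).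
Proof. by []. Qed.

(** The derivation of the exterior algebra with matrix A on covectors: all
   connection and curvature forms of the bundle of forms are of this shape. *)
Definition deriv_op A : endo := \sum_j \sum_m (A j m)%:C *: (ext j *m int m).

Lemma ext_int_swap k l : int k *m ext l = (l == k)%:R%:M - ext l *m int k.
Proof. by rewrite -ext_int_anticomm addrC addKr. Qed.

Lemma extv_zmod_morphism : zmod_morphism extv.
Proof.
move=> u v; rewrite /extv -sumrB; apply: eq_bigr => k _.
by rewrite !mxE rmorphB scalerBl.
Qed.
HB.instance Definition _ := GRing.isZmodMorphism.Build _ _ extv extv_zmod_morphism.

Lemma contr_zmod_morphism : zmod_morphism (@contr R n).
Proof.
move=> u v; rewrite /contr -sumrB; apply: eq_bigr => k _.
by rewrite !mxE rmorphB scalerBl.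
Qed.
HB.instance Definition _ := GRing.isZmodMorphism.Build _ _ (@contr R n) contr_zmod_morphism.

Lemma deriv_op_zmod_morphism : zmod_morphism deriv_op.
Proof.
move=> A B; rewrite /deriv_op -sumrB; apply: eq_bigr => j _.
by rewrite -sumrB; apply: eq_bigr => m _; rewrite !mxE rmorphB scalerBl.
Qed.
HB.instance Definition _ :=
  GRing.isZmodMorphism.Build _ _ deriv_op deriv_op_zmod_morphism.

Lemma extvZ a v : extv (a *: v) = a%:C *: extv v.
Proof. by rewrite /extv scaler_sumr; apply: eq_bigr => k _; rewrite mxE rmorphM scalerA. Qed.

Lemma contrZ a v : contr (a *: v) = a%:C *: contr v.
Proof. by rewrite /contr scaler_sumr; apply: eq_bigr => k _; rewrite mxE rmorphM scalerA. Qed.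

Lemma deriv_opZ a A : deriv_op (a *: A) = a%:C *: deriv_op A.
Proof.
rewrite /deriv_op scaler_sumr; apply: eq_bigr => j _; rewrite scaler_sumr.
by apply: eq_bigr => m _; rewrite mxE rmorphM scalerA.
Qed.

Lemma sum_delta (V : lmodType C) (F : 'I_n -> V) k :
  \sum_m (k == m)%:R *: F m = F k.
Proof.
rewrite (bigD1 k)//= eqxx scale1r big1 ?addr0// => m mk.
by rewrite eq_sym (negbTE mk) scale0r.
Qed.

Lemma extv_anticomm v w : extv v *m extv w + extv w *m extv v = 0.
Proof.
rewrite /extv !mulmx_suml.
under eq_bigr do rewrite mulmx_sumr.
under [X in _ + X]eq_bigr do rewrite mulmx_sumr.
rewrite [X in _ + X]exchange_big -big_split big1// => k _ /=.
rewrite -big_split big1// => l _ /=.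
rewrite -!scalemxAl -!scalemxAr extmC !scalerA [X in _ + X *: _]mulrC.
by rewrite scalerN addNr.
Qed.

Lemma contr_anticomm X Y : contr X *m contr Y + contr Y *m contr X = 0.
Proof.
rewrite /contr !mulmx_suml.
under eq_bigr do rewrite mulmx_sumr.
under [Z in _ + Z]eq_bigr do rewrite mulmx_sumr.
rewrite [Z in _ + Z]exchange_big -big_split big1// => k _ /=.
rewrite -big_split big1// => l _ /=.
rewrite -!scalemxAl -!scalemxAr intmC !scalerA [Z in _ + Z *: _]mulrC.
by rewrite scalerN addNr.
Qed.

Lemma extv_contr_anticomm v X :
  extv v *m contr X + contr X *m extv v = ((v *m X^T) 0 0)%:C%:M.
Proof.
rewrite /extv /contr !mulmx_suml.
under eq_bigr do rewrite mulmx_sumr.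
under [Z in _ + Z]eq_bigr do rewrite mulmx_sumr.
rewrite [Z in _ + Z]exchange_big -big_split /=.
rewrite mxE rmorph_sum raddf_sum /=; apply: eq_bigr => k _.
rewrite -big_split [X^T _ _]mxE rmorphM -[RHS](sum_delta (fun l => ((v 0 k)%:C * (X 0 l)%:C)%:M)).
apply: eq_bigr => l _ /=.
rewrite -!scalemxAl -!scalemxAr !scalerA [X in _ + X *: _]mulrC -scalerDr.
by rewrite ext_int_anticomm !scale_scalar_mx mulrC.
Qed.

Lemma deriv_op_extm A k :
  deriv_op A *m ext k - ext k *m deriv_op A = \sum_j (A j k)%:C *: ext j.
Proof.
rewrite /deriv_op mulmx_suml mulmx_sumr -sumrB; apply: eq_bigr => j _.
rewrite mulmx_suml mulmx_sumr -sumrB -[RHS](sum_delta (fun m => (A j m)%:C *: ext j)).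
apply: eq_bigr => m _; rewrite -scalemxAl -scalemxAr -scalerBr -mulmxA ext_int_swap.
rewrite mulmxBr mulmxA [ext j *m ext k]extmC mulNmx opprK mulmxA addrK.
by rewrite mul_mx_scalar !scalerA mulrC.
Qed.

Lemma deriv_op_intm A k :
  deriv_op A *m int k - int k *m deriv_op A = - \sum_m (A k m)%:C *: int m.
Proof.
rewrite -[X in _ = - X](sum_delta (fun j => \sum_m (A j m)%:C *: int m)) -sumrN.
rewrite /deriv_op mulmx_suml mulmx_sumr -sumrB; apply: eq_bigr => j _.
rewrite mulmx_suml mulmx_sumr -sumrB scaler_sumr -sumrN; apply: eq_bigr => m _.
rewrite -scalemxAl -scalemxAr -scalerBr !mulmxA ext_int_swap mulmxBl -!mulmxA.
rewrite [int k *m int m]intmC mulmxN opprK opprD addrCA subrr addr0.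
by rewrite mul_scalar_mx scalerN !scalerA mulrC eq_sym.
Qed.

Lemma deriv_op_extv A v :
  deriv_op A *m extv v - extv v *m deriv_op A = extv (v *m A^T).
Proof.
rewrite /extv mulmx_sumr mulmx_suml -sumrB.
under eq_bigr do rewrite -scalemxAl -scalemxAr -scalerBr deriv_op_extm scaler_sumr.
rewrite exchange_big; apply: eq_bigr => j _ /=.
rewrite mxE rmorph_sum scaler_suml; apply: eq_bigr => k _.
by rewrite scalerA mxE rmorphM.
Qed.

Lemma deriv_op_contr A X :
  deriv_op A *m contr X - contr X *m deriv_op A = - contr (X *m A).
Proof.
rewrite /contr mulmx_sumr mulmx_suml -sumrB.
under eq_bigr do rewrite -scalemxAl -scalemxAr -scalerBr deriv_op_intm scalerN scaler_sumr.
rewrite sumrN; congr (- _); rewrite exchange_big; apply: eq_bigr => j _ /=.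
rewrite mxE rmorph_sum scaler_suml; apply: eq_bigr => k _.
by rewrite scalerA rmorphM.
Qed.

(** A commutator of derivations is a derivation, and is therefore given by its
   matrix on covectors. *)
Lemma deriv_op_comm A B :
  deriv_op A *m deriv_op B - deriv_op B *m deriv_op A = deriv_op (A *m B - B *m A).
Proof.
have H k m : deriv_op A *m (ext k *m int m) - ext k *m int m *m deriv_op A =
   \sum_j (A j k)%:C *: (ext j *m int m) - \sum_l (A m l)%:C *: (ext k *m int l).
  have -> : deriv_op A *m (ext k *m int m) - ext k *m int m *m deriv_op A =
    (deriv_op A *m ext k - ext k *m deriv_op A) *m int m
    + ext k *m (deriv_op A *m int m - int m *m deriv_op A).
    by rewrite mulmxBl mulmxBr !mulmxA addrA subrK.
  rewrite deriv_op_extm deriv_op_intm mulmxN mulmx_suml mulmx_sumr.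
  by congr (_ - _); apply: eq_bigr => j _; [rewrite -scalemxAl|rewrite -scalemxAr].
rewrite {2 3}/deriv_op mulmx_sumr mulmx_suml -sumrB.
under eq_bigr => k _.
  rewrite mulmx_sumr mulmx_suml -sumrB.
  under eq_bigr => m _ do rewrite -scalemxAl -scalemxAr -scalerBr H scalerBr.
  over.
under eq_bigr do rewrite sumrB.
rewrite sumrB [RHS]raddfB /=; congr (_ - _).
  under eq_bigr => k _ do (under eq_bigr => m _ do rewrite scaler_sumr).
  rewrite /deriv_op; under [RHS]eq_bigr => j _.
    under eq_bigr => m _ do rewrite mxE rmorph_sum scaler_suml.
    rewrite exchange_big; over.
  rewrite [RHS]exchange_big; apply: eq_bigr => k _; rewrite [RHS]exchange_big.
  by apply: eq_bigr => m _; apply: eq_bigr => j _ /=; rewrite scalerA rmorphM mulrC.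
rewrite /deriv_op; apply: eq_bigr => k _.
under [RHS]eq_bigr => m _ do rewrite mxE rmorph_sum scaler_suml.
rewrite [RHS]exchange_big; apply: eq_bigr => m _; rewrite scaler_sumr.
by apply: eq_bigr => j _ /=; rewrite scalerA rmorphM.
Qed.

End ExteriorAlgebra.
(** * The inner product of forms *)

Section SortedEnumeration.
Variable n : nat.
Implicit Types (I J : {set 'I_n}) (l x : 'I_n).

Lemma nth_rem (T : eqType) (x0 l : T) (s : seq T) a : l \in s ->
  nth x0 (rem l s) a = nth x0 s (bump (index l s) a).
Proof.
move=> ls; rewrite remE nth_cat size_take -/(index l s) index_mem ls /bump.
have [al|la] := ltnP a (index l s); first by rewrite nth_take.
by rewrite nth_drop addSn subnKC.
Qed.

Lemma enum_setD1 I l : enum (I :\ l) = rem l (enum I).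
Proof.
rewrite rem_filter ?enum_uniq// /enum_mem -filter_predI; apply: eq_filter => x.
by rewrite /= !inE.
Qed.

Lemma index_enum_set I l : l \in I -> index l (enum I) = #|[set j in I | (j < l)%N]|.
Proof.
move=> lI; have -> : #|[set j in I | (j < l)%N]| = count (fun j : 'I_n => (j < l)%N) (enum I).
  rewrite cardE -size_filter; apply/perm_size/uniq_perm.
  - exact: enum_uniq.
  - by rewrite filter_uniq// enum_uniq.
  - by move=> j; rewrite mem_enum inE [RHS]mem_filter mem_enum andbC.
have srt : sorted (fun i j : 'I_n => (i < j)%N) (enum I).
  have tr : transitive (fun i j : 'I_n => (i < j)%N) by move=> ? ? ?; exact: ltn_trans.
  rewrite /enum_mem (sorted_filter tr)// -enumT.
  by rewrite -(@sorted_map _ _ val ltn) val_enum_ord iota_ltn_sorted.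
have : l \in enum I by rewrite mem_enum.
elim: (enum I) srt => //= x s IH; rewrite path_sortedE; last by move=> ? ? ?; exact: ltn_trans.
move=> /andP[/allP xs srt]; rewrite inE eq_sym; case: eqP => [<- _|_ /= ls].
  rewrite ltnn add0n; symmetry; apply/eqP; rewrite eqn0Ngt -has_count.
  by apply/hasPn => y /xs xy; rewrite -leqNgt ltnW.
by rewrite xs// IH.
Qed.

End SortedEnumeration.

Section CompoundMatrix.
Context {R : realType} {n : nat}.
Notation C := R[i].
Notation endo := 'M[C]_(dimL n).
Notation ext k := (@extm R n k).
Implicit Types (k l : 'I_n) (I J : {set 'I_n}) (A B : 'M[R]_n).

Let submatrix A (x0 : 'I_n) p (s t : seq 'I_n) : 'M[R]_p :=
  \matrix_(a, b) A (nth x0 s a) (nth x0 t b).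

Lemma set_minorE A (x0 : 'I_n) p I J : #|I| = p -> #|J| = p ->
  set_minor A I J = \det (submatrix A x0 p (enum I) (enum J)).
Proof.
move=> Ip Jp; rewrite /set_minor; case: eqP => [e|]; last by rewrite Ip Jp.
subst p; congr (\det _); apply/matrixP => a b; rewrite !mxE.
by rewrite !(enum_val_nth x0).
Qed.

Lemma set_minor_card A I J : #|I| <> #|J| -> set_minor A I J = 0.
Proof. by move=> IJ; rewrite /set_minor; case: eqP. Qed.

Lemma set_minor0 A I : set_minor A I finset.set0 = (I == finset.set0)%:R.
Proof.
case: eqP => [->|I0]; last first.
  by apply: set_minor_card => /eqP; rewrite finset.cards0 cards_eq0 => /eqP.
rewrite /set_minor; case: eqP => // e.
by move: (\matrix_(a, b) _); rewrite finset.cards0 => M; rewrite det_mx00.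
Qed.

Lemma set_minor_tr A I J : set_minor A^T I J = set_minor A J I.
Proof.
have [IJ|IJ] := eqVneq #|I| #|J|; last first.
  by rewrite !set_minor_card//; [move=> /esym|]; exact/eqP.
have [I0|/set0Pn[x0 _]] := eqVneq I finset.set0.
  have J0 : J = finset.set0 by apply/eqP; rewrite -cards_eq0 -IJ I0 finset.cards0.
  by rewrite I0 J0 !set_minor0.
rewrite (set_minorE _ x0 IJ erefl) (set_minorE _ x0 erefl IJ) -det_tr.
by congr (\det _); apply/matrixP => a b; rewrite !mxE.
Qed.

(** Laplace expansion along the column of k: the minors with one column more
   are obtained from those with one column less. The second case holds because
   then the determinant has two equal columns. *)
Lemma set_minor_expand A k I J :
  \sum_(l in I) (A l k)%:C * lower_sign l I * (set_minor A (I :\ l) J)%:C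
  = (if k \in J then 0 else lower_sign k J * (set_minor A I (k |: J))%:C) :> C.
Proof.
have [IJ|IJ] := eqVneq #|I| #|J|.+1; last first.
  rewrite big1 => [|l lI].
    case: ifPn => // kJ; rewrite set_minor_card ?mulr0// cardsU1 kJ add1n.
    exact/eqP.
  rewrite set_minor_card ?mulr0//; apply/eqP; apply: contra IJ.
  by rewrite (cardsD1 l I) lI add1n eqSS.
set p := #|J| in IJ.
pose B := submatrix A k p.+1 (enum I) (k :: enum J).
have sg_index l : l \in I -> lower_sign l I = (-1) ^+ index l (enum I) :> C.
  by move=> lI; rewrite index_enum_set.
have -> : \sum_(l in I) (A l k)%:C * lower_sign l I * (set_minor A (I :\ l) J)%:C
    = (\det B)%:C.
  pose G a := let l := nth k (enum I) a in
    (A l k)%:C * lower_sign l I * (set_minor A (I :\ l) J)%:C : C.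
  rewrite big_enum_val (eq_bigr (fun i : 'I_#|I| => G i)); last first.
    by move=> i _; rewrite /G (enum_val_nth k).
  rewrite -(big_mkord xpredT G) IJ big_mkord (expand_det_col B ord0) rmorph_sum.
  apply: eq_bigr => a _; rewrite /G; set l := nth k (enum I) a.
  have aI : (a < size (enum I))%N by rewrite -cardE IJ.
  have lI : l \in I by rewrite -mem_enum mem_nth.
  have ia : index l (enum I) = a by rewrite index_uniq// enum_uniq.
  have cIl : #|I :\ l| = p by apply/eqP; rewrite -eqSS -IJ (cardsD1 l I) lI.
  rewrite (sg_index l lI) ia (set_minorE A k cIl erefl) enum_setD1.
  rewrite /cofactor addn0 !rmorphM rmorphXn rmorphN1 /= mulrA.
  rewrite /B mxE /=; congr (_ * (\det _)%:C); apply/matrixP => a' b'; rewrite !mxE.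
  by rewrite nth_rem ?mem_enum// ia.
case: ifPn => kJ.
  have kp : (index k (enum J) < p)%N by rewrite /p cardE index_mem mem_enum.
  rewrite -det_tr (@determinant_alternate _ _ _ ord0 (lift ord0 (Ordinal kp)))//.
  by move=> a; rewrite !mxE /= nth_index// mem_enum.
have kJ' : k \in k |: J by rewrite finset.setU11.
have cJ : #|k |: J| = p.+1 by rewrite cardsU1 kJ.
rewrite (set_minorE A k IJ cJ); set B' := submatrix _ _ _ _ _.
have bp : (index k (enum (k |: J)) < p.+1)%N by rewrite -cJ cardE index_mem mem_enum.
pose b0 := Ordinal bp.
have Bcof a : cofactor B' a b0 = (-1) ^+ b0 * cofactor B a ord0.
  rewrite /cofactor addn0 exprD mulrA [(-1) ^+ b0 * _]mulrC; congr (_ * \det _).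
  apply/matrixP => a' b'; rewrite !mxE /=; congr (A _ _).
  by rewrite -(nth_rem _ _ (_ : k \in enum (k |: J))) ?mem_enum// -enum_setD1 finset.setU1K.
rewrite (expand_det_col B ord0) (expand_det_col B' b0) -lower_signUk /lower_sign -index_enum_set//.
rewrite (_ : (-1) ^+ _ = ((-1) ^+ b0)%:C) -?rmorphM /=; last by rewrite rmorphXn rmorphN1.
rewrite mulr_sumr; congr (_%:C); apply: eq_bigr => a _.
rewrite Bcof -[index _ _]/(nat_of_ord b0) [RHS]mulrCA signrMK; congr (_ * _).
by rewrite !mxE nth_index// mem_enum.
Qed.

(** The matrix of the map induced by A on the exterior algebra; for the inverse
   of the metric matrix it is the Gram matrix of the inner product of forms. *)
Definition compound A : endo :=
  \matrix_(I, J) (set_minor A (enum_val I) (enum_val J))%:C.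

Lemma tr_compound A : (compound A)^T = compound A^T.
Proof. by apply/matrixP => I J; rewrite !mxE set_minor_tr. Qed.

Lemma compound_bform A I J :
  (compound A *m bform J) (enum_rank I) 0 = (set_minor A I J)%:C.
Proof. by rewrite mulmx_bform !mxE !enum_rankK. Qed.

Lemma compound_bform0 A : compound A *m bform finset.set0 = bform finset.set0.
Proof.
apply/colP => I; rewrite -[I]enum_valK compound_bform set_minor0 bformE.
by rewrite rmorph_nat.
Qed.

Lemma extm_entry l (v : 'cV[C]_(dimL n)) I : (ext l *m v) (enum_rank I) 0 =
  if l \in I then lower_sign l I * v (enum_rank (I :\ l)) 0 else 0.
Proof.
have -> : (ext l *m v) (enum_rank I) 0 = (v^T *m (intm l *m bform I)) 0 0.
  rewrite mulmxA -trmx_mul mulmx_bform !mxE; apply: eq_bigr => K _; rewrite !mxE.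
  by [].
rewrite intm_bform; case: ifP => _; last by rewrite mulmx0 mxE.
by rewrite -scalemxAr mulmx_bform !mxE.
Qed.

(** The induced map is a homomorphism for the exterior product; in components
   this is the Laplace expansion. *)
Lemma compound_extm A k :
  compound A *m ext k = extv (row k A^T) *m compound A.
Proof.
apply: eq_on_bform => J; rewrite -!mulmxA extm_bform; apply/colP => I0.
rewrite -[I0]enum_valK; set I := enum_val I0.
rewrite /extv mulmx_suml summxE.
under eq_bigr => l _ do rewrite -scalemxAl mxE extm_entry compound_bform !mxE.
transitivity (if k \in J then 0 else lower_sign k J * (set_minor A I (k |: J))%:C : C).
  by case: ifP => _; [rewrite mulmx0 mxE|rewrite -scalemxAr mxE compound_bform].
rewrite -set_minor_expand [RHS](bigID (mem I)) /= [X in _ + X]big1 ?addr0; last first.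
  by move=> l /negbTE ->; rewrite mulr0.
by apply: eq_bigr => l ->; rewrite mulrA.
Qed.

(** The dx^k generate the exterior algebra from the form 1, so the
   intertwining relations propagate the value there to all forms. *)
Lemma intertwiner_uniq (E : 'I_n -> endo) (X Y : endo) :
  X *m bform finset.set0 = Y *m bform finset.set0 ->
  (forall k, X *m ext k = E k *m X) -> (forall k, Y *m ext k = E k *m Y) -> X = Y.
Proof.
move=> XY0 XE YE; apply: eq_on_bform => J; move: {2}#|J| (erefl #|J|) => p.
elim: p J => [J /eqP|p IH J Jp]; first by rewrite cards_eq0 => /eqP->.
have /card_gt0P[k kJ] : (0 < #|J|)%N by rewrite Jp.
have cJk : #|J :\ k| = p by apply/eqP; rewrite -eqSS -Jp (cardsD1 k J) kJ.
have -> : bform J = lower_sign k J *: (ext k *m bform (J :\ k)).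
  rewrite extm_bform finset.setD11 scalerA lower_signD1k lower_sign_sqr scale1r.
  by rewrite finset.setD1K.
by rewrite -!scalemxAr !mulmxA XE YE -!mulmxA IH.
Qed.

Lemma compound1 : compound 1%:M = 1%:M.
Proof.
apply: (@intertwiner_uniq (fun k => extv (row k 1%:M))) => [|k|k].
- by rewrite compound_bform0 mul1mx.
- by rewrite compound_extm trmx1.
rewrite mul1mx mulmx1 -[LHS](sum_delta (fun l => ext l)) /extv.
by apply: eq_bigr => l _; rewrite !mxE rmorph_nat.
Qed.

(** Both sides intertwine exterior multiplications in the same way, which avoids
   the Cauchy-Binet formula. *)
Lemma compoundM A B : compound A *m compound B = compound (A *m B).
Proof.
apply: (@intertwiner_uniq (fun k => extv (row k (A *m B)^T))) => [|k|k].
- by rewrite -mulmxA !compound_bform0.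
- rewrite -mulmxA compound_extm mulmxA {1}/extv mulmx_sumr [RHS]mulmxA; congr (_ *m _).
  under eq_bigr => l _ do rewrite -scalemxAr compound_extm.
  rewrite (_ : row k _ = \sum_l B l k *: row l A^T) ?raddf_sum /=.
    rewrite mulmx_suml; apply: eq_bigr => l _.
    by rewrite extvZ -scalemxAl !mxE.
  apply/rowP => m; rewrite summxE !mxE; apply: eq_bigr => l _.
  by rewrite !mxE mulrC.
- exact: compound_extm.
Qed.

End CompoundMatrix.
(** * Calculus of matrix-valued functions *)

Section MatrixCalculus.
Context {R : realType} {n : nat}.
Notation pt := 'rV[R]_n.
Notation C := R[i].
Variable O : set pt.
Hypothesis oO : open O.
Implicit Types (i : 'I_n) (x : pt).

Lemma pderiv_mxE p q i (F : pt -> 'M[R]_(p, q)) x k l :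
  pderiv_mx i F x k l = pderiv i (fun y => F y k l) x.
Proof. by rewrite mxE. Qed.

Section Real.
Variables p q r : nat.
Implicit Types (F G : pt -> 'M[R]_(p, q)).

Lemma smooth_mx_eq F G : (forall y, O y -> F y = G y) ->
  smooth_mx O F -> smooth_mx O G.
Proof.
by move=> FG sF k l; apply: (smooth_eq oO _ (sF k l)) => y Oy; rewrite FG.
Qed.

Lemma pderiv_mx_eq i F G x : (forall y, O y -> F y = G y) -> O x ->
  pderiv_mx i F x = pderiv_mx i G x.
Proof.
move=> FG Ox; apply/matrixP => k l; rewrite !mxE.
by apply: (pderiv_open i oO) Ox => y Oy; rewrite FG.
Qed.

Lemma smooth_mx_pderiv i F : smooth_mx O F -> smooth_mx O (pderiv_mx i F).
Proof.
move=> sF k l; apply: (smooth_eq oO _ (smooth_pderiv i (sF k l))) => y Oy.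
by rewrite mxE.
Qed.

Lemma smooth_mx_cst (A : 'M[R]_(p, q)) : smooth_mx O (fun=> A).
Proof. by move=> k l; exact: smooth_cst. Qed.

Lemma smooth_mxD F G : smooth_mx O F -> smooth_mx O G ->
  smooth_mx O (fun x => F x + G x).
Proof.
move=> sF sG k l; apply: (smooth_eq oO _ (smoothD oO (sF k l) (sG k l))) => y _.
by rewrite mxE.
Qed.

Lemma smooth_mxB F G : smooth_mx O F -> smooth_mx O G ->
  smooth_mx O (fun x => F x - G x).
Proof.
move=> sF sG k l; apply: (smooth_eq oO _ (smoothB oO (sF k l) (sG k l))) => y _.
by rewrite !mxE.
Qed.

Lemma smooth_mxM F (G : pt -> 'M[R]_(q, r)) : smooth_mx O F -> smooth_mx O G ->
  smooth_mx O (fun x => F x *m G x).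
Proof.
move=> sF sG k l.
have s : smooth_on O (fun x => \sum_j F x k j * G x j l).
  by apply: smooth_sum => // j _; apply: smoothM.
by apply: (smooth_eq oO _ s) => y _; rewrite mxE.
Qed.

Lemma smooth_mx_tr F : smooth_mx O F -> smooth_mx O (fun x => (F x)^T).
Proof. by move=> sF k l; apply: (smooth_eq oO _ (sF l k)) => y _; rewrite mxE. Qed.

Lemma pderiv_mx_cst i (A : 'M[R]_(p, q)) x : pderiv_mx i (fun=> A) x = 0.
Proof. by apply/matrixP => k l; rewrite !mxE; exact: pderiv_cst. Qed.

Lemma pderiv_mxD i F G x : smooth_mx O F -> smooth_mx O G -> O x ->
  pderiv_mx i (fun x => F x + G x) x = pderiv_mx i F x + pderiv_mx i G x.
Proof.
move=> sF sG Ox; apply/matrixP => k l; rewrite !mxE -pderivD.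
- by congr (pderiv i _ x); apply/funext => y; rewrite mxE.
- exact: smooth_differentiable (sF k l) Ox.
- exact: smooth_differentiable (sG k l) Ox.
Qed.

Lemma pderiv_mxM i F (G : pt -> 'M[R]_(q, r)) x : smooth_mx O F ->
  smooth_mx O G -> O x -> pderiv_mx i (fun x => F x *m G x) x =
  pderiv_mx i F x *m G x + F x *m pderiv_mx i G x.
Proof.
move=> sF sG Ox; apply/matrixP => k l; rewrite !mxE -big_split /=.
transitivity (pderiv i (fun y => \sum_j F y k j * G y j l) x).
  by congr (pderiv i _ x); apply/funext => y; rewrite mxE.
have dF (j : 'I_q) := smooth_differentiable (sF k j) Ox.
have dG (j : 'I_q) := smooth_differentiable (sG j l) Ox.
rewrite pderiv_sum => [|j]; last exact: differentiableM.
by apply: eq_bigr => j _; rewrite pderivM// !mxE.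
Qed.

Lemma pderiv_mx_tr i F x : pderiv_mx i (fun x => (F x)^T) x = (pderiv_mx i F x)^T.
Proof.
apply/matrixP => k l; rewrite !mxE.
by congr (pderiv i _ x); apply/funext => y; rewrite mxE.
Qed.

Lemma smooth_mxZ (h : pt -> R) F : smooth_on O h -> smooth_mx O F ->
  smooth_mx O (fun x => h x *: F x).
Proof.
move=> sh sF k l; apply: (smooth_eq oO _ (smoothM oO sh (sF k l))) => y _.
by rewrite mxE.
Qed.

Lemma pderiv_mxZ i (h : pt -> R) F x : smooth_on O h -> smooth_mx O F -> O x ->
  pderiv_mx i (fun x => h x *: F x) x = pderiv i h x *: F x + h x *: pderiv_mx i F x.
Proof.
move=> sh sF Ox; apply/matrixP => k l; rewrite !mxE -pderivM.
- by congr (pderiv i _ x); apply/funext => y; rewrite mxE.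
- exact: smooth_differentiable sh Ox.
- exact: smooth_differentiable (sF k l) Ox.
Qed.

Lemma pderiv_mx_sum I (s : seq I) (F : I -> pt -> 'M[R]_(p, q)) i x :
  (forall j, smooth_mx O (F j)) -> O x ->
  pderiv_mx i (fun x => \sum_(j <- s) F j x) x = \sum_(j <- s) pderiv_mx i (F j) x.
Proof.
move=> sF Ox; apply/matrixP => k l; rewrite [LHS]mxE summxE.
under [RHS]eq_bigr do rewrite mxE.
rewrite -pderiv_sum => [|j]; last exact: smooth_differentiable (sF j k l) Ox.
by congr (pderiv i _ x); apply/funext => y; rewrite summxE.
Qed.

Lemma pderiv_mxC (i j : 'I_n) F x : smooth_mx O F -> O x ->
  pderiv_mx i (pderiv_mx j F) x = pderiv_mx j (pderiv_mx i F) x.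
Proof.
move=> sF Ox; apply/matrixP => k l; rewrite [LHS]mxE [RHS]mxE.
transitivity (pderiv i (pderiv j (fun y => F y k l)) x).
  by congr (pderiv i _ x); apply/funext => y; rewrite mxE.
rewrite (pderivC i j oO _ Ox); last by have /smooth_onP := sF k l.
by congr (pderiv j _ x); apply/funext => y; rewrite mxE.
Qed.

End Real.

Section ComplexScalars.
Implicit Types (f g : pt -> C).

Definition smooth_cpx f : Prop :=
  smooth_on O (fun x => complex.Re (f x)) /\ smooth_on O (fun x => complex.Im (f x)).

Definition pderiv_cpx i f x : C :=
  pderiv i (fun y => complex.Re (f y)) x +i* pderiv i (fun y => complex.Im (f y)) x.

Lemma smooth_cpx_eq f g : (forall y, O y -> f y = g y) -> smooth_cpx f -> smooth_cpx g.
Proof.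
move=> fg [sr si]; split.
  by apply: (smooth_eq oO _ sr) => y Oy; rewrite fg.
by apply: (smooth_eq oO _ si) => y Oy; rewrite fg.
Qed.

Lemma smooth_cpxD f g : smooth_cpx f -> smooth_cpx g -> smooth_cpx (fun x => f x + g x).
Proof.
move=> [fr fi] [gr gi]; split.
  by apply: (smooth_eq oO _ (smoothD oO fr gr)) => y _; case: (f y) (g y) => a b [].
by apply: (smooth_eq oO _ (smoothD oO fi gi)) => y _; case: (f y) (g y) => a b [].
Qed.

Lemma smooth_cpxM f g : smooth_cpx f -> smooth_cpx g -> smooth_cpx (fun x => f x * g x).
Proof.
move=> [fr fi] [gr gi]; split.
  apply: (smooth_eq oO _ (smoothB oO (smoothM oO fr gr) (smoothM oO fi gi))) => y _.
  by case: (f y) (g y) => a b [].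
apply: (smooth_eq oO _ (smoothD oO (smoothM oO fr gi) (smoothM oO fi gr))) => y _.
by case: (f y) (g y) => a b [].
Qed.

Lemma pderiv_cpxD i f g x : smooth_cpx f -> smooth_cpx g -> O x ->
  pderiv_cpx i (fun x => f x + g x) x = pderiv_cpx i f x + pderiv_cpx i g x.
Proof.
move=> [fr fi] [gr gi] Ox; rewrite /pderiv_cpx.
have dfr := smooth_differentiable fr Ox; have dfi := smooth_differentiable fi Ox.
have dgr := smooth_differentiable gr Ox; have dgi := smooth_differentiable gi Ox.
rewrite [RHS]/GRing.add /= -!pderivD//; congr (pderiv i _ x +i* pderiv i _ x);
  by apply/funext => y; case: (f y) (g y) => a b [].
Qed.

Lemma pderiv_cpxM i f g x : smooth_cpx f -> smooth_cpx g -> O x ->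
  pderiv_cpx i (fun x => f x * g x) x = pderiv_cpx i f x * g x + f x * pderiv_cpx i g x.
Proof.
move=> [fr fi] [gr gi] Ox; rewrite /pderiv_cpx.
have dfr := smooth_differentiable fr Ox; have dfi := smooth_differentiable fi Ox.
have dgr := smooth_differentiable gr Ox; have dgi := smooth_differentiable gi Ox.
pose a y := complex.Re (f y); pose b y := complex.Im (f y).
pose c y := complex.Re (g y); pose d y := complex.Im (g y).
have -> : (fun y => complex.Re (f y * g y)) = (fun y => a y * c y + (-1) * (b y * d y)).
  by apply/funext => y; rewrite /a /b /c /d mulN1r; case: (f y) (g y) => ? ? [].
have -> : (fun y => complex.Im (f y * g y)) = (fun y => a y * d y + b y * c y).
  by apply/funext => y; rewrite /a /b /c /d; case: (f y) (g y) => ? ? [].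
rewrite !pderivD ?pderivM//; try exact: differentiableM; try exact: differentiable_cst;
  last by apply: differentiableM; [exact: differentiable_cst|exact: differentiableM].
rewrite pderiv_cst -/a -/b -/c -/d.
have -> : f x = a x +i* b x by rewrite /a /b; case: (f x).
have -> : g x = c x +i* d x by rewrite /c /d; case: (g x).
by apply/eqP; rewrite eq_complex /=; apply/andP; split; apply/eqP; ring.
Qed.

Lemma smooth_cpx_cst (c : C) : smooth_cpx (fun=> c).
Proof. by split; exact: smooth_cst. Qed.

Lemma pderiv_cpx_cst i (c : C) x : pderiv_cpx i (fun=> c) x = 0.
Proof. by rewrite /pderiv_cpx !pderiv_cst. Qed.

Lemma smooth_cpx_real (h : pt -> R) : smooth_on O h -> smooth_cpx (fun x => (h x)%:C).
Proof. by move=> sh; split=> //; exact: smooth_cst. Qed.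

Lemma pderiv_cpx_real i (h : pt -> R) x :
  pderiv_cpx i (fun x => (h x)%:C) x = (pderiv i h x)%:C.
Proof. by rewrite /pderiv_cpx /= pderiv_cst. Qed.

Lemma smooth_cpx_sum I (s : seq I) (F : I -> pt -> C) :
  (forall j, smooth_cpx (F j)) -> smooth_cpx (fun x => \sum_(j <- s) F j x).
Proof.
move=> sF; elim: s => [|j s IH].
  by apply: (smooth_cpx_eq _ (smooth_cpx_cst 0)) => y _; rewrite big_nil.
by apply: (smooth_cpx_eq _ (smooth_cpxD (sF j) IH)) => y _; rewrite big_cons.
Qed.

Lemma pderiv_cpx_sum I (s : seq I) (F : I -> pt -> C) i x :
  (forall j, smooth_cpx (F j)) -> O x ->
  pderiv_cpx i (fun x => \sum_(j <- s) F j x) x = \sum_(j <- s) pderiv_cpx i (F j) x.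
Proof.
move=> sF Ox; elim: s => [|j s IH].
  rewrite big_nil -[RHS](pderiv_cpx_cst i 0 x); congr (pderiv_cpx i _ x).
  by apply/funext => y; rewrite big_nil.
rewrite big_cons -IH -pderiv_cpxD//; last exact: smooth_cpx_sum.
by congr (pderiv_cpx i _ x); apply/funext => y; rewrite big_cons.
Qed.

Lemma smooth_cpx_pderiv i f : smooth_cpx f -> smooth_cpx (pderiv_cpx i f).
Proof. by move=> [fr fi]; split; exact: smooth_pderiv. Qed.

Lemma pderiv_cpxC (i j : 'I_n) f x : smooth_cpx f -> O x ->
  pderiv_cpx i (pderiv_cpx j f) x = pderiv_cpx j (pderiv_cpx i f) x.
Proof.
move=> [/smooth_onP fr /smooth_onP fi] Ox.
pose fR y := complex.Re (f y); pose fI y := complex.Im (f y).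
rewrite -[LHS]/(pderiv i (pderiv j fR) x +i* pderiv i (pderiv j fI) x).
by rewrite (pderivC i j oO (fr 2%N) Ox) (pderivC i j oO (fi 2%N) Ox).
Qed.

Lemma pderiv_cpx_eq i f g x : (forall y, O y -> f y = g y) -> O x ->
  pderiv_cpx i f x = pderiv_cpx i g x.
Proof.
move=> fg Ox; rewrite /pderiv_cpx; congr Complex; apply: (pderiv_open i oO) Ox => y Oy;
  by rewrite fg.
Qed.

End ComplexScalars.

Lemma pderiv_cmxE p q i (F : pt -> 'M[C]_(p, q)) x k l :
  pderiv_cmx i F x k l = pderiv_cpx i (fun y => F y k l) x.
Proof. by rewrite mxE. Qed.

Section Complex.
Variables p q r : nat.
Implicit Types (F G : pt -> 'M[C]_(p, q)) (h : pt -> R).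

Lemma smooth_cmx_eq F G : (forall y, O y -> F y = G y) ->
  smooth_cmx O F -> smooth_cmx O G.
Proof.
by move=> FG sF k l; apply: (smooth_cpx_eq _ (sF k l)) => y Oy; rewrite FG.
Qed.

Lemma pderiv_cmx_eq i F G x : (forall y, O y -> F y = G y) -> O x ->
  pderiv_cmx i F x = pderiv_cmx i G x.
Proof.
move=> FG Ox; apply/matrixP => k l; rewrite !pderiv_cmxE.
by apply: pderiv_cpx_eq Ox => y Oy; rewrite FG.
Qed.

Lemma smooth_cmx_cst (A : 'M[C]_(p, q)) : smooth_cmx O (fun=> A).
Proof. by move=> k l; exact: smooth_cpx_cst. Qed.

Lemma pderiv_cmx_cst i (A : 'M[C]_(p, q)) x : pderiv_cmx i (fun=> A) x = 0.
Proof. by apply/matrixP => k l; rewrite pderiv_cmxE pderiv_cpx_cst mxE. Qed.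

Lemma smooth_cmxD F G : smooth_cmx O F -> smooth_cmx O G ->
  smooth_cmx O (fun x => F x + G x).
Proof.
move=> sF sG k l; apply: (smooth_cpx_eq _ (smooth_cpxD (sF k l) (sG k l))) => y _.
by rewrite mxE.
Qed.

Lemma pderiv_cmxD i F G x : smooth_cmx O F -> smooth_cmx O G -> O x ->
  pderiv_cmx i (fun x => F x + G x) x = pderiv_cmx i F x + pderiv_cmx i G x.
Proof.
move=> sF sG Ox; apply/matrixP => k l; rewrite [RHS]mxE !pderiv_cmxE.
rewrite -(pderiv_cpxD i (sF k l) (sG k l) Ox).
by congr (pderiv_cpx i _ x); apply/funext => y; rewrite mxE.
Qed.

Lemma smooth_cmxZ (f : pt -> C) F : smooth_cpx f -> smooth_cmx O F ->
  smooth_cmx O (fun x => f x *: F x).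
Proof.
move=> sf sF k l; apply: (smooth_cpx_eq _ (smooth_cpxM sf (sF k l))) => y _.
by rewrite mxE.
Qed.

Lemma pderiv_cmxZ i (f : pt -> C) F x : smooth_cpx f -> smooth_cmx O F -> O x ->
  pderiv_cmx i (fun x => f x *: F x) x =
  pderiv_cpx i f x *: F x + f x *: pderiv_cmx i F x.
Proof.
move=> sf sF Ox; apply/matrixP => k l; rewrite pderiv_cmxE !mxE.
rewrite -[X in _ + f x * X]/(pderiv_cpx i (fun y => F y k l) x).
rewrite -(pderiv_cpxM i sf (sF k l) Ox).
by congr (pderiv_cpx i _ x); apply/funext => y; rewrite mxE.
Qed.

Lemma smooth_cmxM F (G : pt -> 'M[C]_(q, r)) : smooth_cmx O F -> smooth_cmx O G ->
  smooth_cmx O (fun x => F x *m G x).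
Proof.
move=> sF sG k l.
have s : smooth_cpx (fun x => \sum_j F x k j * G x j l).
  by apply: smooth_cpx_sum => j; apply: smooth_cpxM; [exact: sF|exact: sG].
by apply: (smooth_cpx_eq _ s) => y _; rewrite mxE.
Qed.

Lemma pderiv_cmxM i F (G : pt -> 'M[C]_(q, r)) x : smooth_cmx O F ->
  smooth_cmx O G -> O x -> pderiv_cmx i (fun x => F x *m G x) x =
  pderiv_cmx i F x *m G x + F x *m pderiv_cmx i G x.
Proof.
move=> sF sG Ox; apply/matrixP => k l; rewrite pderiv_cmxE.
rewrite [RHS]mxE [X in X + _]mxE [X in _ + X]mxE -big_split /=.
transitivity (pderiv_cpx i (fun y => \sum_j F y k j * G y j l) x).
  by congr (pderiv_cpx i _ x); apply/funext => y; rewrite mxE.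
rewrite pderiv_cpx_sum// => [|j]; last by apply: smooth_cpxM; [exact: sF|exact: sG].
apply: eq_bigr => j _; rewrite !pderiv_cmxE.
by apply: pderiv_cpxM.
Qed.

Lemma smooth_cmx_sum I (s : seq I) (F : I -> pt -> 'M[C]_(p, q)) :
  (forall j, smooth_cmx O (F j)) -> smooth_cmx O (fun x => \sum_(j <- s) F j x).
Proof.
move=> sF; elim: s => [|j s IH].
  by apply: (smooth_cmx_eq _ (smooth_cmx_cst 0)) => y _; rewrite big_nil.
by apply: (smooth_cmx_eq _ (smooth_cmxD (sF j) IH)) => y _; rewrite big_cons.
Qed.

Lemma pderiv_cmx_sum I (s : seq I) (F : I -> pt -> 'M[C]_(p, q)) i x :
  (forall j, smooth_cmx O (F j)) -> O x ->
  pderiv_cmx i (fun x => \sum_(j <- s) F j x) x = \sum_(j <- s) pderiv_cmx i (F j) x.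
Proof.
move=> sF Ox; elim: s => [|j s IH].
  rewrite big_nil -[RHS](pderiv_cmx_cst i 0 x); congr (pderiv_cmx i _ x).
  by apply/funext => y; rewrite big_nil.
rewrite big_cons -IH -pderiv_cmxD//; last exact: smooth_cmx_sum.
by congr (pderiv_cmx i _ x); apply/funext => y; rewrite big_cons.
Qed.

Lemma smooth_cmxN F : smooth_cmx O F -> smooth_cmx O (fun x => - F x).
Proof.
move=> sF; apply: (smooth_cmx_eq _ (smooth_cmxZ (smooth_cpx_cst (-1)) sF)) => y _.
by rewrite scaleN1r.
Qed.

Lemma pderiv_cmxZc i (c : C) F x : smooth_cmx O F -> O x ->
  pderiv_cmx i (fun x => c *: F x) x = c *: pderiv_cmx i F x.
Proof.
move=> sF Ox; rewrite (pderiv_cmxZ i (smooth_cpx_cst c))//.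
by rewrite pderiv_cpx_cst scale0r add0r.
Qed.

Lemma pderiv_cmxN i F x : smooth_cmx O F -> O x ->
  pderiv_cmx i (fun x => - F x) x = - pderiv_cmx i F x.
Proof.
move=> sF Ox; rewrite -scaleN1r -(pderiv_cmxZc i (-1) sF Ox).
by congr (pderiv_cmx i _ x); apply/funext => y; rewrite scaleN1r.
Qed.

Lemma smooth_cmxB F G : smooth_cmx O F -> smooth_cmx O G ->
  smooth_cmx O (fun x => F x - G x).
Proof. by move=> sF sG; apply: smooth_cmxD => //; exact: smooth_cmxN. Qed.

Lemma pderiv_cmxB i F G x : smooth_cmx O F -> smooth_cmx O G -> O x ->
  pderiv_cmx i (fun x => F x - G x) x = pderiv_cmx i F x - pderiv_cmx i G x.
Proof.
by move=> sF sG Ox; rewrite pderiv_cmxD ?pderiv_cmxN//; exact: smooth_cmxN.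
Qed.

Lemma smooth_cmx_pderiv i F : smooth_cmx O F -> smooth_cmx O (pderiv_cmx i F).
Proof.
move=> sF k l; apply: (smooth_cpx_eq _ (smooth_cpx_pderiv i (sF k l))) => y _.
by rewrite pderiv_cmxE.
Qed.

Lemma pderiv_cmxC (i j : 'I_n) F x : smooth_cmx O F -> O x ->
  pderiv_cmx i (pderiv_cmx j F) x = pderiv_cmx j (pderiv_cmx i F) x.
Proof.
move=> sF Ox; apply/matrixP => k l; rewrite [LHS]pderiv_cmxE [RHS]pderiv_cmxE.
transitivity (pderiv_cpx i (pderiv_cpx j (fun y => F y k l)) x).
  by congr (pderiv_cpx i _ x); apply/funext => y; rewrite pderiv_cmxE.
rewrite (pderiv_cpxC i j (sF k l) Ox).
by congr (pderiv_cpx j _ x); apply/funext => y; rewrite pderiv_cmxE.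
Qed.

(** Fields of the form sum_k h_k A_k with real coefficients h_k and constant
   matrices A_k: exterior multiplications, contractions and derivations. *)
Lemma smooth_lincomb I (s : seq I) (h : I -> pt -> R) (A : I -> 'M[C]_(p, q)) :
  (forall j, smooth_on O (h j)) -> smooth_cmx O (fun x => \sum_(j <- s) (h j x)%:C *: A j).
Proof.
move=> sh; apply: smooth_cmx_sum => j; apply: smooth_cmxZ.
  exact: smooth_cpx_real.
exact: smooth_cmx_cst.
Qed.

Lemma pderiv_lincomb I (s : seq I) (h : I -> pt -> R) (A : I -> 'M[C]_(p, q)) i x :
  (forall j, smooth_on O (h j)) -> O x ->
  pderiv_cmx i (fun x => \sum_(j <- s) (h j x)%:C *: A j) x =
  \sum_(j <- s) (pderiv i (h j) x)%:C *: A j.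
Proof.
move=> sh Ox; rewrite pderiv_cmx_sum// => [|j]; last first.
  by apply: smooth_cmxZ; [exact: smooth_cpx_real|exact: smooth_cmx_cst].
apply: eq_bigr => j _; rewrite pderiv_cmxZ//.
- by rewrite pderiv_cpx_real pderiv_cmx_cst scaler0 addr0.
- exact: smooth_cpx_real.
- exact: smooth_cmx_cst.
Qed.

End Complex.

Lemma smooth_extv (v : pt -> 'rV[R]_n) : smooth_mx O v ->
  smooth_cmx O (fun x => extv (v x)).
Proof. by move=> sv; apply: smooth_lincomb => k; exact: sv. Qed.

Lemma pderiv_extv i (v : pt -> 'rV[R]_n) x : smooth_mx O v -> O x ->
  pderiv_cmx i (fun x => extv (v x)) x = extv (pderiv_mx i v x).
Proof.
move=> sv Ox; rewrite /extv (pderiv_lincomb _ _ _ (fun k => sv 0 k))//.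
by apply: eq_bigr => k _; rewrite mxE.
Qed.

Lemma smooth_contr (v : pt -> 'rV[R]_n) : smooth_mx O v ->
  smooth_cmx O (fun x => contr (v x)).
Proof. by move=> sv; apply: smooth_lincomb => k; exact: sv. Qed.

Lemma pderiv_contr i (v : pt -> 'rV[R]_n) x : smooth_mx O v -> O x ->
  pderiv_cmx i (fun x => contr (v x)) x = contr (pderiv_mx i v x).
Proof.
move=> sv Ox; rewrite /contr (pderiv_lincomb _ _ _ (fun k => sv 0 k))//.
by apply: eq_bigr => k _; rewrite mxE.
Qed.

Lemma smooth_deriv_op (A : pt -> 'M[R]_n) : smooth_mx O A ->
  smooth_cmx O (fun x => deriv_op (A x)).
Proof.
move=> sA; apply: smooth_cmx_sum => j.
by apply: (smooth_lincomb _ _ (h := fun m x => A x j m)) => m; exact: sA.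
Qed.

Lemma pderiv_deriv_op i (A : pt -> 'M[R]_n) x : smooth_mx O A -> O x ->
  pderiv_cmx i (fun x => deriv_op (A x)) x = deriv_op (pderiv_mx i A x).
Proof.
move=> sA Ox; rewrite /deriv_op pderiv_cmx_sum// => [|j]; last first.
  by apply: (smooth_lincomb _ _ (h := fun m x => A x j m)) => m; exact: sA.
apply: eq_bigr => j _; rewrite (pderiv_lincomb _ _ _ (h := fun m x => A x j m))//.
by apply: eq_bigr => m _; rewrite mxE.
Qed.

End MatrixCalculus.

(** * Riemannian geometry of a coordinate domain *)

Section PositiveDefinite.
Context {R : realType} {n : nat}.
Implicit Types G : 'M[R]_n.

Definition pos_def G : Prop :=
  forall v : 'rV[R]_n, v != 0 -> 0 < (v *m G *m v^T) 0 0.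

Lemma pos_def_det_neq0 G : pos_def G -> \det G != 0.
Proof.
move=> pG; apply/det0P => -[v v0 vG]; have := pG v v0.
by rewrite vG mul0mx mxE ltxx.
Qed.

Lemma pos_def1 : pos_def 1%:M.
Proof.
move=> v v0; rewrite mulmx1 mxE; have [i vi] : exists i, v 0 i != 0.
  by apply/rV0Pn.
rewrite (bigD1 i)//= ltr_pwDl//; first by rewrite mxE -expr2 exprn_even_gt0.
by apply: sumr_ge0 => j _; rewrite mxE -expr2 sqr_ge0.
Qed.

(** The determinant does not vanish on the segment from the identity to G, so by
   the intermediate value theorem it keeps the sign of det 1. *)
Lemma pos_def_det_gt0 G : pos_def G -> 0 < \det G.
Proof.
move=> pG; pose P : 'M[{poly R}]_n := \matrix_(i, j) ((G i j)%:P * 'X + (i == j)%:R%:P * (1 - 'X)).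
have PE t : (\det P).[t] = \det (t *: G + (1 - t) *: 1%:M).
  rewrite -horner_evalE -det_map_mx; congr (\det _).
  apply/matrixP => i j; rewrite !mxE /=. by rewrite horner_evalE !hornerE mulrC [_ * (1 - t)]mulrC.
have pt t : 0 <= t <= 1 -> pos_def (t *: G + (1 - t) *: 1%:M).
  move=> /andP[t0 t1] v v0; rewrite mulmxDr mulmxDl -!scalemxAr -!scalemxAl.
  have addE (a b : R) (A B : 'M[R]_1) : (a *: A + b *: B) 0 0 = a * A 0 0 + b * B 0 0.
    by rewrite !mxE.
  rewrite addE.
  have [->|tn0] := eqVneq t 0; first by rewrite mul0r add0r subr0 mul1r pos_def1.
  rewrite ltr_pwDl//; first by rewrite mulr_gt0 ?pG// lt_neqAle eq_sym tn0.
  by rewrite mulr_ge0 ?subr_ge0// ltW// pos_def1.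
have P0 : (\det P).[0] = 1 by rewrite PE scale0r add0r subr0 scale1r det1.
have P1 : (\det P).[1] = \det G by rewrite PE scale1r subrr scale0r addr0.
rewrite lt_neqAle eq_sym pos_def_det_neq0//= leNgt; apply/negP => dG.
have [|t t01 /rootP] := @poly_ivt _ (- \det P) 0 1 ler01.
  by rewrite !hornerN P0 P1 oppr_le0 ler01 oppr_ge0 ltW.
rewrite hornerN PE => /eqP; rewrite oppr_eq0; apply/negP.
by apply/pos_def_det_neq0/pt.
Qed.

Lemma pos_def_unit G : pos_def G -> G \in unitmx.
Proof. by move=> /pos_def_det_neq0; rewrite unitmxE unitfE. Qed.

End PositiveDefinite.

Section Determinant.
Context {R : realType} {n : nat}.
Variable O : set 'rV[R]_n.
Hypothesis oO : open O.

Lemma smooth_det p (F : 'rV[R]_n -> 'M[R]_p) : smooth_mx O F ->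
  smooth_on O (fun x => \det (F x)).
Proof.
move=> sF; apply: smooth_sum => // s _; apply: smoothM => //; first exact: smooth_cst.
by apply: smooth_prod => // i; exact: sF.
Qed.

Lemma smooth_invmx p (F : 'rV[R]_n -> 'M[R]_p) : smooth_mx O F ->
  (forall x, O x -> \det (F x) != 0) -> smooth_mx O (fun x => invmx (F x)).
Proof.
move=> sF F0; have sadj : smooth_mx O (fun x => \adj (F x)).
  move=> k l; have sc : smooth_on O (fun x => cofactor (F x) l k).
    apply: smoothM => //; first exact: smooth_cst.
    apply: smooth_det => a b; apply: (smooth_eq oO _ (sF (lift l a) (lift k b))) => y _.
    by rewrite !mxE.
  by apply: (smooth_eq oO _ sc) => y _; rewrite mxE.
have sd := smoothV oO F0 (smooth_det sF).
apply: (smooth_mx_eq oO _ (smooth_mxZ oO sd sadj)) => y Oy.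
by rewrite /invmx unitmxE unitfE F0.
Qed.

End Determinant.

(** Vectors being rows, the index convention (Gamma_i)_jk = Gamma^k_ij makes
   nabla_i Y = d_i Y + Y Gamma_i a matrix expression. *)
HB.lock Definition connection_mx {R : realType} {n : nat}
    (g : 'rV[R]_n -> 'M[R]_n) (i : 'I_n) (x : 'rV[R]_n) : 'M[R]_n :=
  \matrix_(j, k) christoffel g k i j x.

(** The matrix of R(d_k, d_l), acting on rows from the right; this reverses the
   order of the products. *)
HB.lock Definition curvature_mx {R : realType} {n : nat}
    (g : 'rV[R]_n -> 'M[R]_n) (k l : 'I_n) (x : 'rV[R]_n) : 'M[R]_n :=
  pderiv_mx k (connection_mx g l) x - pderiv_mx l (connection_mx g k) x
  + (connection_mx g l x *m connection_mx g k x
     - connection_mx g k x *m connection_mx g l x).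

HB.lock Definition cov_deriv_row {R : realType} {n : nat}
    (g : 'rV[R]_n -> 'M[R]_n) (k : 'I_n) (Z : 'rV[R]_n -> 'rV[R]_n)
    (x : 'rV[R]_n) : 'rV[R]_n :=
  pderiv_mx k Z x + Z x *m connection_mx g k x.

Section RiemannianGeometry.
Context {R : realType} {n : nat}.
Notation pt := 'rV[R]_n.
Notation C := R[i].
Variable O : set pt.
Hypothesis oO : open O.
Variable g : pt -> 'M[R]_n.
Hypothesis g_smooth : smooth_mx O g.
Hypothesis g_sym : forall x, O x -> (g x)^T = g x.
Hypothesis g_pos : forall x, O x -> pos_def (g x).
Implicit Types (i j k l m : 'I_n) (x : pt) (X Y Z : pt -> pt).

Lemma g_unit x : O x -> g x \in unitmx.
Proof. by move=> /g_pos /pos_def_unit. Qed.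

Lemma mulVg x : O x -> ginv g x *m g x = 1%:M.
Proof. by move=> /g_unit; exact: mulVmx. Qed.

Lemma mulgV x : O x -> g x *m ginv g x = 1%:M.
Proof. by move=> /g_unit; exact: mulmxV. Qed.

Lemma ginv_sym x : O x -> (ginv g x)^T = ginv g x.
Proof. by move=> Ox; rewrite /ginv trmx_inv g_sym. Qed.

Lemma ginv_smooth : smooth_mx O (ginv g).
Proof.
by apply: smooth_invmx => // x /g_pos; exact: pos_def_det_neq0.
Qed.

Notation conn_mx := (connection_mx g).
Notation curv_mx := (curvature_mx g).
Notation cov_deriv := (cov_deriv_row g).

Lemma conn_mxE i x j k : conn_mx i x j k = christoffel g k i j x.
Proof. by rewrite connection_mx.unlock mxE. Qed.

Lemma lcformE i x : lcform g i x = - deriv_op (conn_mx i x).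
Proof.
congr (- _); apply: eq_bigr => j _; apply: eq_bigr => k _.
by rewrite conn_mxE.
Qed.

Lemma christoffel_smooth k i j : smooth_on O (christoffel g k i j).
Proof.
apply: smoothM => //; first exact: smooth_cst.
apply: smooth_sum => // l _; apply: smoothM => //; first exact: ginv_smooth.
apply: smoothB => //; last exact/smooth_pderiv/g_smooth.
by apply: smoothD => //; exact/smooth_pderiv/g_smooth.
Qed.

Lemma conn_mx_smooth i : smooth_mx O (conn_mx i).
Proof.
move=> j k; apply: (smooth_eq oO _ (christoffel_smooth k i j)) => y _.
by rewrite conn_mxE.
Qed.

Lemma pderiv_g_sym i j k x : O x ->
  pderiv i (fun y => g y j k) x = pderiv i (fun y => g y k j) x.
Proof.
move=> Ox; apply: (pderiv_open i oO) Ox => y Oy.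
by rewrite -[in LHS](g_sym Oy) mxE.
Qed.

Lemma christoffelC k i j x : O x -> christoffel g k i j x = christoffel g k j i x.
Proof.
move=> Ox; congr (_ * _); apply: eq_bigr => l _; congr (_ * _).
by rewrite [X in X - _]addrC (pderiv_g_sym l i j).
Qed.

Lemma conn_mxC i j k x : O x -> conn_mx i x j k = conn_mx j x i k.
Proof. by move=> Ox; rewrite !conn_mxE christoffelC. Qed.

(** Lowering the index with g gives the Christoffel symbols of the first kind,
   in which the inverse metric no longer occurs. *)
Lemma conn_mx_g i j l x : O x -> (conn_mx i x *m g x) j l =
  2^-1 * (pderiv i (fun y => g y j l) x + pderiv j (fun y => g y i l) x
          - pderiv l (fun y => g y i j) x).
Proof.
move=> Ox; pose T : 'rV[R]_n := \row_l (2^-1 * (pderiv i (fun y => g y j l) x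
  + pderiv j (fun y => g y i l) x - pderiv l (fun y => g y i j) x)).
have Tc k : conn_mx i x j k = (T *m (ginv g x)^T) 0 k.
  rewrite conn_mxE mxE /christoffel mulr_sumr; apply: eq_bigr => m _.
  by rewrite !mxE mulrCA [RHS]mulrC.
have -> : (conn_mx i x *m g x) j l = (T *m (ginv g x)^T *m g x) 0 l.
  by rewrite !mxE; apply: eq_bigr => k _; rewrite Tc.
by rewrite ginv_sym// -mulmxA mulVg// mulmx1 mxE.
Qed.

Lemma metric_compat i x : O x ->
  pderiv_mx i g x = conn_mx i x *m g x + g x *m (conn_mx i x)^T.
Proof.
move=> Ox; rewrite -[X in _ + X]trmxK trmx_mul trmxK g_sym//.
apply/matrixP => j l; rewrite pderiv_mxE [RHS]mxE [X in _ + X]mxE !conn_mx_g//.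
rewrite (pderiv_g_sym i l j Ox).
by field.
Qed.

Lemma ginv_compat i x : O x -> pderiv_mx i (ginv g) x =
  - (ginv g x *m conn_mx i x + (conn_mx i x)^T *m ginv g x).
Proof.
move=> Ox; have E : pderiv_mx i (fun y => ginv g y *m g y) x = 0.
  rewrite -(pderiv_mx_cst i (1%:M : 'M[R]_n) x).
  by apply: (pderiv_mx_eq oO) Ox => y Oy; rewrite mulVg.
move: E; rewrite (pderiv_mxM i ginv_smooth g_smooth Ox) metric_compat//.
move=> /(congr1 (mulmx^~ (ginv g x))); rewrite mul0mx mulmxDl -mulmxA mulgV// mulmx1.
move=> /eqP; rewrite addr_eq0 => /eqP->; rewrite mulmxDr mulmxDl -!mulmxA mulgV// mulmx1.
by rewrite [ginv g x *m (g x *m _)]mulmxA mulVg// mul1mx.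
Qed.

Lemma nablaLE X Y x : nablaL g X Y x =
  \sum_i X x 0 i *: (pderiv_mx i Y x + Y x *m conn_mx i x).
Proof.
apply/rowP => k; rewrite summxE !mxE -big_split; apply: eq_bigr => i _ /=.
rewrite !mxE ?pderiv_mxE mulrDr; congr (_ + _); rewrite mulr_sumr.
by apply: eq_bigr => j _; rewrite conn_mxE; ring.
Qed.

Lemma nablaL_dvec i Y x : nablaL g (dvec i) Y x =
  pderiv_mx i Y x + Y x *m conn_mx i x.
Proof.
rewrite nablaLE (bigD1 i)//= big1 => [|j ji].
  by rewrite addr0 /dvec mxE !eqxx scale1r.
by rewrite /dvec mxE eqxx (negbTE ji) scale0r.
Qed.

Lemma curv_mx_anti k l x : curv_mx l k x = - curv_mx k l x.
Proof. by rewrite curvature_mx.unlock opprD !opprB. Qed.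

Lemma cov_derivE k Z x : cov_deriv k Z x = pderiv_mx k Z x + Z x *m conn_mx k x.
Proof. by rewrite cov_deriv_row.unlock. Qed.

Lemma cov_deriv_smooth k Z : smooth_mx O Z -> smooth_mx O (cov_deriv k Z).
Proof.
move=> sZ; rewrite cov_deriv_row.unlock; apply: smooth_mxD => //.
  exact: smooth_mx_pderiv.
by apply: smooth_mxM => //; exact: conn_mx_smooth.
Qed.

Let cancel_symmetric_terms (a b c d e c' e' : 'rV[R]_n) :
  a + b + c + d + e - (a + d + c' + b + e') = c - c' + (e - e').
Proof. by apply/rowP => m; rewrite !mxE; ring. Qed.

Let curvature_sums (X Y : 'I_n -> R) (dX dY : 'I_n -> 'I_n -> R)
    (N : 'I_n -> 'rV[R]_n) (NN : 'I_n -> 'I_n -> 'rV[R]_n) :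
  (\sum_k \sum_l (X k * dY k l) *: N l + \sum_k \sum_l (X k * Y l) *: NN k l)
  - (\sum_k \sum_l (Y k * dX k l) *: N l + \sum_k \sum_l (Y k * X l) *: NN k l)
  - \sum_l (\sum_k (X k * dY k l - Y k * dX k l)) *: N l
  = \sum_k \sum_l (X k * Y l) *: (NN k l - NN l k).
Proof.
have -> : \sum_l (\sum_k (X k * dY k l - Y k * dX k l)) *: N l =
    \sum_k \sum_l (X k * dY k l) *: N l - \sum_k \sum_l (Y k * dX k l) *: N l.
  rewrite exchange_big [X in _ - X]exchange_big -sumrB.
  by apply: eq_bigr => l _ /=; rewrite -!scaler_suml -scalerBl sumrB.
have -> : \sum_k \sum_l (X k * Y l) *: (NN k l - NN l k) =
    \sum_k \sum_l (X k * Y l) *: NN k l - \sum_k \sum_l (Y k * X l) *: NN k l.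
  rewrite [X in _ - X]exchange_big -sumrB; apply: eq_bigr => k _ /=.
  by rewrite -sumrB; apply: eq_bigr => l _; rewrite [Y l * _]mulrC -scalerBr.
move: (\sum_k \sum_l (X k * dY k l) *: N l) (\sum_k \sum_l (Y k * dX k l) *: N l).
move: (\sum_k \sum_l _) (\sum_k \sum_l _) => q s p r.
by apply/rowP => m; rewrite !mxE; ring.
Qed.

Lemma cov_derivC k l Z x : smooth_mx O Z -> O x ->
  cov_deriv k (cov_deriv l Z) x - cov_deriv l (cov_deriv k Z) x = Z x *m curv_mx k l x.
Proof.
move=> sZ Ox; have E i j : cov_deriv i (cov_deriv j Z) x =
    pderiv_mx i (pderiv_mx j Z) x + pderiv_mx i Z x *m conn_mx j x
    + Z x *m pderiv_mx i (conn_mx j) x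
    + pderiv_mx j Z x *m conn_mx i x + Z x *m (conn_mx j x *m conn_mx i x).
  have sG := smooth_mxM oO sZ (conn_mx_smooth j).
  rewrite cov_derivE cov_deriv_row.unlock (pderiv_mxD i (smooth_mx_pderiv oO j sZ) sG Ox).
  rewrite (pderiv_mxM i sZ (conn_mx_smooth j) Ox).
  by rewrite mulmxDl -mulmxA !addrA.
rewrite !E (pderiv_mxC oO k l sZ Ox) curvature_mx.unlock !mulmxDr !mulmxN.
exact: cancel_symmetric_terms.
Qed.

Lemma nablaL_cov X Y : nablaL g X Y = fun x => \sum_i X x 0 i *: cov_deriv i Y x.
Proof.
by apply/funext => x; rewrite nablaLE; apply: eq_bigr => i _; rewrite cov_derivE.
Qed.

Lemma cov_derivZ k (h : pt -> R) Z x : smooth_on O h -> smooth_mx O Z -> O x ->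
  cov_deriv k (fun y => h y *: Z y) x = pderiv k h x *: Z x + h x *: cov_deriv k Z x.
Proof.
move=> sh sZ Ox; rewrite !cov_derivE (pderiv_mxZ k sh sZ Ox) scalerDr addrA.
by rewrite scalemxAl.
Qed.

Lemma cov_deriv_sum k (F : 'I_n -> pt -> 'rV[R]_n) x :
  (forall j, smooth_mx O (F j)) -> O x ->
  cov_deriv k (fun y => \sum_j F j y) x = \sum_j cov_deriv k (F j) x.
Proof.
move=> sF Ox; rewrite !cov_derivE (pderiv_mx_sum _ _ sF Ox) mulmx_suml -big_split.
by apply: eq_bigr => j _; rewrite cov_derivE.
Qed.

(** The curvature is a tensor: the derivatives of the three fields cancel. *)
Lemma curvE X Y Z x : smooth_mx O X -> smooth_mx O Y -> smooth_mx O Z -> O x ->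
  curv g X Y Z x = \sum_k \sum_l (X x 0 k * Y x 0 l) *: (Z x *m curv_mx k l x).
Proof.
move=> sX sY sZ Ox.
have NN A B : smooth_mx O B -> nablaL g A (nablaL g B Z) x =
    \sum_k \sum_l (A x 0 k * pderiv k (fun y => B y 0 l) x) *: cov_deriv l Z x
    + \sum_k \sum_l (A x 0 k * B x 0 l) *: cov_deriv k (cov_deriv l Z) x.
  move=> sB; rewrite [nablaL g B Z]nablaL_cov nablaL_cov -big_split.
  apply: eq_bigr => k _ /=; rewrite cov_deriv_sum// => [|l]; last first.
    by apply: smooth_mxZ => //; exact: cov_deriv_smooth.
  rewrite scaler_sumr -big_split; apply: eq_bigr => l _ /=.
  by rewrite (cov_derivZ k (sB 0 l) (cov_deriv_smooth l sZ) Ox) scalerDr !scalerA.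
rewrite /curv NN// NN//.
rewrite nablaL_cov; pose d (A : pt -> pt) k l := pderiv k (fun y => A y 0 l) x.
have lieE l : lie X Y x 0 l = \sum_k (X x 0 k * d Y k l - Y x 0 k * d X k l).
  by rewrite /lie summxE; apply: eq_bigr => k _; rewrite !mxE ?pderiv_mxE.
under [X in _ - X]eq_bigr do rewrite lieE.
apply: etrans (curvature_sums (X x 0) (Y x 0) (d X) (d Y)
  (fun l => cov_deriv l Z x) (fun k l => cov_deriv k (cov_deriv l Z) x)) _.
by apply: eq_bigr => k _; apply: eq_bigr => l _; rewrite cov_derivC.
Qed.

Let second_derivative_form (A B D G : 'M[R]_n) : G^T = G ->
  D *m G + B *m (A *m G + G *m A^T) + ((A *m G + G *m A^T) *m B^T + G *m D^T)
  = (D + B *m A) *m G + ((D + B *m A) *m G)^T + (B *m G *m A^T + A *m G *m B^T).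
Proof.
move=> symG; rewrite !(mulmxDl, mulmxDr) linearD /= !trmx_mul symG !mulmxA.
move: (D *m G) (B *m A *m G) (B *m G *m A^T) (A *m G *m B^T) (G *m A^T *m B^T) (G *m D^T).
by move=> a b c d e f; apply/matrixP => i j; rewrite !mxE; ring.
Qed.

Let skew_of_symmetric (P Q a b : 'M[R]_n) :
  P + P^T + (a + b) = Q + Q^T + (b + a) -> (P - Q)^T = - (P - Q).
Proof.
move=> /matrixP PQ; apply/matrixP => i j; have := PQ i j; rewrite !mxE.
by move=> /eqP; rewrite [b i j + _]addrC (inj_eq (addIr _)) => /eqP H; apply/eqP;
  rewrite opprB subr_eq addrAC -subr_eq opprK [_ + P i j]addrC H addrC.
Qed.

(** The second derivatives of g, written with the compatibility of metric and
   connection, commute. *)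
Lemma curv_mx_skew k l x : O x ->
  (curv_mx k l x *m g x)^T = - (curv_mx k l x *m g x).
Proof.
move=> Ox; have E i j : pderiv_mx i (pderiv_mx j g) x =
    (pderiv_mx i (conn_mx j) x + conn_mx j x *m conn_mx i x) *m g x
    + ((pderiv_mx i (conn_mx j) x + conn_mx j x *m conn_mx i x) *m g x)^T
    + (conn_mx j x *m g x *m (conn_mx i x)^T + conn_mx i x *m g x *m (conn_mx j x)^T).
  rewrite -second_derivative_form ?g_sym// -metric_compat//.
  transitivity (pderiv_mx i (fun y => conn_mx j y *m g y + g y *m (conn_mx j y)^T) x).
    by apply: (pderiv_mx_eq oO) Ox => y Oy; rewrite metric_compat.
  have sT := smooth_mx_tr oO (conn_mx_smooth j).
  have s1 := smooth_mxM oO (conn_mx_smooth j) g_smooth.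
  rewrite (pderiv_mxD i s1 (smooth_mxM oO g_smooth sT) Ox).
  rewrite (pderiv_mxM i (conn_mx_smooth j) g_smooth Ox) (pderiv_mxM i g_smooth sT Ox).
  by rewrite pderiv_mx_tr.
have := pderiv_mxC oO k l g_smooth Ox; rewrite !E => /skew_of_symmetric.
rewrite -mulmxBl; set M := (X in X *m _) => H.
have -> // : curv_mx k l x = M.
by rewrite curvature_mx.unlock /M opprD addrACA.
Qed.

Let curvature_entry (A B G H : 'M[R]_n) j m :
  (A - B + (G *m H - H *m G)) j m = A j m - B j m
   + (\sum_p G j p * H p m - \sum_p H j p * G p m).
Proof. by rewrite !mxE. Qed.

(** The curvature is obtained by antisymmetrizing expressions that are symmetric
   in their last two indices because the connection is torsion free. *)
Lemma bianchi j k l m x : O x ->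
  curv_mx k l x j m + curv_mx l j x k m + curv_mx j k x l m = 0.
Proof.
move=> Ox; have dC a b c d : pderiv_mx a (conn_mx b) x c d = pderiv_mx a (conn_mx c) x b d.
  rewrite [LHS]pderiv_mxE [RHS]pderiv_mxE.
  by apply: (pderiv_open a oO) Ox => y Oy; rewrite conn_mxC.
have [T [S [E TC SC]]] : exists T S : 'I_n -> 'I_n -> 'I_n -> R,
    [/\ forall a b c, curv_mx a b x c m = T a b c - T b a c + (S a b c - S b a c),
        forall a b c, T a b c = T a c b & forall a b c, S a b c = S a c b].
  exists (fun a b c => pderiv_mx a (conn_mx b) x c m).
  exists (fun a b c => \sum_p conn_mx b x c p * conn_mx a x p m).
  split=> a b c; [by rewrite curvature_mx.unlock curvature_entry|exact: dC|].
  by apply: eq_bigr => p _; rewrite conn_mxC.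
by rewrite !E (TC l k j) (TC j l k) (TC k j l) (SC l k j) (SC j l k) (SC k j l); ring.
Qed.

End RiemannianGeometry.
(** * Clifford multiplication *)

Section CliffordMultiplication.
Context {R : realType} {n : nat}.
Notation C := R[i].
Notation N := (dimL n).
Variable G : 'M[R]_n.
Implicit Types X Y : 'rV[R]_n.

Lemma cliff_lincomb (a : 'I_n -> R) (X : 'I_n -> 'rV[R]_n) :
  cliff G (\sum_k a k *: X k) = \sum_k (a k)%:C *: cliff G (X k).
Proof.
rewrite /cliff wedgeE mulmx_suml [extv (\sum_(_ <- _ | _) _)]raddf_sum.
rewrite [contr (\sum_(_ <- _ | _) _)]raddf_sum -sumrB; apply: eq_bigr => k _ /=.
by rewrite -scalemxAl extvZ contrZ scalerBr wedgeE.
Qed.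

Lemma cliffh_lincomb (a : 'I_n -> R) (X : 'I_n -> 'rV[R]_n) :
  cliffh G (\sum_k a k *: X k) = \sum_k (a k)%:C *: cliffh G (X k).
Proof.
rewrite /cliffh wedgeE mulmx_suml [extv (\sum_(_ <- _ | _) _)]raddf_sum.
rewrite [contr (\sum_(_ <- _ | _) _)]raddf_sum -big_split; apply: eq_bigr => k _ /=.
by rewrite -scalemxAl extvZ contrZ scalerDr wedgeE.
Qed.

Lemma cliff_coord X : cliff G X = \sum_k (X 0 k)%:C *: cliff G (delta_mx 0 k).
Proof. by rewrite {1}[X]row_sum_delta cliff_lincomb. Qed.

Hypothesis G_sym : G^T = G.

Let ipC X Y : (X *m G *m Y^T) 0 0 = (Y *m G *m X^T) 0 0.
Proof.
transitivity ((X *m G *m Y^T)^T 0 0); first by rewrite [RHS]mxE.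
by rewrite !trmx_mul trmxK G_sym mulmxA.
Qed.

Let wedge_contr_anticomm X Y :
  wedge G X *m contr Y + contr Y *m wedge G X = ((X *m G *m Y^T) 0 0)%:C%:M.
Proof. by rewrite wedgeE extv_contr_anticomm. Qed.

Let anticomm_expand (a b e f : 'M[C]_N) :
  (a + b) *m (e + f) + (e + f) *m (a + b) =
  (a *m e + e *m a) + (b *m f + f *m b) + ((a *m f + f *m a) + (e *m b + b *m e)).
Proof.
rewrite !(mulmxDl, mulmxDr).
move: (a *m e) (e *m a) (b *m f) (f *m b) (a *m f) (f *m a) (e *m b) (b *m e).
by move=> a1 a2 a3 a4 a5 a6 a7 a8; apply/matrixP => i j; rewrite !mxE; ring.
Qed.

Lemma cliffh_anticomm X Y : cliffh G X *m cliffh G Y + cliffh G Y *m cliffh G X =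
  (2 * (X *m G *m Y^T) 0 0)%:C%:M.
Proof.
rewrite anticomm_expand !wedge_contr_anticomm !wedgeE extv_anticomm contr_anticomm (ipC Y X).
by rewrite !add0r mulr_natl mulr2n rmorphD /= [RHS]raddfD.
Qed.

Lemma cliff_anticomm X Y : cliff G X *m cliff G Y + cliff G Y *m cliff G X =
  (- (2 * (X *m G *m Y^T) 0 0))%:C%:M.
Proof.
rewrite anticomm_expand !mulNmx !mulmxN !opprK -!opprD !wedge_contr_anticomm.
rewrite !wedgeE extv_anticomm contr_anticomm (ipC Y X).
rewrite !add0r mulr_natl mulr2n rmorphN rmorphD /= [RHS]raddfN; congr (- _).
by rewrite [RHS]raddfD.
Qed.

Lemma cliff_cliffh_anticomm X Y :
  cliff G X *m cliffh G Y + cliffh G Y *m cliff G X = 0.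
Proof.
rewrite anticomm_expand !mulNmx !mulmxN -!opprD !wedge_contr_anticomm.
by rewrite (ipC Y X) !wedgeE extv_anticomm contr_anticomm oppr0 !add0r subrr.
Qed.

End CliffordMultiplication.
(** * The bundle of forms *)

(** The derivation extending the connection on covectors, which is minus the
   transpose of the connection on vectors. *)
HB.lock Definition conn_form {R : realType} {n : nat}
    (g : 'rV[R]_n -> 'M[R]_n) (k : 'I_n) (x : 'rV[R]_n) : 'M[R[i]]_(dimL n) :=
  - deriv_op (connection_mx g k x).

HB.lock Definition form_nabla {R : realType} {n p : nat}
    (g : 'rV[R]_n -> 'M[R]_n) (k : 'I_n) (u : 'rV[R]_n -> 'M[R[i]]_(dimL n, p))
    (x : 'rV[R]_n) : 'M[R[i]]_(dimL n, p) :=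
  pderiv_cmx k u x + conn_form g k x *m u x.

HB.lock Definition endo_nabla {R : realType} {n : nat}
    (g : 'rV[R]_n -> 'M[R]_n) (k : 'I_n) (F : 'rV[R]_n -> 'M[R[i]]_(dimL n))
    (x : 'rV[R]_n) : 'M[R[i]]_(dimL n) :=
  pderiv_cmx k F x + (conn_form g k x *m F x - F x *m conn_form g k x).

(** Clifford multiplication by the coordinate covector dx^k. *)
HB.lock Definition cliff_up {R : realType} {n : nat}
    (g : 'rV[R]_n -> 'M[R]_n) (k : 'I_n) (x : 'rV[R]_n) : 'M[R[i]]_(dimL n) :=
  extv (delta_mx 0 k) - contr (row k (ginv g x)).

Section BundleOfForms.
Context {R : realType} {n : nat}.
Notation pt := 'rV[R]_n.
Notation C := R[i].
Notation N := (dimL n).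
Variable O : set pt.
Hypothesis oO : open O.
Variable g : pt -> 'M[R]_n.
Hypothesis g_smooth : smooth_mx O g.
Hypothesis g_sym : forall x, O x -> (g x)^T = g x.
Hypothesis g_pos : forall x, O x -> pos_def (g x).
Implicit Types (i j k l m : 'I_n) (x : pt) (X Y Z : pt -> pt).
Implicit Types (F G : pt -> 'M[C]_N).
Notation conn_mx := (connection_mx g).
Notation curv_mx := (curvature_mx g).
Notation cov_deriv := (cov_deriv_row g).
Notation L := (conn_form g).
Notation nab := (form_nabla g).
Notation nabE := (endo_nabla g).
Notation c := (cliff_up g).

Lemma conn_formE k x : L k x = - deriv_op (conn_mx k x).
Proof. by rewrite conn_form.unlock. Qed.

Lemma lcform_conn k x : lcform g k x = L k x.
Proof. by rewrite lcformE conn_formE. Qed.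

Lemma conn_form_smooth k : smooth_cmx O (L k).
Proof.
apply: (smooth_cmx_eq oO (F := fun x => - deriv_op (conn_mx k x))).
  by move=> y _; rewrite conn_formE.
apply: smooth_cmxN => //; apply: smooth_deriv_op => //.
exact: conn_mx_smooth.
Qed.

Lemma form_nablaE p k (u : pt -> 'M[C]_(N, p)) x :
  nab k u x = pderiv_cmx k u x + L k x *m u x.
Proof. by rewrite form_nabla.unlock. Qed.

Lemma form_nabla_smooth p k (u : pt -> 'M[C]_(N, p)) : smooth_cmx O u ->
  smooth_cmx O (nab k u).
Proof.
move=> su; rewrite form_nabla.unlock; apply: smooth_cmxD => //.
  exact: smooth_cmx_pderiv.
by apply: smooth_cmxM => //; exact: conn_form_smooth.
Qed.

Lemma form_nabla_eq p k (u v : pt -> 'M[C]_(N, p)) x :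
  (forall y, O y -> u y = v y) -> O x -> nab k u x = nab k v x.
Proof. by move=> uv Ox; rewrite !form_nablaE (pderiv_cmx_eq oO k uv Ox) uv. Qed.

Lemma endo_nabla_eq k F G x :
  (forall y, O y -> F y = G y) -> O x -> nabE k F x = nabE k G x.
Proof.
by move=> FG Ox; rewrite endo_nabla.unlock (pderiv_cmx_eq oO k FG Ox) FG.
Qed.

Lemma endo_nabla_smooth k F : smooth_cmx O F -> smooth_cmx O (nabE k F).
Proof.
move=> sF; rewrite endo_nabla.unlock; apply: smooth_cmxD => //.
  exact: smooth_cmx_pderiv.
by apply: smooth_cmxB => //; apply: smooth_cmxM => //; exact: conn_form_smooth.
Qed.

Lemma form_nablaM p k F (u : pt -> 'M[C]_(N, p)) x : smooth_cmx O F ->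
  smooth_cmx O u -> O x ->
  nab k (fun y => F y *m u y) x = nabE k F x *m u x + F x *m nab k u x.
Proof.
move=> sF su Ox; rewrite !form_nablaE endo_nabla.unlock (pderiv_cmxM oO k sF su Ox).
rewrite !mulmxDl mulmxDr mulNmx !mulmxA -!addrA; congr (_ + _).
by rewrite addrC; congr (_ + _); rewrite addrCA addNr addr0.
Qed.

Lemma form_nablaZ p k (h : pt -> C) (u : pt -> 'M[C]_(N, p)) x : smooth_cpx O h ->
  smooth_cmx O u -> O x ->
  nab k (fun y => h y *: u y) x = pderiv_cpx k h x *: u x + h x *: nab k u x.
Proof.
move=> sh su Ox; rewrite !form_nablaE (pderiv_cmxZ k sh su Ox) scalerDr addrA.
by rewrite scalemxAr.
Qed.

Lemma form_nablaD p k (u v : pt -> 'M[C]_(N, p)) x : smooth_cmx O u ->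
  smooth_cmx O v -> O x -> nab k (fun y => u y + v y) x = nab k u x + nab k v x.
Proof.
by move=> su sv Ox; rewrite !form_nablaE (pderiv_cmxD k su sv Ox) mulmxDr addrACA.
Qed.

Lemma form_nabla_sum p k I (s : seq I) (u : I -> pt -> 'M[C]_(N, p)) x :
  (forall j : I, smooth_cmx O (u j)) -> O x ->
  nab k (fun y => \sum_(q <- s) u q y) x = \sum_(q <- s) nab k (u q) x.
Proof.
move=> su Ox; rewrite form_nablaE (pderiv_cmx_sum oO _ _ su Ox) mulmx_sumr -big_split.
by apply: eq_bigr => j _; rewrite form_nablaE.
Qed.

Lemma endo_nablaM k F G x : smooth_cmx O F -> smooth_cmx O G -> O x ->
  nabE k (fun y => F y *m G y) x = nabE k F x *m G x + F x *m nabE k G x.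
Proof.
move=> sF sG Ox; rewrite !endo_nabla.unlock (pderiv_cmxM oO k sF sG Ox).
rewrite !(mulmxDl, mulmxDr, mulNmx, mulmxN) !mulmxA -!addrA; congr (_ + _).
by rewrite [X in _ = _ + X]addrCA addKr addrCA.
Qed.

Lemma endo_nablaB k F G x : smooth_cmx O F -> smooth_cmx O G -> O x ->
  nabE k (fun y => F y - G y) x = nabE k F x - nabE k G x.
Proof.
move=> sF sG Ox; rewrite !endo_nabla.unlock (pderiv_cmxB oO k sF sG Ox).
rewrite [in RHS]opprD [RHS]addrACA; congr (_ + _); rewrite mulmxBr mulmxBl !opprB.
by rewrite addrACA [RHS]addrACA; congr (_ + _); exact: addrC.
Qed.

Lemma endo_nablaD k F G x : smooth_cmx O F -> smooth_cmx O G -> O x ->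
  nabE k (fun y => F y + G y) x = nabE k F x + nabE k G x.
Proof.
move=> sF sG Ox; rewrite !endo_nabla.unlock (pderiv_cmxD k sF sG Ox).
by rewrite mulmxDr mulmxDl opprD [RHS]addrACA; congr (_ + _); rewrite addrACA.
Qed.

Lemma endo_nablaZ k (h : pt -> C) F x : smooth_cpx O h -> smooth_cmx O F -> O x ->
  nabE k (fun y => h y *: F y) x = pderiv_cpx k h x *: F x + h x *: nabE k F x.
Proof.
move=> sh sF Ox; rewrite !endo_nabla.unlock (pderiv_cmxZ k sh sF Ox) scalerDr addrA.
by rewrite -scalemxAl -scalemxAr scalerBr !addrA.
Qed.

Lemma endo_nabla_extv k (v : pt -> 'rV[R]_n) x : smooth_mx O v -> O x ->
  nabE k (fun y => extv (v y)) x = extv (pderiv_mx k v x - v x *m (conn_mx k x)^T).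
Proof.
move=> sv Ox; rewrite endo_nabla.unlock (pderiv_extv oO k sv Ox) conn_formE raddfB /=.
by rewrite -deriv_op_extv mulNmx mulmxN opprK opprB [X in _ + X]addrC.
Qed.

Lemma endo_nabla_contr k Y x : smooth_mx O Y -> O x ->
  nabE k (fun y => contr (Y y)) x = contr (cov_deriv k Y x).
Proof.
move=> sY Ox; rewrite endo_nabla.unlock (pderiv_contr oO k sY Ox) conn_formE cov_derivE raddfD /=.
congr (_ + _); rewrite mulNmx mulmxN opprK addrC -[RHS]opprK -deriv_op_contr.
by rewrite opprB.
Qed.

Lemma cliffh_smooth Y : smooth_mx O Y -> smooth_cmx O (fun y => cliffh (g y) (Y y)).
Proof.
move=> sY; apply: smooth_cmxD => //; last exact: smooth_contr.
by apply: (smooth_extv oO (v := fun y => Y y *m g y)); exact: smooth_mxM.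
Qed.

(** The metric is parallel, so Clifford multiplication by a vector field is
   differentiated through the field alone. *)
Lemma endo_nabla_cliffh k Y x : smooth_mx O Y -> O x ->
  nabE k (fun y => cliffh (g y) (Y y)) x = cliffh (g x) (cov_deriv k Y x).
Proof.
move=> sY Ox; have sYg := smooth_mxM oO sY g_smooth.
rewrite (endo_nablaD k (smooth_extv oO sYg) (smooth_contr oO sY) Ox).
rewrite endo_nabla_contr//; congr (_ + _); rewrite endo_nabla_extv//.
rewrite wedgeE; congr extv; rewrite (pderiv_mxM k sY g_smooth Ox).
rewrite (metric_compat oO g_sym g_pos k Ox) cov_derivE mulmxDl mulmxDr !mulmxA.
by rewrite addrA addrK.
Qed.

Lemma cliff_upE k x : c k x = extv (delta_mx 0 k) - contr (row k (ginv g x)).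
Proof. by rewrite cliff_up.unlock. Qed.

Let row_ginv_smooth k : smooth_mx O (fun y => row k (ginv g y)).
Proof.
move=> a b; apply: (smooth_eq oO _ (ginv_smooth oO g_smooth g_pos k b)) => y _.
by rewrite mxE.
Qed.

Lemma cliff_up_smooth k : smooth_cmx O (c k).
Proof.
rewrite cliff_up.unlock; apply: smooth_cmxB => //; first exact: smooth_cmx_cst.
exact: smooth_contr (row_ginv_smooth k).
Qed.

Lemma endo_nabla_cliff_up k l x : O x ->
  nabE k (c l) x = - \sum_m (conn_mx k x m l)%:C *: c m x.
Proof.
move=> Ox; have sd : smooth_mx O (fun _ : pt => delta_mx 0 l : 'rV[R]_n).
  exact: smooth_mx_cst.
have -> : nabE k (c l) x = nabE k (fun y => extv (delta_mx 0 l) - contr (row l (ginv g y))) x.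
  by rewrite cliff_up.unlock.
rewrite (endo_nablaB k (smooth_extv oO sd) (smooth_contr oO (row_ginv_smooth l)) Ox).
rewrite endo_nabla_extv// endo_nabla_contr// pderiv_mx_cst sub0r raddfN /=.
have -> : cov_deriv k (fun y => row l (ginv g y)) x = - (row l ((conn_mx k x)^T) *m ginv g x).
  rewrite cov_derivE (_ : pderiv_mx k _ x = row l (pderiv_mx k (ginv g) x)); last first.
    apply/rowP => a; rewrite [RHS]mxE !pderiv_mxE.
    by congr (pderiv k _ x); apply/funext => y; rewrite mxE.
  rewrite (ginv_compat oO g_smooth g_sym g_pos k Ox) -!row_mul.
  by rewrite linearN linearD /= opprD addrAC addNr add0r.
rewrite raddfN opprK /= -rowE.
have -> : row l (conn_mx k x)^T = \sum_m conn_mx k x m l *: delta_mx 0 m.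
  by rewrite [LHS]row_sum_delta; apply: eq_bigr => m _; rewrite !mxE.
rewrite mulmx_suml [extv _]raddf_sum [contr _]raddf_sum -!sumrN -big_split /=; apply: eq_bigr => m _.
by rewrite cliff_upE -scalemxAl extvZ contrZ scalerBr -rowE opprB addrC.
Qed.

Let reorder_second_derivative (V : zmodType) (a b c d e : V) :
  a + (- d + b) + (c + e) = a + (b + c) - d + e.
Proof. by rewrite addrA; congr (_ + _); rewrite -!addrA; congr (_ + _); rewrite addrC addrA. Qed.

Let antisymmetrize (V : zmodType) (a b c d e d' e' : V) :
  (a + (b + c) - d + e) - (a + (c + b) - d' + e') = - (d - d') + (e - e').
Proof.
rewrite [c + b]addrC opprD addrACA; congr (_ + _).
by rewrite opprD opprK addrACA subrr add0r opprB addrC.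
Qed.

(** Derivations of the exterior algebra compose like their matrices
   ([deriv_op_comm]), so the curvature of forms is minus the derivation attached
   to the curvature of vectors. *)
Lemma form_nablaC p k l (u : pt -> 'M[C]_(N, p)) x : smooth_cmx O u -> O x ->
  nab k (nab l u) x - nab l (nab k u) x = - (deriv_op (curv_mx k l x) *m u x).
Proof.
move=> su Ox; have dL i j : pderiv_cmx i (L j) x = - deriv_op (pderiv_mx i (conn_mx j) x).
  have sc := conn_mx_smooth oO g_smooth g_pos j.
  rewrite -(pderiv_deriv_op oO i sc Ox) -(pderiv_cmxN i (smooth_deriv_op oO sc) Ox).
  by apply: (pderiv_cmx_eq oO) Ox => y _; rewrite conn_formE.
have E i j : nab i (nab j u) x = pderiv_cmx i (pderiv_cmx j u) x
   + (L j x *m pderiv_cmx i u x + L i x *m pderiv_cmx j u x)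
   - deriv_op (pderiv_mx i (conn_mx j) x) *m u x + L i x *m (L j x *m u x).
  rewrite form_nablaE [in L i x *m _]form_nablaE.
  have sLu := smooth_cmxM oO (conn_form_smooth j) su.
  have -> : pderiv_cmx i (nab j u) x =
      pderiv_cmx i (fun y => pderiv_cmx j u y + L j y *m u y) x.
    by apply: (pderiv_cmx_eq oO) Ox => y _; rewrite form_nablaE.
  rewrite (pderiv_cmxD i (smooth_cmx_pderiv oO j su) sLu Ox).
  rewrite (pderiv_cmxM oO i (conn_form_smooth j) su Ox) dL mulNmx mulmxDr.
  exact: reorder_second_derivative.
rewrite (congr2 (fun a b => a - b) (E k l) (E l k)) (pderiv_cmxC oO k l su Ox).
apply: etrans (antisymmetrize _ _ _ _ _ _ _) _.
rewrite -[RHS]mulNmx; apply: etrans (_ : (- (deriv_op (pderiv_mx k (conn_mx l) x)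
  - deriv_op (pderiv_mx l (conn_mx k) x)) + (L k x *m L l x - L l x *m L k x)) *m u x = _).
  by rewrite [RHS]mulmxDl mulNmx !mulmxBl -!mulmxA.
congr (_ *m _); rewrite !conn_formE !mulNmx !mulmxN !opprK deriv_op_comm curvature_mx.unlock.
rewrite [deriv_op (_ + _)]raddfD /= [RHS]opprD; congr (_ + _); first by rewrite deriv_op_zmod_morphism.
by rewrite -[deriv_op _]opprK; congr (- _); rewrite -[LHS]raddfN /= opprB.
Qed.

End BundleOfForms.
(** * The codifferential *)

Section Codifferential.
Context {R : realType} {n : nat}.
Notation pt := 'rV[R]_n.
Notation C := R[i].
Notation N := (dimL n).
Notation ext k := (@extm R n k).
Notation int k := (@intm R n k).
Notation vac := (bform (finset.set0 : {set 'I_n})).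
Notation top := (bform (finset.setTfor 'I_n)).
Implicit Types (i j k l m : 'I_n) (x : pt) (A : 'M[R]_n).

Lemma tr_deriv_op A : (deriv_op A)^T = deriv_op A^T.
Proof.
rewrite /deriv_op linear_sum exchange_big; apply: eq_bigr => m _ /=.
rewrite [LHS]linear_sum; apply: eq_bigr => j _.
by rewrite [LHS]linearZ /= trmx_mul /intm trmxK mxE.
Qed.

Lemma deriv_op_vac A : deriv_op A *m vac = 0.
Proof.
rewrite /deriv_op mulmx_suml big1 // => j _; rewrite mulmx_suml big1 // => m _.
by rewrite -scalemxAl -mulmxA intm_bform finset.in_set0 mulmx0 scaler0.
Qed.

(** Exterior multiplications annihilate the top degree, so by the anticommutation
   rules only the diagonal of A contributes. *)
Lemma deriv_op_top A : deriv_op A *m top = (\tr A)%:C *: top.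
Proof.
have E m j : ext j *m int m *m top = (m == j)%:R *: top.
  have := ext_int_anticomm (R := R) j m; move=> /(congr1 (mulmx^~ top)).
  rewrite mulmxDl -[int m *m _ *m _]mulmxA extm_bform finset.in_setT mulmx0 addr0 => ->.
  by rewrite mul_scalar_mx eq_sym.
rewrite /deriv_op mulmx_suml /mxtrace rmorph_sum scaler_suml; apply: eq_bigr => j _.
rewrite mulmx_suml (bigD1 j)//= big1 ?addr0 => [|m mj]; rewrite -scalemxAl E.
  by rewrite eqxx scale1r.
by rewrite (negbTE mj) scale0r scaler0.
Qed.

Let det_reindex p A (f : 'I_p -> 'I_n) : p = n -> injective f ->
  \det (\matrix_(a, b) A (f a) (f b)) = \det A.
Proof.
move=> pn; subst p => injf.
have -> : \matrix_(a, b) A (f a) (f b) = row_perm (perm.perm injf) (col_perm (perm.perm injf) A).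
  by apply/matrixP => a b; rewrite !mxE !perm.permE.
rewrite row_permE col_permE !det_mulmx !det_perm perm.odd_permV mulrCA -signr_addb addbb mulr1.
by [].
Qed.

Lemma set_minorT A : set_minor A finset.setT finset.setT = \det A.
Proof.
rewrite /set_minor; case: eqP => // e.
rewrite -(det_reindex A (f := fun a : 'I_#|finset.setTfor 'I_n| => enum_val a)).
- by congr (\det _); apply/matrixP => a b; rewrite !mxE; congr (A _ (enum_val _)); exact: val_inj.
- by rewrite cardsT card_ord.
- exact: enum_val_inj.
Qed.

Lemma compound_top A : (compound A *m top) (enum_rank finset.setT) 0 = (\det A)%:C.
Proof. by rewrite compound_bform set_minorT. Qed.

(** For a real form u the conjugation of v can be taken outside, and the rest is
   bilinear. *)
Lemma form_ip_real (G : 'M[R]_n) (u v : 'cV[C]_N) : (forall I, complex.Im (u I 0) = 0) ->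
  form_ip G u v = conjc ((u^T *m (compound (invmx G) *m v)) 0 0).
Proof.
move=> u_real; rewrite /form_ip mxE rmorph_sum; apply: eq_bigr => I _ /=.
rewrite !mxE rmorphM rmorph_sum mulr_sumr; apply: eq_bigr => J _ /=.
rewrite mxE rmorphM /=; have -> : (conjc (u I 0) = u I 0) by case: (u I 0) (u_real I) => a b /= ->; rewrite oppr0.
by rewrite oppr0 -mulrA; congr (_ * _); rewrite mulrC.
Qed.

Lemma smooth_compound O (H : pt -> 'M[R]_n) : open O -> smooth_mx O H ->
  smooth_cmx O (fun x => compound (H x)).
Proof.
move=> oO sH I J; have sm : smooth_on O (fun x => set_minor (H x) (enum_val I) (enum_val J)).
  rewrite /set_minor; case: eqP => [e|_]; last exact: smooth_cst.
  apply: (smooth_det oO) => a b.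
  by apply: (smooth_eq oO _ (sH (enum_val a) (enum_val (cast_ord e b)))) => y _; rewrite mxE.
split; first by apply: (smooth_eq oO _ sm) => y _; rewrite mxE.
by apply: (smooth_eq oO _ (@smooth_cst _ _ O 0)) => y _; rewrite mxE.
Qed.

Variable O : set pt.
Hypothesis oO : open O.
Variable g : pt -> 'M[R]_n.
Hypothesis g_smooth : smooth_mx O g.
Hypothesis g_sym : forall x, O x -> (g x)^T = g x.
Hypothesis g_pos : forall x, O x -> pos_def (g x).
Notation L := (conn_form g).
Notation conn_mx := (connection_mx g).
Notation nab := (form_nabla g).
Notation H x := (compound (ginv g x)).
Notation vol x := (Num.sqrt (\det (g x))).

Let sginv : smooth_mx O (ginv g). Proof. exact: ginv_smooth. Qed.
Let sH : smooth_cmx O (fun x => H x). Proof. exact: smooth_compound. Qed.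

Lemma conn_form_vac k x : L k x *m vac = 0.
Proof. by rewrite conn_formE mulNmx deriv_op_vac oppr0. Qed.

Lemma tr_conn_form k x : (L k x)^T = - deriv_op (conn_mx k x)^T.
Proof. by rewrite conn_formE linearN /= tr_deriv_op. Qed.

Lemma compound_extv A (v : 'rV[R]_n) :
  compound A *m extv v = extv (v *m A^T) *m compound A.
Proof.
rewrite {1}/extv mulmx_sumr mulmx_sum_row [extv (\sum_(_ <- _ | _) _)]raddf_sum mulmx_suml; apply: eq_bigr => k _ /=.
by rewrite extvZ -scalemxAl -scalemxAr compound_extm.
Qed.

Lemma extv_delta k : extv (delta_mx 0 k) = ext k.
Proof.
rewrite -(sum_delta (fun j => ext j) k); apply: eq_bigr => j _.
by rewrite mxE eqxx eq_sym; case: (_ == _); rewrite ?scale1r ?scale0r.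
Qed.

Let intertwine_leibniz (D LT L0 H0 E dE G1 G2 e : 'M[C]_N) :
  D *m e = dE *m H0 + E *m D -> L0 *m e = e *m L0 - G1 -> LT *m E = E *m LT - G2 ->
  H0 *m e = E *m H0 -> H0 *m G1 = (- dE - G2) *m H0 ->
  (D - (LT *m H0 + H0 *m L0)) *m e = E *m (D - (LT *m H0 + H0 *m L0)).
Proof.
move=> De Le LE He HG; rewrite mulmxBl mulmxDl -!mulmxA He Le De mulmxA LE.
rewrite !mulmxBr mulmxDr mulmxA He HG !mulmxBl mulNmx !mulmxA.
move: (dE *m H0) (E *m D) (E *m LT *m H0) (G2 *m H0) (E *m H0 *m L0) => a b c d f.
by apply/matrixP => i j; rewrite !mxE; ring.
Qed.

Let commute_oppl (Q e v : 'M[C]_N) : Q *m e - e *m Q = v -> - Q *m e = e *m - Q - v.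
Proof. by move=> <-; rewrite mulNmx mulmxN opprB addKr. Qed.

Lemma conn_form_extm k m x :
  L k x *m ext m = ext m *m L k x - extv (row m (conn_mx k x)^T).
Proof.
rewrite -[ext m]extv_delta conn_formE; apply: commute_oppl.
by rewrite deriv_op_extv -rowE.
Qed.

Lemma tr_conn_form_extv k v x :
  (L k x)^T *m extv v = extv v *m (L k x)^T - extv (v *m conn_mx k x).
Proof. by rewrite tr_conn_form; apply: commute_oppl; rewrite deriv_op_extv trmxK. Qed.

(** The metric on forms is parallel. Both sides are determined by how they
   intertwine the exterior multiplications, where the claim reduces to the
   parallelism of the inverse metric on covectors. *)
Lemma pderiv_compound_ginv k x : O x ->
  pderiv_cmx k (fun y => H y) x = (L k x)^T *m H x + H x *m L k x.
Proof.
move=> Ox; apply/eqP; rewrite -subr_eq0; apply/eqP.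
set D := pderiv_cmx k _ x.
pose E m := extv (row m (ginv g x)^T).
have HE m : H x *m ext m = E m *m H x by exact: compound_extm.
apply: (intertwiner_uniq (E := E)).
- rewrite mul0mx mulmxBl mulmxDl -!mulmxA conn_form_vac mulmx0 addr0 compound_bform0.
  rewrite tr_conn_form mulNmx deriv_op_vac oppr0 subr0.
  have := pderiv_cmxM oO k sH (smooth_cmx_cst O vac) Ox.
  rewrite pderiv_cmx_cst mulmx0 addr0 => <-.
  rewrite -(pderiv_cmx_cst k vac x); apply: (pderiv_cmx_eq oO) Ox => y Oy.
  exact: compound_bform0.
- move=> m.
  have srow : smooth_mx O (fun y => row m (ginv g y)^T).
    by move=> a b; apply: (smooth_eq oO _ (sginv b m)) => y _; rewrite !mxE.
  have DE : D *m ext m = extv (pderiv_mx k (fun y => row m (ginv g y)^T) x) *m H x + E m *m D.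
    have <- := pderiv_extv oO k srow Ox.
    rewrite -(pderiv_cmxM oO k (smooth_extv oO srow) sH Ox).
    have := pderiv_cmxM oO k sH (smooth_cmx_cst O (ext m)) Ox.
    rewrite pderiv_cmx_cst mulmx0 addr0 => <-.
    by apply: (pderiv_cmx_eq oO) Ox => y Oy; exact: compound_extm.
  have dE : pderiv_mx k (fun y => row m (ginv g y)^T) x =
     - (row m (ginv g x)^T *m conn_mx k x + row m (conn_mx k x)^T *m ginv g x).
    apply: etrans (_ : row m (pderiv_mx k (ginv g) x)^T = _).
      apply/rowP => b; rewrite mxE [RHS]mxE [RHS]mxE pderiv_mxE.
      by congr (pderiv k _ x); apply/funext => y; rewrite !mxE.
    rewrite (ginv_compat oO g_smooth g_sym g_pos k Ox) -!row_mul -linearD -linearN /=.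
    congr row; rewrite [LHS]linearN /= [(_ + _)^T]linearD /= !trmx_mul trmxK (ginv_sym g_sym Ox).
    by rewrite addrC.
  apply: (intertwine_leibniz DE (conn_form_extm k m x) (tr_conn_form_extv k _ x) (HE m)).
  rewrite compound_extv dE (ginv_sym g_sym Ox) -raddfN -raddfB opprK /=.
  by rewrite addrAC subrr add0r.
- by move=> m; rewrite mul0mx mulmx0.
Qed.

Let svol : smooth_on O (fun x => vol x).
Proof.
by apply: smooth_sqrt => // [x /g_pos|]; [exact: pos_def_det_gt0|exact: smooth_det].
Qed.

(** The derivative of the inverse metric determinant is the top degree part of
   the parallelism of the metric on forms. *)
Lemma pderiv_det_ginv k x : O x -> pderiv k (fun y => \det (ginv g y)) x =
  - (2 * \tr (conn_mx k x) * \det (ginv g x)).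
Proof.
move=> Ox.
have E1 : pderiv_cmx k (fun y => H y *m top) x (enum_rank finset.setT) 0 =
    (pderiv k (fun y => \det (ginv g y)) x)%:C.
  rewrite pderiv_cmxE -pderiv_cpx_real.
  by apply: (pderiv_cpx_eq oO) Ox => y _; rewrite compound_top.
have := pderiv_cmxM oO k sH (smooth_cmx_cst O top) Ox.
rewrite pderiv_cmx_cst mulmx0 addr0 pderiv_compound_ginv// mulmxDl.
have -> : H x *m L k x *m top = - (\tr (conn_mx k x))%:C *: (H x *m top).
  by rewrite -mulmxA conn_formE mulNmx deriv_op_top mulmxN -scalemxAr scaleNr.
move=> /matrixP /(_ (enum_rank finset.setT) 0); rewrite E1.
rewrite [in RHS]mxE [X in _ = _ + X]mxE compound_top.
have -> : ((L k x)^T *m H x *m top) (enum_rank finset.setT) 0 =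
   - (\tr (conn_mx k x))%:C * (\det (ginv g x))%:C.
  have topE (w : 'cV[C]_N) : w (enum_rank finset.setT) 0 = (top^T *m w) 0 0.
    by rewrite /bform trmx_delta -rowE [RHS]mxE.
  rewrite topE -mulmxA mulmxA -trmx_mul conn_formE mulNmx deriv_op_top -scaleNr.
  by rewrite linearZ /= -scalemxAl mxE -topE compound_top.
move=> /(congr1 (@complex.Re R)) /= ->; ring.
Qed.

(** Differentiate vol^2 det g^-1 = 1. *)
Lemma pderiv_vol k x : O x ->
  pderiv k (fun y => vol y) x = \tr (conn_mx k x) * vol x.
Proof.
move=> Ox; have sdi : smooth_on O (fun y => \det (ginv g y)) by exact: smooth_det.
have gt0 y : O y -> 0 < \det (g y) by move=> /g_pos; exact: pos_def_det_gt0.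
have E y : O y -> vol y * vol y * \det (ginv g y) = 1.
  move=> Oy; rewrite -expr2 sqr_sqrtr; last exact/ltW/gt0.
  by rewrite -det_mulmx (mulgV g_pos Oy) det1.
have D f : smooth_on O f -> differentiable f x by move=> sf; exact: (sf [::]).
have : pderiv k (fun y => vol y * vol y * \det (ginv g y)) x = 0.
  by rewrite -(pderiv_cst k 1 x); apply: (pderiv_open k oO) Ox => y Oy; rewrite E.
rewrite (pderivM k (D _ (smoothM oO svol svol)) (D _ sdi)).
rewrite (pderivM k (D _ svol) (D _ svol)) pderiv_det_ginv//.
have := E x Ox.
have v0 : vol x != 0 by rewrite sqrtr_eq0 -ltNge gt0.
move: (pderiv k _ x) (\tr _) => p t; move: (\det (ginv g x)) (vol x) v0 => d v v0 vd.
have d0 : d != 0 by apply: contra_eq_neq vd => ->; rewrite mulr0 eq_sym oner_eq0.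
move=> H0; apply: (mulfI v0); apply: (mulfI d0); apply: (mulfI (_ : 2 != 0 :> R)); first by rewrite pnatr_eq0.
move: H0 => /eqP; rewrite addr_eq0 => /eqP; rewrite mulrN opprK.
have -> : v * v * (2 * t * d) = 2 * (d * (v * (t * v))) by ring.
by move=> <-; ring.
Qed.

(** The Christoffel symbols are symmetric and exterior multiplications
   anticommute; hence d is also the sum of the dx^k wedge nabla_k. *)
Lemma extm_conn_form x : O x -> \sum_k ext k *m L k x = 0.
Proof.
move=> Ox; apply/eqP; rewrite -oppr_eq0 -sumrN; apply/eqP.
have -> : \sum_k - (ext k *m L k x) =
    \sum_m (\sum_k \sum_j (conn_mx k x j m)%:C *: (ext k *m ext j)) *m int m.
  under [RHS]eq_bigr do rewrite mulmx_suml.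
  rewrite exchange_big; apply: eq_bigr => k _; rewrite conn_formE mulmxN opprK.
  rewrite /deriv_op mulmx_sumr.
  under [RHS]eq_bigr do rewrite mulmx_suml.
  rewrite exchange_big; apply: eq_bigr => j _; rewrite mulmx_sumr; apply: eq_bigr => m _.
  by rewrite -scalemxAr -scalemxAl mulmxA.
rewrite big1 // => m _; set S := (X in X *m _).
suff /eqP: S = - S by rewrite -addr_eq0 -mulr2n -scaler_nat scaler_eq0 pnatr_eq0 => /eqP->; rewrite mul0mx.
rewrite {1}/S exchange_big -sumrN; apply: eq_bigr => k _; rewrite -sumrN.
apply: eq_bigr => j _; by rewrite extmC scalerN (conn_mxC oO g_sym k j m Ox).
Qed.

(** The zeroth order terms produced by the derivatives of the volume density and
   of the Gram matrix cancel: transposed, this is [extm_conn_form]. *)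
Lemma trace_conn_form x : O x ->
  \sum_k int k *m ((\tr (conn_mx k x))%:C%:M + (L k x)^T) = 0.
Proof.
move=> Ox; apply: trmx_inj; rewrite trmx0 linear_sum /=.
apply: etrans (_ : \sum_k (\tr (conn_mx k x))%:C *: ext k + \sum_k L k x *m ext k = _).
  rewrite -big_split; apply: eq_bigr => k _ /=.
  by rewrite trmx_mul /intm trmxK linearD /= trmxK tr_scalar_mx mulmxDl mul_scalar_mx.
under [X in _ + X]eq_bigr do rewrite conn_form_extm.
rewrite sumrB extm_conn_form// sub0r; apply/eqP; rewrite subr_eq0; apply/eqP.
rewrite /extv exchange_big; apply: eq_bigr => j _; rewrite -scaler_suml -rmorph_sum.
congr (_%:C *: _); apply: eq_bigr => k _; by rewrite !mxE (conn_mxC oO g_sym k j k Ox).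
Qed.

(** The test form phi dx^J. *)
Let real_basis_form (phi : pt -> R) (J : 'I_N) : pt -> 'cV[C]_N :=
  fun y => (phi y)%:C *: delta_mx J 0.

Let pderiv_real_basis_form phi J k y : smooth_on setT phi ->
  pderiv_cmx k (real_basis_form phi J) y = (pderiv k phi y)%:C *: delta_mx J 0.
Proof.
move=> sphi; have := pderiv_cmxZ k (smooth_cpx_real sphi)
  (smooth_cmx_cst setT (delta_mx J 0 : 'cV[C]_N)) (Logic.I : setT y).
by rewrite pderiv_cmx_cst scaler0 addr0 pderiv_cpx_real.
Qed.

(** The density through which the inner product with v is paired with forms. *)
Let densT (v : pt -> 'cV[C]_N) y : 'cV[C]_N := (vol y)%:C *: (H y *m v y).

Let dens_smooth v : smooth_cmx O v -> smooth_cmx O (densT v).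
Proof.
move=> sv; apply: smooth_cmxZ => //; first exact: (smooth_cpx_real svol).
exact: smooth_cmxM.
Qed.

Let delta_real (J I : 'I_N) : complex.Im ((delta_mx J 0 : 'cV[C]_N) I 0) = 0.
Proof. by rewrite mxE; case: (_ && _). Qed.

Let ext_delta_real (J : 'I_N) k (I : 'I_N) : complex.Im ((ext k *m (delta_mx J 0 : 'cV[C]_N)) I 0) = 0.
Proof.
rewrite -colE mxE mxE /=; case: ifP => // _.
by rewrite -signr_odd; case: (odd _); rewrite ?expr0 ?expr1 //= oppr0.
Qed.

Let ip_density (u : 'cV[C]_N) v y : (forall I, complex.Im (u I 0) = 0) ->
  form_ip (g y) u (v y) * (vol y)%:C = conjc ((u^T *m densT v y) 0 0).
Proof.
move=> u_real; rewrite form_ip_real//.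
have -> : (vol y)%:C = conjc (vol y)%:C by rewrite /= oppr0.
by rewrite -rmorphM mulrC -scalemxAr [in RHS]mxE.
Qed.

Let coordinate_ip (a : C) (J : 'I_N) (w : 'cV[C]_N) :
  ((a *: (delta_mx J 0 : 'cV[C]_N))^T *m w) 0 0 = a * w J 0.
Proof. by rewrite linearZ /= trmx_delta -scalemxAl -rowE !mxE. Qed.

Let ext_coordinate_ip (a : 'I_n -> C) (J : 'I_N) (w : 'cV[C]_N) :
  ((\sum_k a k *: (ext k *m (delta_mx J 0 : 'cV[C]_N)))^T *m w) 0 0 =
  \sum_k a k * (int k *m w) J 0.
Proof.
rewrite linear_sum mulmx_suml summxE; apply: eq_bigr => k _ /=.
by rewrite linearZ /= trmx_mul trmx_delta -scalemxAl -mulmxA -rowE [LHS]mxE [in LHS]mxE.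
Qed.

Let ip_basis_form phi J v y :
  form_ip (g y) (real_basis_form phi J y) (v y) * (vol y)%:C =
  conjc ((phi y)%:C * densT v y J 0).
Proof.
rewrite ip_density => [|I]; last first.
  by rewrite mxE; have := delta_real J I; case: (_ I 0) => a b /= ->; rewrite mulr0 mul0r addr0.
by rewrite /real_basis_form coordinate_ip.
Qed.

Let ip_d_basis_form phi J v y : smooth_on setT phi ->
  form_ip (g y) (dR (real_basis_form phi J) y) (v y) * (vol y)%:C =
  conjc (\sum_k (pderiv k phi y)%:C * (int k *m densT v y) J 0).
Proof.
move=> sphi; have -> : dR (real_basis_form phi J) y =
    \sum_k (pderiv k phi y)%:C *: (ext k *m delta_mx J 0).
  by apply: eq_bigr => k _; rewrite pderiv_real_basis_form// scalemxAr.
rewrite ip_density => [|I].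
  by rewrite ext_coordinate_ip.
rewrite summxE raddf_sum big1 // => k _ /=; rewrite mxE.
by have := ext_delta_real J k I; case: (_ I 0) => a b /= ->; rewrite mulr0 mul0r addr0.
Qed.

Let Re_opp_sum (a b : 'I_n -> R) :
  complex.Re (- \sum_k (a k +i* b k)) = - \sum_k a k.
Proof. by rewrite raddfN raddf_sum. Qed.

Let Im_opp_sum (a b : 'I_n -> R) :
  complex.Im (- \sum_k (a k +i* b k)) = - \sum_k b k.
Proof. by rewrite raddfN raddf_sum. Qed.

(** In the adjunction tested against phi dx^J, integration by parts makes the
   interior products of the density sqrt(det g) H beta appear. *)
Lemma codifferential_density delta (beta : pt -> 'cV[C]_N) x :
  formal_adjoint_d g O delta -> smooth_cmx O beta -> O x ->
  densT (delta beta) x = - \sum_k int k *m pderiv_cmx k (densT beta) x.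
Proof.
move=> adj sb Ox; have [sdb adjT] := adj beta sb.
have sT := dens_smooth sb; have sS := dens_smooth sdb.
have sw k : smooth_cmx O (fun y => int k *m densT beta y).
  by apply: smooth_cmxM => //; exact: smooth_cmx_cst.
apply/matrixP => J j; rewrite [j]ord1.
have l2E phi : test_function O phi ->
   ciint (fun y => conjc (\sum_k (pderiv k phi y)%:C * (int k *m densT beta y) J 0))
   = ciint (fun y => conjc ((phi y)%:C * densT (delta beta) y J 0)).
  move=> [sphi [S [cS SO phi0]]].
  have sa : smooth_cmx setT (real_basis_form phi J).
    apply: (smooth_cmxZ openT); first exact: (smooth_cpx_real sphi).
    exact: smooth_cmx_cst.
  have := adjT (real_basis_form phi J) S sa cS SO.
  rewrite /l2; under eq_fun do rewrite ip_d_basis_form//.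
  under [in RHS]eq_fun do rewrite ip_basis_form.
  by apply => y nSy; rewrite /real_basis_form phi0// scale0r.
have Resum (a : 'I_n -> R) (z : 'I_n -> C) :
    complex.Re (conjc (\sum_k (a k)%:C * z k)) = \sum_k a k * complex.Re (z k).
  rewrite !raddf_sum; apply: eq_bigr => k _; case: (z k) => p q /=.
  by rewrite mul0r subr0.
have Imsum (a : 'I_n -> R) (z : 'I_n -> C) :
    complex.Im (conjc (\sum_k (a k)%:C * z k)) = \sum_k a k * - complex.Im (z k).
  rewrite !raddf_sum; apply: eq_bigr => k _; case: (z k) => p q /=.
  by rewrite mul0r addr0 mulrN.
have Hre : complex.Re (densT (delta beta) x J 0) = 
  - \sum_k pderiv k (fun y => complex.Re ((int k *m densT beta y) J 0)) x.
  have s1 : smooth_on O (fun y => complex.Re (densT (delta beta) y J 0)) by have [] := sS J 0.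
  have s2 k : smooth_on O (fun y => complex.Re ((int k *m densT beta y) J 0)).
    by have [] := sw k J 0.
  apply: (weak_divergence_test oO s1 s2) Ox => phi /l2E /(congr1 (@complex.Re R)).
  rewrite [LHS]/= [in RHS]/= => E; apply: etrans (etrans E _); apply: eq_iint => y.
    by rewrite Resum.
  by case: (densT _ y J 0) => p q /=; rewrite mul0r subr0.
have sI k : smooth_on O (fun y => complex.Im ((int k *m densT beta y) J 0)).
  by have [] := sw k J 0.
have Him : - complex.Im (densT (delta beta) x J 0) = 
  - \sum_k pderiv k (fun y => - complex.Im ((int k *m densT beta y) J 0)) x.
  have s1 : smooth_on O (fun y => - complex.Im (densT (delta beta) y J 0)).
    by apply: smoothN => //; have [] := sS J 0.
  have s2 k : smooth_on O (fun y => - complex.Im ((int k *m densT beta y) J 0)).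
    by apply: smoothN.
  apply: (weak_divergence_test oO s1 s2) Ox => phi /l2E /(congr1 (@complex.Im R)).
  rewrite [LHS]/= [in RHS]/= => E; apply: etrans (etrans E _); apply: eq_iint => y.
    by rewrite Imsum.
  by case: (densT _ y J 0) => p q /=; rewrite mul0r addr0 mulrN.
have E k : (int k *m pderiv_cmx k (densT beta) x) J 0 =
    pderiv k (fun y => complex.Re ((int k *m densT beta y) J 0)) x +i*
    pderiv k (fun y => complex.Im ((int k *m densT beta y) J 0)) x.
  have := pderiv_cmxM oO k (smooth_cmx_cst O (int k)) sT Ox.
  by rewrite pderiv_cmx_cst mul0mx add0r => <-; rewrite pderiv_cmxE.
have dN k : pderiv k (fun y => - complex.Im ((int k *m densT beta y) J 0)) x =
    - pderiv k (fun y => complex.Im ((int k *m densT beta y) J 0)) x.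
  have di : differentiable (fun y => complex.Im ((int k *m densT beta y) J 0)) x.
    exact: (sI k [::]).
  by rewrite /pderiv -deriveN//; exact: diff_derivable.
have -> : (- \sum_k int k *m pderiv_cmx k (densT beta) x) J 0 =
    - \sum_k (pderiv k (fun y => complex.Re ((int k *m densT beta y) J 0)) x +i*
      pderiv k (fun y => complex.Im ((int k *m densT beta y) J 0)) x).
  by rewrite mxE summxE; congr (- _); apply: eq_bigr => k _; rewrite E.
apply/eqP; rewrite eq_complex; apply/andP; split; apply/eqP.
  by rewrite Hre Re_opp_sum.
rewrite -[LHS]opprK Him opprK Im_opp_sum -sumrN.
by apply: eq_bigr => k _; rewrite dN.
Qed.

(** By the product rule the divergence of the density is the one of beta for the
   connection, up to terms that cancel by [trace_conn_form]; the invertible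
   factor sqrt(det g) H is then divided out. *)
Lemma codifferentialE delta (beta : pt -> 'cV[C]_N) x :
  formal_adjoint_d g O delta -> smooth_cmx O beta -> O x ->
  delta beta x = - \sum_k contr (row k (ginv g x)) *m nab k beta x.
Proof.
move=> adj sb Ox; have := codifferential_density adj sb Ox.
have vol0 : vol x != 0 by rewrite sqrtr_eq0 -ltNge pos_def_det_gt0//; exact: g_pos.
have dT k : pderiv_cmx k (densT beta) x = (vol x)%:C *:
    (((\tr (conn_mx k x))%:C%:M + (L k x)^T) *m (H x *m beta x) + H x *m nab k beta x).
  have sHb := smooth_cmxM oO sH sb.
  rewrite (pderiv_cmxZ k (smooth_cpx_real svol) sHb Ox) pderiv_cpx_real pderiv_vol//.
  rewrite (pderiv_cmxM oO k sH sb Ox) pderiv_compound_ginv// form_nablaE.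
  rewrite rmorphM mulrC -scalerA -scalerDr; congr (_ *: _).
  rewrite /= !mulmxDl mul_scalar_mx mulmxDr !mulmxA -!addrA; congr (_ + (_ + _)).
  exact: addrC.
have intH k : int k *m H x = H x *m contr (row k (ginv g x)).
  apply: trmx_inj; rewrite !trmx_mul /intm trmxK tr_compound (ginv_sym g_sym Ox).
  rewrite compound_extm (ginv_sym g_sym Ox); congr (_ *m _).
  by rewrite /contr linear_sum; apply: eq_bigr => j _ /=; rewrite linearZ /= /intm trmxK.
under eq_bigr do rewrite dT -scalemxAr mulmxDr [int _ *m ((_ + _) *m _)]mulmxA [int _ *m (H x *m _)]mulmxA intH.
rewrite -scaler_sumr big_split /= -mulmx_suml trace_conn_form// mul0mx add0r /densT.
have volC : (vol x)%:C != 0 by rewrite eq_complex /= eqxx andbT.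
rewrite -scalerN => /(scalerI volC) /(congr1 (mulmx (compound (g x)))).
rewrite mulmxN mulmx_sumr mulmxA compoundM (mulgV g_pos Ox) compound1 mul1mx => ->.
congr (- _); apply: eq_bigr => k _.
by rewrite !mulmxA compoundM (mulgV g_pos Ox) compound1 mul1mx.
Qed.

End Codifferential.
(** * The square of the Dirac operator *)

(** The operator d + delta, as the Dirac operator of the bundle of forms. *)
HB.lock Definition dirac {R : realType} {n p : nat} (g : 'rV[R]_n -> 'M[R]_n)
    (u : 'rV[R]_n -> 'M[R[i]]_(dimL n, p)) (x : 'rV[R]_n) : 'M[R[i]]_(dimL n, p) :=
  \sum_k cliff_up g k x *m form_nabla g k u x.

HB.lock Definition cov_hessian {R : realType} {n p : nat} (g : 'rV[R]_n -> 'M[R]_n)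
    (k l : 'I_n) (u : 'rV[R]_n -> 'M[R[i]]_(dimL n, p)) (x : 'rV[R]_n) :
    'M[R[i]]_(dimL n, p) :=
  form_nabla g k (form_nabla g l u) x
  - \sum_m (connection_mx g k x l m)%:C *: form_nabla g m u x.

(** The curvature endomorphism of the Weitzenboeck formula. *)
HB.lock Definition weitzenboeck {R : realType} {n : nat} (g : 'rV[R]_n -> 'M[R]_n)
    (x : 'rV[R]_n) : 'M[R[i]]_(dimL n) :=
  2^-1 *: \sum_k \sum_l
    cliff_up g k x *m cliff_up g l x *m deriv_op (curvature_mx g k l x).

Section DiracSquare.
Context {R : realType} {n : nat}.
Notation pt := 'rV[R]_n.
Notation C := R[i].
Notation N := (dimL n).
Variable O : set pt.
Hypothesis oO : open O.
Variable g : pt -> 'M[R]_n.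
Hypothesis g_smooth : smooth_mx O g.
Hypothesis g_sym : forall x, O x -> (g x)^T = g x.
Hypothesis g_pos : forall x, O x -> pos_def (g x).
Implicit Types (i j k l m : 'I_n) (x : pt) (F : pt -> 'M[C]_N).
Notation ext k := (@extm R n k).
Notation conn_mx := (connection_mx g).
Notation curv_mx := (curvature_mx g).
Notation L := (conn_form g).
Notation nab := (form_nabla g).
Notation nabE := (endo_nabla g).
Notation c := (cliff_up g).
Notation D := (dirac g).
Notation hess := (cov_hessian g).

Lemma cliff_up_cliff k x : O x -> c k x = cliff (g x) (row k (ginv g x)).
Proof. by move=> Ox; rewrite cliff_upE /cliff wedgeE -row_mul (mulVg g_pos Ox) row1. Qed.

Lemma cliff_up_anticomm k l x : O x ->
  c k x *m c l x + c l x *m c k x = (- (2 * ginv g x k l))%:C%:M.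
Proof.
move=> Ox; rewrite !cliff_up_cliff// (cliff_anticomm (g_sym Ox)); congr ((- (2 * _))%:C%:M).
by rewrite -row_mul (mulVg g_pos Ox) row1 -rowE -{1}(ginv_sym g_sym Ox) !mxE.
Qed.

Let cliff_smooth (X : pt -> pt) : smooth_mx O X -> smooth_cmx O (fun y => cliff (g y) (X y)).
Proof.
move=> sX; apply: smooth_cmxB => //; last exact: smooth_contr.
by apply: (smooth_extv oO (v := fun y => X y *m g y)); exact: smooth_mxM.
Qed.

Lemma endo_nabla_cliff k (Y : pt -> pt) x : smooth_mx O Y -> O x ->
  nabE k (fun y => cliff (g y) (Y y)) x = cliff (g x) (cov_deriv_row g k Y x).
Proof.
move=> sY Ox; have sYg := smooth_mxM oO sY g_smooth.
rewrite (endo_nablaB oO g k (smooth_extv oO sYg) (smooth_contr oO sY) Ox).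
rewrite (endo_nabla_contr oO)//; congr (_ - _); rewrite (endo_nabla_extv oO)//.
rewrite wedgeE; congr extv; rewrite (pderiv_mxM k sY g_smooth Ox).
rewrite (metric_compat oO g_sym g_pos k Ox) cov_derivE mulmxDl mulmxDr !mulmxA.
by rewrite addrA addrK.
Qed.

Lemma cov_hessianE p k l (u : pt -> 'M[C]_(N, p)) x : hess k l u x =
  nab k (nab l u) x - \sum_m (conn_mx k x l m)%:C *: nab m u x.
Proof. by rewrite cov_hessian.unlock. Qed.

Lemma diracE p (u : pt -> 'M[C]_(N, p)) x : D u x = \sum_k c k x *m nab k u x.
Proof. by rewrite dirac.unlock. Qed.

Lemma dirac_smooth p (u : pt -> 'M[C]_(N, p)) : smooth_cmx O u -> smooth_cmx O (D u).
Proof.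
move=> su; rewrite dirac.unlock; apply: smooth_cmx_sum => // k.
apply: (smooth_cmxM oO (cliff_up_smooth oO g_smooth g_pos k)).
exact: (form_nabla_smooth oO g_smooth g_pos).
Qed.

Lemma dR_dirac delta (u : pt -> 'cV[C]_N) x : formal_adjoint_d g O delta ->
  smooth_cmx O u -> O x -> dR u x + delta u x = D u x.
Proof.
move=> adj su Ox; rewrite (codifferentialE oO g_smooth g_sym g_pos adj su Ox) diracE.
rewrite -sumrN.
have -> : dR u x = \sum_k ext k *m nab k u x.
  under [RHS]eq_bigr do rewrite form_nablaE mulmxDr mulmxA.
  by rewrite big_split /= -mulmx_suml (extm_conn_form oO)// mul0mx addr0.
rewrite -big_split; apply: eq_bigr => k _ /=.
by rewrite cliff_upE mulmxBl extv_delta.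
Qed.

Lemma form_nabla_dirac p k (u : pt -> 'M[C]_(N, p)) x : smooth_cmx O u -> O x ->
  nab k (D u) x = \sum_l c l x *m hess k l u x.
Proof.
move=> su Ox; have sc l := cliff_up_smooth oO g_smooth g_pos l.
have sn l := form_nabla_smooth oO g_smooth g_pos l su.
apply: etrans (_ : nab k (fun y => \sum_l c l y *m nab l u y) x = _).
  by apply: (form_nabla_eq oO) Ox => y _; rewrite diracE.
rewrite (form_nabla_sum oO)// => [|l]; last exact: (smooth_cmxM oO (sc l) (sn l)).
under eq_bigr do rewrite (form_nablaM oO)//.
under eq_bigr do rewrite (endo_nabla_cliff_up oO)//.
under [RHS]eq_bigr do rewrite cov_hessianE mulmxBr.
rewrite big_split sumrB /= addrC; congr (_ + _).
under eq_bigr do rewrite mulNmx mulmx_suml.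
rewrite sumrN exchange_big; congr (- _); apply: eq_bigr => m _ /=.
rewrite mulmx_sumr; apply: eq_bigr => l _.
by rewrite -scalemxAl -scalemxAr.
Qed.

Lemma cov_hessianC p k l (u : pt -> 'M[C]_(N, p)) x : smooth_cmx O u -> O x ->
  hess k l u x - hess l k u x = - (deriv_op (curv_mx k l x) *m u x).
Proof.
move=> su Ox; rewrite -(form_nablaC oO g_smooth g_pos k l su Ox) !cov_hessianE.
have -> : \sum_m (conn_mx l x k m)%:C *: nab m u x =
    \sum_m (conn_mx k x l m)%:C *: nab m u x.
  by apply: eq_bigr => m _; rewrite (conn_mxC oO g_sym l k m Ox).
by rewrite opprB addrA addrNK.
Qed.

(** The symmetric part of a product of two generators is scalar; what remains is
   the contraction with the antisymmetric part of h. *)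
Lemma clifford_contract p (a : 'I_n -> 'M[C]_N) (h : 'I_n -> 'I_n -> 'M[C]_(N, p))
    (G : 'I_n -> 'I_n -> C) :
  (forall k l, a k *m a l + a l *m a k = (- (2 * G k l))%:M) ->
  \sum_k \sum_l a k *m a l *m h k l =
  2^-1 *: \sum_k \sum_l a k *m a l *m (h k l - h l k) - \sum_k \sum_l G k l *: h k l.
Proof.
move=> aa; have two : 2 != 0 :> C by rewrite pnatr_eq0.
apply: (scalerI two); rewrite scalerBr scalerA mulfV// scale1r.
have -> : \sum_k \sum_l a k *m a l *m (h k l - h l k) =
    \sum_k \sum_l a k *m a l *m h k l - \sum_k \sum_l a l *m a k *m h k l.
  rewrite [X in _ - X]exchange_big -sumrB; apply: eq_bigr => k _.
  by rewrite -sumrB; apply: eq_bigr => l _; rewrite mulmxBr.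
rewrite scaler_nat mulr2n -addrA; congr (_ + _); apply/eqP; rewrite -subr_eq0; apply/eqP.
rewrite opprD !opprK addrA -big_split /= scaler_sumr -big_split big1 // => k _ /=.
rewrite -big_split /= scaler_sumr -big_split big1 // => l _ /=.
by rewrite -mulmxDl aa mul_scalar_mx scalerA scaleNr addNr.
Qed.

(** The antisymmetric part of the Hessian is the curvature. *)
Lemma dirac_dirac p (u : pt -> 'M[C]_(N, p)) x : smooth_cmx O u -> O x ->
  D (D u) x = - \sum_k \sum_l (ginv g x k l)%:C *: hess k l u x - weitzenboeck g x *m u x.
Proof.
move=> su Ox; rewrite [LHS]diracE.
under eq_bigr do rewrite form_nabla_dirac// mulmx_sumr.
under eq_bigr do under eq_bigr do rewrite mulmxA.
rewrite (@clifford_contract p (fun k => c k x) (fun k l => hess k l u x) (fun k l => (ginv g x k l)%:C)).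
  rewrite [LHS]addrC; congr (_ + _).
  under eq_bigr do under eq_bigr do rewrite cov_hessianC// mulmxN mulmxA.
  rewrite weitzenboeck.unlock -scalemxAl -scalerN; congr (_ *: _).
  rewrite mulmx_suml -sumrN; apply: eq_bigr => k _; rewrite mulmx_suml -sumrN.
  by [].
by move=> k l; rewrite cliff_up_anticomm// rmorphN rmorphM rmorph_nat.
Qed.

(** ** Completing the square *)

(** The endomorphism left over when a first order term F D is absorbed into
   the connection. *)
Definition twist_potential F x : 'M[C]_N :=
  4^-1 *: \sum_k \sum_l (ginv g x k l)%:C *:
     (F x *m cliff (g x) (delta_mx 0 k) *m (F x *m cliff (g x) (delta_mx 0 l)))
  - 2^-1 *: \sum_k nabE k F x *m c k x.

(** The one-form added to the connection; its contraction with the metric is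
   chosen so that twice the cross term cancels F D. *)
Definition twist_form F k x : 'M[C]_N := - (2^-1 *: (F x *m cliff (g x) (delta_mx 0 k))).

Lemma twist_form_smooth F k : smooth_cmx O F -> smooth_cmx O (twist_form F k).
Proof.
move=> sF; have s0 : smooth_mx O (fun=> delta_mx 0 k : 'rV[R]_n) by exact: smooth_mx_cst.
apply: (smooth_cmxN oO); apply: (smooth_cmxZ oO); first exact: smooth_cpx_cst.
exact: (smooth_cmxM oO sF (cliff_smooth s0)).
Qed.

Lemma cliff_up_sum l x : O x ->
  \sum_k (ginv g x k l)%:C *: cliff (g x) (delta_mx 0 k) = c l x.
Proof.
move=> Ox; rewrite cliff_up_cliff//.
rewrite cliff_coord; apply: eq_bigr => k _.
by rewrite mxE -[in RHS](ginv_sym g_sym Ox) mxE.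
Qed.

Lemma twist_form_trace F l x : O x ->
  \sum_k (ginv g x k l)%:C *: twist_form F k x = - (2^-1 *: (F x *m c l x)).
Proof.
move=> Ox; rewrite -(cliff_up_sum l Ox) mulmx_sumr scaler_sumr -sumrN.
apply: eq_bigr => k _; rewrite /twist_form scalerN -scalemxAr !scalerA.
by rewrite mulrC.
Qed.

Lemma endo_nabla_cliff_delta k j x : O x ->
  nabE k (fun y => cliff (g y) (delta_mx 0 j)) x =
  \sum_m (conn_mx k x j m)%:C *: cliff (g x) (delta_mx 0 m).
Proof.
move=> Ox; have s0 : smooth_mx O (fun=> delta_mx 0 j : 'rV[R]_n) by exact: smooth_mx_cst.
rewrite endo_nabla_cliff// cov_derivE pderiv_mx_cst add0r -rowE cliff_coord.
by apply: eq_bigr => m _; rewrite mxE.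
Qed.

Lemma endo_nabla_twist_form F k l x : smooth_cmx O F -> O x ->
  nabE k (twist_form F l) x - \sum_m (conn_mx k x l m)%:C *: twist_form F m x =
  - (2^-1 *: (nabE k F x *m cliff (g x) (delta_mx 0 l))).
Proof.
move=> sF Ox; have s0 : smooth_mx O (fun=> delta_mx 0 l : 'rV[R]_n) by exact: smooth_mx_cst.
have sc := cliff_smooth s0.
apply: etrans (_ : nabE k (fun y => - 2^-1 *: (F y *m cliff (g y) (delta_mx 0 l))) x - _ = _).
  congr (_ - _); apply: (endo_nabla_eq oO) Ox => y _.
  by rewrite /twist_form scaleNr.
rewrite (endo_nablaZ g k (smooth_cpx_cst O _) (smooth_cmxM oO sF sc) Ox) pderiv_cpx_cst scale0r add0r.
rewrite (endo_nablaM oO g k sF sc Ox) endo_nabla_cliff_delta//.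
rewrite scalerDr scaleNr -[RHS]addr0 -addrA; congr (_ + _).
rewrite mulmx_sumr scaler_sumr -sumrB big1 // => m _.
by rewrite /twist_form scaleNr scalerN opprK -scalemxAr !scalerA [_ * 2^-1]mulrC addNr.
Qed.

Lemma twist_form_divergence F x : smooth_cmx O F -> O x ->
  \sum_k \sum_l (ginv g x k l)%:C *:
    (nabE k (twist_form F l) x - \sum_m (conn_mx k x l m)%:C *: twist_form F m x) =
  - (2^-1 *: \sum_k nabE k F x *m c k x).
Proof.
move=> sF Ox; under eq_bigr do under eq_bigr do rewrite endo_nabla_twist_form//.
rewrite scaler_sumr -sumrN; apply: eq_bigr => k _.
rewrite -(cliff_up_sum k Ox) mulmx_sumr scaler_sumr -sumrN; apply: eq_bigr => l _.
rewrite scalerN -scalemxAr !scalerA mulrC; congr (- ((_ * _%:C) *: _)).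
by rewrite -[in LHS](ginv_sym g_sym Ox) mxE.
Qed.

Lemma twist_form_sqr F x : \sum_k \sum_l (ginv g x k l)%:C *: (twist_form F k x *m twist_form F l x)
  = 4^-1 *: \sum_k \sum_l (ginv g x k l)%:C *:
     (F x *m cliff (g x) (delta_mx 0 k) *m (F x *m cliff (g x) (delta_mx 0 l))).
Proof.
rewrite scaler_sumr; apply: eq_bigr => k _; rewrite scaler_sumr; apply: eq_bigr => l _.
rewrite /twist_form mulNmx mulmxN opprK -scalemxAl -scalemxAr !scalerA; congr (_ *: _).
by rewrite -mulrA -invfM -natrM mulrC.
Qed.

Lemma twist_potentialE F x : smooth_cmx O F -> O x -> twist_potential F x =
  \sum_k \sum_l (ginv g x k l)%:C *:
    (nabE k (twist_form F l) x - \sum_m (conn_mx k x l m)%:C *: twist_form F m x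
     + twist_form F k x *m twist_form F l x).
Proof.
move=> sF Ox; rewrite /twist_potential -twist_form_sqr -twist_form_divergence// addrC.
rewrite -big_split; apply: eq_bigr => k _; rewrite -big_split; apply: eq_bigr => l _.
by rewrite [RHS]scalerDr.
Qed.

Let dvec_sum p (h : 'I_n -> 'M[C]_(N, p)) i x :
  \sum_m ((@dvec R n i x) 0 m)%:C *: h m = h i.
Proof.
rewrite (bigD1 i)//= big1 => [|m mi]; first by rewrite mxE !eqxx scale1r addr0.
by rewrite mxE (negbTE mi) andbF scale0r.
Qed.

Lemma nabla_dvec (omega : 'I_n -> pt -> 'M[C]_N) i (u : pt -> 'cV[C]_N) x :
  nabla omega (dvec i) u x = pderiv_cmx i u x + omega i x *m u x.
Proof. exact: (dvec_sum (fun m => pderiv_cmx m u x + omega m x *m u x)). Qed.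

Lemma nablaL_dvec2 i j m x : nablaL g (dvec i) (dvec j) x 0 m = conn_mx i x j m.
Proof. by rewrite nablaL_dvec pderiv_mx_cst add0r -rowE mxE. Qed.

Lemma nabla_nablaL_dvec (omega : 'I_n -> pt -> 'M[C]_N) i j (u : pt -> 'cV[C]_N) x :
  nabla omega (nablaL g (dvec i) (dvec j)) u x =
  \sum_m (conn_mx i x j m)%:C *: (pderiv_cmx m u x + omega m x *m u x).
Proof. by apply: eq_bigr => m _; rewrite nablaL_dvec2. Qed.

Let nabla_shift (a : 'I_n -> pt -> 'M[C]_N) k (u : pt -> 'cV[C]_N) x :
  pderiv_cmx k u x + (L k x + a k x) *m u x = nab k u x + a k x *m u x.
Proof. by rewrite form_nablaE mulmxDl addrA. Qed.

Let shifted_hessian_terms (a b c0 d e f h : 'cV[C]_N) :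
  a + (b + c0) + (d + e) - (f + h) = a - f + (b - h + e) + c0 + d.
Proof. by apply/matrixP => i j; rewrite !mxE; ring. Qed.

Let first_order_balance (h t f r : 'cV[C]_N) :
  - h - r + f = - (h + t + - (2^-1 *: f) + - (2^-1 *: f)) - r + t.
Proof. by apply/matrixP => i j; rewrite !mxE; field. Qed.

Lemma rough_laplacian_shift (a : 'I_n -> pt -> 'M[C]_N) (u : pt -> 'cV[C]_N) x :
  (forall k, smooth_cmx O (a k)) -> smooth_cmx O u -> O x ->
  rough_laplacian g (fun k y => L k y + a k y) u x =
  \sum_k \sum_l (ginv g x k l)%:C *: (hess k l u x
    + (nabE k (a l) x - \sum_m (conn_mx k x l m)%:C *: a m x + a k x *m a l x) *m u x
    + a l x *m nab k u x + a k x *m nab l u x).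
Proof.
move=> sa su Ox; apply: eq_bigr => k _; apply: eq_bigr => l _; congr (_ *: _).
have sau := smooth_cmxM oO (sa l) su.
have sn := form_nabla_smooth oO g_smooth g_pos l su.
rewrite nabla_nablaL_dvec nabla_dvec nabla_shift.
have E y : O y -> nabla (fun k y => L k y + a k y) (dvec l) u y = nab l u y + a l y *m u y.
  by move=> _; rewrite nabla_dvec nabla_shift.
rewrite (form_nabla_eq oO g k E Ox) (E x Ox) (form_nablaD g k sn sau Ox).
rewrite (form_nablaM oO g k (sa l) su Ox) cov_hessianE.
under eq_bigr do rewrite nabla_shift scalerDr.
rewrite big_split /= mulmxDr mulmxDl mulmxBl.
have -> : \sum_m (conn_mx k x l m)%:C *: (a m x *m u x) =
    (\sum_m (conn_mx k x l m)%:C *: a m x) *m u x.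
  by rewrite mulmx_suml; apply: eq_bigr => m _; rewrite scalemxAl.
rewrite [a k x *m (a l x *m u x)]mulmxA.
exact: shifted_hessian_terms.
Qed.

(** Adding a_k to the connection adds 2 g^kl a_k nabla_l to its Laplacian; for
   a_k = - 1/2 F c_k this is - F D. *)
Lemma dirac_twisted F (u : pt -> 'cV[C]_N) x : smooth_cmx O F -> smooth_cmx O u -> O x ->
  D (D u) x + F x *m D u x =
  - rough_laplacian g (fun k y => L k y + twist_form F k y) u x
  - weitzenboeck g x *m u x + twist_potential F x *m u x.
Proof.
move=> sF su Ox; rewrite dirac_dirac// rough_laplacian_shift//; last first.
  by move=> k; exact: twist_form_smooth.
have FD : \sum_k \sum_l (ginv g x k l)%:C *: (twist_form F k x *m nab l u x) =
    - (2^-1 *: (F x *m D u x)).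
  rewrite exchange_big diracE mulmx_sumr scaler_sumr -sumrN; apply: eq_bigr => l _.
  under eq_bigr do rewrite scalemxAl.
  by rewrite -mulmx_suml twist_form_trace// mulNmx -scalemxAl mulmxA.
have FD' : \sum_k \sum_l (ginv g x k l)%:C *: (twist_form F l x *m nab k u x) =
    - (2^-1 *: (F x *m D u x)).
  rewrite -FD exchange_big; apply: eq_bigr => k _; apply: eq_bigr => l _.
  by rewrite -[in LHS](ginv_sym g_sym Ox) mxE.
apply: etrans (first_order_balance _ (twist_potential F x *m u x) _ _) _.
congr (- _ - _ + _); rewrite -[X in _ + X + _]FD' -[X in _ + X]FD twist_potentialE//.
rewrite mulmx_suml -!big_split; apply: eq_bigr => k _ /=.
rewrite mulmx_suml -!big_split; apply: eq_bigr => l _ /=.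
by rewrite -scalemxAl -!scalerDr.
Qed.

(** ** The canonical connection *)

(** Constant sections and coordinate functions times constant sections have no
   second derivatives, and separate the other coefficients. *)
Lemma laplace_form_uniq P A B A' B' : laplace_form g O P A B ->
  laplace_form g O P A' B' -> forall i x, O x -> A i x = A' i x.
Proof.
move=> [sA sB PA] [sA' sB' PA'] i x Ox.
suff E (v : 'cV[C]_N) : A i x *m v = A' i x *m v.
  by apply/matrixP => I J; have /matrixP/(_ I 0) := E (delta_mx J 0); rewrite -!colE !mxE.
have P2 (u : pt -> 'cV[C]_N) : smooth_cmx O u -> (forall j k, pderiv_cmx j (pderiv_cmx k u) x = 0) ->
    \sum_j A j x *m pderiv_cmx j u x + B x *m u x =
    \sum_j A' j x *m pderiv_cmx j u x + B' x *m u x.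
  move=> su d2; have := PA u x su Ox; rewrite (PA' u x su Ox) => /oppr_inj.
  have -> : \sum_j \sum_k (ginv g x j k)%:C *: pderiv_cmx j (pderiv_cmx k u) x = 0.
    by rewrite big1 // => j _; rewrite big1 // => k _; rewrite d2 scaler0.
  by rewrite !add0r.
have sv : smooth_cmx O (fun=> v) by exact: smooth_cmx_cst.
have dv j : pderiv_cmx j (fun=> v) = (fun=> 0) by apply/funext => y; exact: pderiv_cmx_cst.
have E0 : B x *m v = B' x *m v.
  have := P2 (fun=> v) sv; rewrite !big1 => [|j _|j _]; try by rewrite dv mulmx0.
  by rewrite !add0r; apply => j k; rewrite dv pderiv_cmx_cst.
have sy : smooth_on setT (fun y : pt => y 0 i) by exact: smooth_coordinate.
pose u (y : pt) : 'cV[C]_N := (y 0 i)%:C *: v.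
have du j : pderiv_cmx j u = (fun=> (j == i)%:R *: v).
  apply/funext => y.
  have := pderiv_cmxZ j (smooth_cpx_real sy) (smooth_cmx_cst setT v) (Logic.I : setT y).
  by rewrite pderiv_cmx_cst scaler0 addr0 pderiv_cpx_real pderiv_coordinate rmorph_nat.
have su : smooth_cmx O u.
  by apply: (smooth_cmxZ oO) => //; apply: smooth_cpx_real; exact: smooth_coordinate.
have := P2 u su; rewrite (bigD1 i)//= [X in _ = X + _](bigD1 i)//= du eqxx scale1r.
rewrite !big1 => [|j ji|j ji]; try by rewrite du (negbTE ji) scale0r mulmx0.
rewrite !addr0 /u -!scalemxAr E0 => E1; apply: addIr (E1 _) => j k.
by rewrite du pderiv_cmx_cst.
Qed.

Definition rough_first_order (omega : 'I_n -> pt -> 'M[C]_N) i x : 'M[C]_N :=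
  2 *: (\sum_j (ginv g x i j)%:C *: omega j x)
  - (\sum_k \sum_l ginv g x k l * christoffel g i k l x)%:C%:M.

Definition rough_zeroth_order (omega : 'I_n -> pt -> 'M[C]_N) x : 'M[C]_N :=
  \sum_k \sum_l (ginv g x k l)%:C *: (pderiv_cmx k (omega l) x + omega k x *m omega l x
     - \sum_m (conn_mx k x l m)%:C *: omega m x).

Let rough_terms (a b c0 d e f h : 'cV[C]_N) :
  a + (b + c0) + (d + e) - (f + h) = a + (c0 + d - f) + (b + e - h).
Proof. by apply/matrixP => i j; rewrite !mxE; ring. Qed.

Let potential_sign (a b z e : 'cV[C]_N) : - (a + b + z) + e = - (a + b + (z - e)).
Proof. by apply/matrixP => i j; rewrite !mxE; ring. Qed.

Lemma smooth_scalar (f : pt -> R) : smooth_on O f -> smooth_cmx O (fun y => (f y)%:C%:M : 'M[C]_N).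
Proof.
move=> sf; have s1 : smooth_cmx O (fun=> 1%:M : 'M[C]_N) by exact: smooth_cmx_cst.
apply: (smooth_cmx_eq oO _ (smooth_cmxZ oO (smooth_cpx_real sf) s1)) => y _.
by rewrite scale_scalar_mx mulr1.
Qed.

Lemma rough_laplacianE omega (u : pt -> 'cV[C]_N) x :
  (forall k, smooth_cmx O (omega k)) -> smooth_cmx O u -> O x ->
  rough_laplacian g omega u x =
  \sum_k \sum_l (ginv g x k l)%:C *: pderiv_cmx k (pderiv_cmx l u) x
  + \sum_i rough_first_order omega i x *m pderiv_cmx i u x
  + rough_zeroth_order omega x *m u x.
Proof.
move=> so su Ox.
have E k l : nabla omega (dvec k) (nabla omega (dvec l) u) x
     - nabla omega (nablaL g (dvec k) (dvec l)) u x =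
   pderiv_cmx k (pderiv_cmx l u) x
   + (omega l x *m pderiv_cmx k u x + omega k x *m pderiv_cmx l u x
      - \sum_m (conn_mx k x l m)%:C *: pderiv_cmx m u x)
   + (pderiv_cmx k (omega l) x + omega k x *m omega l x
     - \sum_m (conn_mx k x l m)%:C *: omega m x) *m u x.
  have su' := smooth_cmx_pderiv oO l su; have sou := smooth_cmxM oO (so l) su.
  have En y : O y -> nabla omega (dvec l) u y = pderiv_cmx l u y + omega l y *m u y.
    by move=> _; rewrite nabla_dvec.
  rewrite nabla_nablaL_dvec nabla_dvec (pderiv_cmx_eq oO k En Ox) (En x Ox).
  rewrite (pderiv_cmxD k su' sou Ox) (pderiv_cmxM oO k (so l) su Ox).
  under eq_bigr do rewrite scalerDr.
  rewrite big_split /= mulmxDr mulmxBl mulmxDl.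
  have -> : \sum_m (conn_mx k x l m)%:C *: (omega m x *m u x) =
      (\sum_m (conn_mx k x l m)%:C *: omega m x) *m u x.
    by rewrite mulmx_suml; apply: eq_bigr => m _; rewrite scalemxAl.
  rewrite [omega k x *m (omega l x *m u x)]mulmxA.
  exact: rough_terms.
apply: etrans (_ : \sum_k \sum_l (ginv g x k l)%:C *: (pderiv_cmx k (pderiv_cmx l u) x
   + (omega l x *m pderiv_cmx k u x + omega k x *m pderiv_cmx l u x
      - \sum_m (conn_mx k x l m)%:C *: pderiv_cmx m u x)
   + (pderiv_cmx k (omega l) x + omega k x *m omega l x
     - \sum_m (conn_mx k x l m)%:C *: omega m x) *m u x) = _).
  by apply: eq_bigr => k _; apply: eq_bigr => l _; congr (_ *: _); exact: E.
have split3 (G : 'I_n -> 'I_n -> C) (h1 h2 h3 : 'I_n -> 'I_n -> 'cV[C]_N) :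
    \sum_k \sum_l G k l *: (h1 k l + h2 k l + h3 k l) =
    \sum_k \sum_l G k l *: h1 k l + \sum_k \sum_l G k l *: h2 k l
    + \sum_k \sum_l G k l *: h3 k l.
  rewrite -!big_split; apply: eq_bigr => k _ /=; rewrite -!big_split.
  by apply: eq_bigr => l _ /=; rewrite !scalerDr.
rewrite split3; congr (_ + _ + _); last first.
  rewrite mulmx_suml; apply: eq_bigr => k _; rewrite mulmx_suml; apply: eq_bigr => l _.
  by rewrite scalemxAl.
have splitB (G : 'I_n -> 'I_n -> C) (h1 h2 h3 : 'I_n -> 'I_n -> 'cV[C]_N) :
    \sum_k \sum_l G k l *: (h1 k l + h2 k l - h3 k l) =
    \sum_k \sum_l G k l *: h1 k l + \sum_k \sum_l G k l *: h2 k l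
    - \sum_k \sum_l G k l *: h3 k l.
  rewrite -!big_split -sumrB; apply: eq_bigr => k _ /=; rewrite -!big_split -sumrB.
  by apply: eq_bigr => l _ /=; rewrite scalerBr scalerDr.
rewrite splitB [X in _ + X - _]exchange_big.
have -> : \sum_l \sum_k (ginv g x k l)%:C *: (omega k x *m pderiv_cmx l u x) =
    \sum_k \sum_l (ginv g x k l)%:C *: (omega l x *m pderiv_cmx k u x).
  by apply: eq_bigr => k _; apply: eq_bigr => l _; rewrite -[in LHS](ginv_sym g_sym Ox) mxE.
rewrite -mulr2n -scaler_nat.
have -> : \sum_k \sum_l (ginv g x k l)%:C *: (\sum_m (conn_mx k x l m)%:C *: pderiv_cmx m u x) =
    \sum_m (\sum_k \sum_l ginv g x k l * christoffel g m k l x)%:C *: pderiv_cmx m u x.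
  transitivity (\sum_k \sum_m (\sum_l ginv g x k l * christoffel g m k l x)%:C *: pderiv_cmx m u x).
    apply: eq_bigr => k _; under eq_bigr do rewrite scaler_sumr.
    rewrite exchange_big; apply: eq_bigr => m _ /=.
    rewrite rmorph_sum scaler_suml; apply: eq_bigr => l _.
    by rewrite scalerA -rmorphM conn_mxE.
  by rewrite exchange_big; apply: eq_bigr => m _ /=; rewrite rmorph_sum scaler_suml.
rewrite scaler_sumr -sumrB; apply: eq_bigr => i _.
rewrite /rough_first_order mulmxBl mul_scalar_mx -scalemxAl mulmx_suml.
by congr (_ *: _ - _); apply: eq_bigr => j _; rewrite scalemxAl.
Qed.

Lemma rough_laplacian_eq omega omega' (u : pt -> 'cV[C]_N) x :
  (forall k y, O y -> omega k y = omega' k y) -> O x ->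
  rough_laplacian g omega u x = rough_laplacian g omega' u x.
Proof.
move=> oo Ox; have nab_eq X v y : O y -> nabla omega X v y = nabla omega' X v y.
  by move=> Oy; apply: eq_bigr => k _; rewrite oo.
have nab_eq2 k v w : (forall y, O y -> v y = w y) ->
    nabla omega (dvec k) v x = nabla omega' (dvec k) w x.
  move=> vw; apply: eq_bigr => m _.
  by rewrite oo// (pderiv_cmx_eq oO m vw Ox) (vw x Ox).
apply: eq_bigr => k _; apply: eq_bigr => l _.
exact: (congr2 (fun a b => _ *: (a - b)) (nab_eq2 k _ _ (nab_eq (dvec l) u)) (nab_eq _ u x Ox)).
Qed.

Lemma rough_first_order_smooth omega i : (forall k, smooth_cmx O (omega k)) ->
  smooth_cmx O (rough_first_order omega i).
Proof.
move=> so; have sg a b := ginv_smooth oO g_smooth g_pos a b.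
apply: (smooth_cmxB oO).
  apply: (smooth_cmxZ oO); first exact: smooth_cpx_cst.
  apply: (smooth_cmx_sum oO) => j; apply: (smooth_cmxZ oO); last exact: so.
  exact: (smooth_cpx_real (sg i j)).
apply: smooth_scalar; apply: smooth_sum => // k _; apply: smooth_sum => // l _.
by apply: smoothM => //; exact: christoffel_smooth.
Qed.

Lemma rough_zeroth_order_smooth omega : (forall k, smooth_cmx O (omega k)) ->
  smooth_cmx O (rough_zeroth_order omega).
Proof.
move=> so; have sg a b := smooth_cpx_real (ginv_smooth oO g_smooth g_pos a b).
apply: (smooth_cmx_sum oO) => k; apply: (smooth_cmx_sum oO) => l.
apply: (smooth_cmxZ oO); first exact: sg.
apply: (smooth_cmxB oO).
  apply: (smooth_cmxD oO); first exact: (smooth_cmx_pderiv oO).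
  exact: (smooth_cmxM oO).
apply: (smooth_cmx_sum oO) => m; apply: (smooth_cmxZ oO); last exact: so.
by apply: smooth_cpx_real; exact: (conn_mx_smooth oO g_smooth g_pos).
Qed.

Lemma twist_potential_smooth F : smooth_cmx O F -> smooth_cmx O (twist_potential F).
Proof.
move=> sF; have sg a b := smooth_cpx_real (ginv_smooth oO g_smooth g_pos a b).
have sFc k : smooth_cmx O (fun y => F y *m cliff (g y) (delta_mx 0 k)).
  have s0 : smooth_mx O (fun=> delta_mx 0 k : 'rV[R]_n) by exact: smooth_mx_cst.
  exact: (smooth_cmxM oO sF (cliff_smooth s0)).
apply: (smooth_cmxB oO); (apply: (smooth_cmxZ oO); first exact: smooth_cpx_cst).
  apply: (smooth_cmx_sum oO) => k; apply: (smooth_cmx_sum oO) => l.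
  by apply: (smooth_cmxZ oO) (sg k l) _; exact: (smooth_cmxM oO).
apply: (smooth_cmx_sum oO) => k; apply: (smooth_cmxM oO).
  exact: (endo_nabla_smooth oO g_smooth g_pos).
exact: (cliff_up_smooth oO g_smooth g_pos).
Qed.

Lemma weitzenboeck_smooth : smooth_cmx O (weitzenboeck g).
Proof.
rewrite weitzenboeck.unlock; apply: (smooth_cmxZ oO); first exact: smooth_cpx_cst.
have sc k := cliff_up_smooth oO g_smooth g_pos k.
apply: (smooth_cmx_sum oO) => k; apply: (smooth_cmx_sum oO) => l.
apply: (smooth_cmxM oO (smooth_cmxM oO (sc k) (sc l))); apply: (smooth_deriv_op oO).
have s1 := conn_mx_smooth oO g_smooth g_pos.
rewrite curvature_mx.unlock; apply: (smooth_mxD oO).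
  by apply: (smooth_mxB oO); apply: (smooth_mx_pderiv oO).
by apply: (smooth_mxB oO); apply: (smooth_mxM oO).
Qed.

(** The first order coefficient of a rough Laplacian is twice the connection form
   with raised index, up to Christoffel symbols, which is the relation that
   defines the canonical connection. *)
Lemma canonical_connection_rough (P : (pt -> 'cV[C]_N) -> pt -> 'cV[C]_N) E omega0 :
  (forall k, smooth_cmx O (omega0 k)) -> smooth_cmx O E ->
  (forall u x, smooth_cmx O u -> O x ->
     P u x = - rough_laplacian g omega0 u x + E x *m u x) ->
  laplace_type g O P /\
  (forall omega, canonical_connection g O P omega ->
     forall k x, O x -> omega k x = omega0 k x).
Proof.
move=> so sE PE.
have lf : laplace_form g O P (rough_first_order omega0)
    (fun x => rough_zeroth_order omega0 x - E x).
  split=> [i||u x su Ox].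
  - exact: rough_first_order_smooth.
  - by apply: (smooth_cmxB oO) => //; exact: rough_zeroth_order_smooth.
  rewrite PE// rough_laplacianE// mulmxBl.
  exact: potential_sign.
split; first by exists (rough_first_order omega0), (fun x => rough_zeroth_order omega0 x - E x).
move=> omega [A [B [lAB oE]]] i x Ox; rewrite oE//.
under eq_bigr do rewrite (laplace_form_uniq lAB lf _ Ox) subrK scalerA mulrC -scalerA.
rewrite -scaler_sumr scalerA mulVf ?pnatr_eq0// scale1r.
transitivity (\sum_k ((g x *m ginv g x) i k)%:C *: omega0 k x).
  under eq_bigr do rewrite scaler_sumr.
  rewrite exchange_big; apply: eq_bigr => k _ /=.
  by rewrite mxE rmorph_sum scaler_suml; apply: eq_bigr => j _; rewrite scalerA rmorphM.
rewrite (mulgV g_pos Ox) -(sum_delta (fun k => omega0 k x) i).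
by apply: eq_bigr => k _; rewrite mxE rmorph_nat.
Qed.

Let regroup_potential (r w : 'cV[C]_N) (a b : 'M[C]_N) :
  r - b *m w + a *m w = r + (a - b) *m w.
Proof. by rewrite mulmxBl addrA addrAC. Qed.

(** The square being completed, no first order term is left beside the rough
   Laplacian. *)
Lemma dirac_twisted_canonical (P : (pt -> 'cV[C]_N) -> pt -> 'cV[C]_N) F : smooth_cmx O F ->
  (forall u x, smooth_cmx O u -> O x -> P u x = D (D u) x + F x *m D u x) ->
  laplace_type g O P /\
  forall omega, canonical_connection g O P omega ->
    forall u x, smooth_cmx O u -> O x ->
    P u x = - rough_laplacian g omega u x - weitzenboeck g x *m u x
            + twist_potential F x *m u x.
Proof.
move=> sF PE.
have so k : smooth_cmx O (fun y => L k y + twist_form F k y).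
  apply: (smooth_cmxD oO); last exact: twist_form_smooth.
  exact: (conn_form_smooth oO g_smooth g_pos).
have sE : smooth_cmx O (fun x => twist_potential F x - weitzenboeck g x).
  apply: (smooth_cmxB oO); first exact: twist_potential_smooth.
  exact: weitzenboeck_smooth.
have PE' u x : smooth_cmx O u -> O x -> P u x =
    - rough_laplacian g (fun k y => L k y + twist_form F k y) u x
    + (twist_potential F x - weitzenboeck g x) *m u x.
  move=> su Ox; rewrite PE// dirac_twisted//; exact: regroup_potential.
have [lt cc] := canonical_connection_rough so sE PE'.
split=> // omega /cc oE u x su Ox.
by rewrite (rough_laplacian_eq u oE Ox) PE// dirac_twisted.
Qed.

End DiracSquare.
(** * Curvature in an orthonormal frame *)

Section CurvatureAlgebra.
Context {R : realType} {n N : nat}.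
Notation C := R[i].
Implicit Types (i j k l p q : 'I_n).

(** Add up the Bianchi identities for the four choices of the fixed index. *)
Lemma curvature_pair_sym (r : 'I_n -> 'I_n -> 'I_n -> 'I_n -> R) :
  (forall i j k l, r j i k l = - r i j k l) ->
  (forall i j k l, r i j l k = - r i j k l) ->
  (forall i j k l, r i j k l + r j k i l + r k i j l = 0) ->
  forall i j k l, r i j k l = r k l i j.
Proof.
move=> s12 s34 b i j k l.
have b1 := b i j k l; have b2 := b j k l i; have b3 := b k l i j; have b4 := b l i j k.
have e1 := s34 j k i l; have e2 := s34 k l i j; have e3 := s12 j l k i.
have e4 := s34 j l i k; have e5 := s34 l i j k; have e6 := s12 k i l j.
have e7 := s34 k i j l; have e8 := s34 i j k l.
by clear -b1 b2 b3 b4 e1 e2 e3 e4 e5 e6 e7 e8; lra.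
Qed.

Lemma sum_cyclic (V : nmodType) (f : 'I_n -> 'I_n -> 'I_n -> V) :
  \sum_i \sum_j \sum_p f i j p = \sum_i \sum_j \sum_p f j p i.
Proof.
rewrite [RHS]exchange_big; apply: eq_bigr => i _ /=.
by rewrite exchange_big.
Qed.

Variable c : 'I_n -> 'M[C]_N.
Hypothesis cc : forall i j, c i *m c j + c j *m c i = (- (2 * (i == j)%:R))%:M.

Let swap i j : c j *m c i = - (2 * (i == j)%:R) *: 1%:M - c i *m c j.
Proof. by rewrite scalemx1 -cc addrAC subrr add0r. Qed.

Let combine (a b d : C) (T X Y : 'M[C]_N) : a + b + d = 0 ->
  a *: T + b *: (T + X) + d *: (T + Y) = b *: X + d *: Y.
Proof.
move=> abd; apply/matrixP => i j; rewrite !mxE.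
move: (T i j) (X i j) (Y i j) => t x y.
have -> : a * t + b * (t + x) + d * (t + y) = (a + b + d) * t + (b * x + d * y) by ring.
by rewrite abd mul0r add0r.
Qed.

(** Permuting the generators cyclically costs only terms with a contraction; the
   sum over the cyclic permutations vanishes by the Bianchi identity. *)
Lemma clifford_cubic (r : 'I_n -> 'I_n -> 'I_n -> C) :
  (forall i j p, r j i p = - r i j p) ->
  (forall i j p, r i j p + r j p i + r p i j = 0) ->
  \sum_i \sum_j \sum_p r i j p *: (c i *m c j *m c p) =
  - 2 *: \sum_i \sum_j r i j j *: c i.
Proof.
move=> skew bian.
have T1 i j p : c j *m c p *m c i = c i *m c j *m c p
    + ((2 * (i == j)%:R) *: c p - (2 * (i == p)%:R) *: c j).
  rewrite -mulmxA (swap i p) mulmxBr -scalemxAr mulmx1 mulmxA (swap i j) mulmxBl.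
  rewrite -scalemxAl mul1mx opprB !scaleNr opprK.
  by rewrite addrC -addrA.
have T2 i j p : c p *m c i *m c j = c i *m c j *m c p
    + ((2 * (j == p)%:R) *: c i - (2 * (i == p)%:R) *: c j).
  rewrite (swap i p) mulmxBl -scalemxAl mul1mx -(mulmxA (c i) (c p)) (swap j p) mulmxBr -scalemxAr mulmx1.
  by rewrite opprB !scaleNr opprK mulmxA addrC -addrA.
set S := (X in X = _).
have E1 : S = \sum_i \sum_j \sum_p r j p i *: (c j *m c p *m c i).
  exact: (sum_cyclic (fun i j p => r i j p *: (c i *m c j *m c p))).
have E2 : S = \sum_i \sum_j \sum_p r p i j *: (c p *m c i *m c j).
  by rewrite E1 (sum_cyclic (fun i j p => r j p i *: (c j *m c p *m c i))).
have E3 : 3 *: S = \sum_i \sum_j \sum_p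
   (r j p i *: ((2 * (i == j)%:R) *: c p - (2 * (i == p)%:R) *: c j)
    + r p i j *: ((2 * (j == p)%:R) *: c i - (2 * (i == p)%:R) *: c j)).
  rewrite (_ : 3 *: S = S + S + S); last first.
    by rewrite scaler_nat !mulrSr mulr0n add0r.
  rewrite {1}/S {1}E1 E2 -!big_split; apply: eq_bigr => i _ /=.
  rewrite -!big_split; apply: eq_bigr => j _ /=.
  rewrite -!big_split; apply: eq_bigr => p _ /=.
  rewrite (T1 i j p) (T2 i j p); exact: (combine _ _ _ (bian i j p)).
have d1 (h : 'I_n -> 'I_n -> 'I_n -> C) (v : 'I_n -> 'M[C]_N) :
    \sum_i \sum_j \sum_p h i j p *: ((2 * (i == j)%:R) *: v p) =
    \sum_i \sum_p (2 * h i i p) *: v p.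
  apply: eq_bigr => i _; rewrite exchange_big; apply: eq_bigr => p _ /=.
  rewrite -(sum_delta (fun j => (2 * h i j p) *: v p) i); apply: eq_bigr => j _.
  by rewrite !scalerA; congr (_ *: _); ring.
have d2 (h : 'I_n -> 'I_n -> 'I_n -> C) (v : 'I_n -> 'M[C]_N) :
    \sum_i \sum_j \sum_p h i j p *: ((2 * (i == p)%:R) *: v j) =
    \sum_i \sum_j (2 * h i j i) *: v j.
  apply: eq_bigr => i _; apply: eq_bigr => j _.
  rewrite -(sum_delta (fun p => (2 * h i j p) *: v j) i); apply: eq_bigr => p _.
  by rewrite !scalerA; congr (_ *: _); ring.
have d3 (h : 'I_n -> 'I_n -> 'I_n -> C) (v : 'I_n -> 'M[C]_N) :
    \sum_i \sum_j \sum_p h i j p *: ((2 * (j == p)%:R) *: v i) =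
    \sum_i \sum_j (2 * h i j j) *: v i.
  apply: eq_bigr => i _; apply: eq_bigr => j _.
  rewrite -(sum_delta (fun p => (2 * h i j p) *: v i) j); apply: eq_bigr => p _.
  by rewrite !scalerA; congr (_ *: _); ring.
have three : 3 != 0 :> C by rewrite pnatr_eq0.
apply: (scalerI three); rewrite E3.
have E4 : \sum_i \sum_j \sum_p
   (r j p i *: ((2 * (i == j)%:R) *: c p - (2 * (i == p)%:R) *: c j)
    + r p i j *: ((2 * (j == p)%:R) *: c i - (2 * (i == p)%:R) *: c j)) =
   \sum_i \sum_p (2 * r i p i) *: c p - \sum_i \sum_j (2 * r j i i) *: c j
   + (\sum_i \sum_j (2 * r j i j) *: c i - \sum_i \sum_j (2 * r i i j) *: c j).
  rewrite -(d1 (fun i j p => r j p i)) -(d2 (fun i j p => r j p i)).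
  rewrite -(d3 (fun i j p => r p i j)) -(d2 (fun i j p => r p i j)).
  rewrite -!sumrB -big_split; apply: eq_bigr => i _ /=.
  rewrite -!sumrB -big_split; apply: eq_bigr => j _ /=.
  rewrite -!sumrB -big_split; apply: eq_bigr => p _ /=.
  by rewrite !scalerBr.
rewrite E4; set Q := \sum_i \sum_j r i j j *: c i.
have r0 i j : r i i j = 0.
  have := skew i i j; move=> /eqP; rewrite -addr_eq0 -mulr2n -mulr_natl mulf_eq0 pnatr_eq0 /=.
  by move=> /eqP.
have -> : \sum_i \sum_j (2 * r i i j) *: c j = 0.
  by rewrite big1 // => i _; rewrite big1 // => j _; rewrite r0 mulr0 scale0r.
have Q1 : \sum_i \sum_j (2 * r j i i) *: c j = 2 *: Q.
  rewrite exchange_big scaler_sumr; apply: eq_bigr => i _ /=; rewrite scaler_sumr.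
  by apply: eq_bigr => j _; rewrite scalerA.
have Q2 : \sum_i \sum_j (2 * r j i j) *: c i = - 2 *: Q.
  rewrite scaleNr scaler_sumr -sumrN; apply: eq_bigr => i _; rewrite scaler_sumr -sumrN.
  by apply: eq_bigr => j _; rewrite skew scalerA mulrN scaleNr.
have Q3 : \sum_i \sum_p (2 * r i p i) *: c p = - 2 *: Q by rewrite exchange_big.
rewrite Q1 Q2 Q3 subr0 -scalerBl -scalerDl scalerA; congr (_ *: _); ring.
Qed.

(** After the cubic contraction only the Ricci tensor is left; as it is symmetric,
   its contraction with two generators is its trace. *)
Lemma clifford_curvature_trace (r : 'I_n -> 'I_n -> 'I_n -> 'I_n -> R) :
  (forall i j k l, r j i k l = - r i j k l) ->
  (forall i j k l, r i j l k = - r i j k l) ->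
  (forall i j k l, r i j k l + r j k i l + r k i j l = 0) ->
  \sum_i \sum_j \sum_p \sum_q (r i j p q)%:C *: (c i *m c j *m c p *m c q) =
  (2 * \sum_i \sum_j r i j j i)%:C%:M.
Proof.
move=> s12 s34 b; have ps := curvature_pair_sym s12 s34 b.
pose ric i q : C := \sum_j (r i j j q)%:C.
have ricC i q : ric i q = ric q i.
  by apply: eq_bigr => j _; rewrite ps s12 s34 opprK.
transitivity (\sum_q (\sum_i \sum_j \sum_p (r i j p q)%:C *: (c i *m c j *m c p)) *m c q).
  under [RHS]eq_bigr do rewrite mulmx_suml.
  rewrite [RHS]exchange_big; apply: eq_bigr => i _ /=.
  under [RHS]eq_bigr do rewrite mulmx_suml.
  rewrite [RHS]exchange_big; apply: eq_bigr => j _ /=.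
  under [RHS]eq_bigr do rewrite mulmx_suml.
  rewrite [RHS]exchange_big; apply: eq_bigr => p _ /=.
  by apply: eq_bigr => q _; rewrite scalemxAl.
have E q : \sum_i \sum_j \sum_p (r i j p q)%:C *: (c i *m c j *m c p) =
    - 2 *: \sum_i ric i q *: c i.
  rewrite clifford_cubic => [|i j p|i j p]; first last.
  - by rewrite -!rmorphD b.
  - by rewrite s12 rmorphN.
  by congr (_ *: _); apply: eq_bigr => i _; rewrite scaler_suml.
under eq_bigr do rewrite E -scalemxAl mulmx_suml.
rewrite -scaler_sumr.
have sym : 2 *: (\sum_q \sum_i ric i q *: c i *m c q) = - 2 *: (\sum_q ric q q)%:M.
  rewrite scaler_nat mulr2n {1}exchange_big -big_split /= [(\sum_q _)%:M]raddf_sum scaler_sumr.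
  apply: eq_bigr => q _; rewrite -big_split /=.
  rewrite -[RHS](sum_delta (fun i => - 2 *: (ric i q)%:M) q); apply: eq_bigr => i _.
  rewrite (ricC q i) -!scalemxAl -scalerDr cc !scale_scalar_mx.
  by congr (_%:M); ring.
rewrite scaleNr sym scaleNr opprK scale_scalar_mx; congr (_%:M).
rewrite rmorphM rmorph_nat rmorph_sum; congr (_ * _); apply: eq_bigr => q _.
by rewrite rmorph_sum.
Qed.

End CurvatureAlgebra.

Section Frames.
Context {R : realType} {n : nat}.
Notation pt := 'rV[R]_n.
Notation C := R[i].
Notation N := (dimL n).
Variable G : 'M[R]_n.
Hypothesis G_sym : G^T = G.
Hypothesis G_unit : G \in unitmx.
Variable E : 'I_n -> 'rV[R]_n.
Hypothesis E_orth : forall i j, (E i *m G *m (E j)^T) 0 0 = (i == j)%:R.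
Implicit Types (i j k l p q : 'I_n).

Let Em : 'M[R]_n := \matrix_i E i.

Lemma frame_invmx : Em^T *m Em = invmx G.
Proof.
have EGE : Em *m G *m Em^T = 1%:M.
  apply/matrixP => i j; rewrite [RHS]mxE -E_orth.
  have rE k : E k = row k Em by rewrite rowK.
  rewrite !rE -row_mul tr_row [LHS]mxE [RHS]mxE; apply: eq_bigr => k _.
  by rewrite [row _ _ _ _]mxE [col _ _ _ _]mxE.
have /(congr1 (mulmx^~ (invmx G))) := mulmx1C EGE.
by rewrite mulmxA mulmxK // mul1mx.
Qed.

Lemma frame_coord k l : \sum_q E q 0 k * E q 0 l = invmx G k l.
Proof. by rewrite -frame_invmx mxE; apply: eq_bigr => q _; rewrite !mxE. Qed.

Lemma frame_row k : \sum_q E q 0 k *: E q = row k (invmx G).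
Proof.
by apply/rowP => l; rewrite mxE -frame_coord summxE; apply: eq_bigr => q _; rewrite mxE.
Qed.

(** The sum of the squares of an orthonormal frame is the inverse metric. *)
Lemma frame_contract (V : lmodType C) (B : 'I_n -> 'I_n -> V) :
  \sum_q \sum_k \sum_l (E q 0 k * E q 0 l)%:C *: B k l =
  \sum_k \sum_l (invmx G k l)%:C *: B k l.
Proof.
rewrite exchange_big; apply: eq_bigr => k _; rewrite exchange_big; apply: eq_bigr => l _ /=.
by rewrite -frame_coord rmorph_sum scaler_suml.
Qed.

Notation c i := (cliff G (E i)).
Notation ch i := (cliffh G (E i)).

Lemma frame_cliff i j : c i *m c j + c j *m c i = (- (2 * (i == j)%:R))%:M.
Proof.
by rewrite (cliff_anticomm G_sym) E_orth rmorphN rmorphM !rmorph_nat.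
Qed.

Lemma deriv_op_bilinear (t : nat) (s : 'M[R]_t) (P S : 'M[R]_(t, n)) :
  \sum_a \sum_b (s a b)%:C *: (extv (row a P) *m contr (row b S)) = deriv_op (P^T *m s *m S).
Proof.
rewrite /deriv_op.
transitivity (\sum_a \sum_b \sum_j \sum_m (P a j * s a b * S b m)%:C *: (extm j *m intm m) : 'M[C]_N).
  apply: eq_bigr => a _; apply: eq_bigr => b _; rewrite mulmx_suml scaler_sumr.
  apply: eq_bigr => j _; rewrite mulmx_sumr scaler_sumr; apply: eq_bigr => m _.
  rewrite -scalemxAl -scalemxAr !scalerA !mxE !rmorphM; congr (_ *: _).
  by rewrite [(s a b)%:C * _]mulrC.
rewrite exchange_big.
under eq_bigr do rewrite exchange_big.
rewrite exchange_big; apply: eq_bigr => j _ /=.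
under eq_bigr do rewrite exchange_big.
rewrite exchange_big; apply: eq_bigr => m _ /=.
rewrite mxE rmorph_sum scaler_suml; apply: eq_bigr => b _ /=.
rewrite mxE mulr_suml rmorph_sum scaler_suml; apply: eq_bigr => a _ /=.
by rewrite !mxE.
Qed.

Lemma deriv_op_frame (A : 'M[R]_n) : deriv_op A =
  \sum_p \sum_q ((E p *m A *m G *m (E q)^T) 0 0)%:C *: (wedge G (E p) *m contr (E q)).
Proof.
have EA : A = (Em *m G)^T *m (Em *m A *m G *m Em^T) *m Em.
  rewrite trmx_mul G_sym !mulmxA -[G *m Em^T *m Em]mulmxA frame_invmx mulmxV// mul1mx.
  by rewrite -[_ *m Em^T *m Em]mulmxA frame_invmx mulmxK.
apply: etrans (congr1 deriv_op EA) _.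
rewrite -deriv_op_bilinear; apply: eq_bigr => p _; apply: eq_bigr => q _.
rewrite wedgeE row_mul !rowK; congr (_%:C *: _).
have rE k : E k = row k Em by rewrite rowK.
rewrite !rE -!row_mul [RHS]mxE [LHS]mxE [RHS]mxE; apply: eq_bigr => k _.
by congr (_ * _); rewrite !mxE.
Qed.

Let skew_sum (V : lmodType C) (r : 'I_n -> 'I_n -> C) (z : 'I_n -> 'I_n -> V) :
  (forall p q, r q p = - r p q) -> (forall p q, z q p = z p q) ->
  \sum_p \sum_q r p q *: z p q = 0.
Proof.
move=> rC zC; have two : 2 != 0 :> C by rewrite pnatr_eq0.
apply: (scalerI two); rewrite scaler0 scaler_nat mulr2n {1}exchange_big -big_split big1 // => p _.
by rewrite -big_split big1 // => q _ /=; rewrite rC zC scaleNr addNr.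
Qed.

Let expand_products (w i1 w' i2 : 'M[C]_N) :
  4 *: (w *m i2) = ((w + i1) *m (w' + i2) - (w - i1) *m (w' - i2))
    - ((w + i1) *m (w' - i2) - (w - i1) *m (w' + i2)).
Proof.
rewrite !(mulmxDl, mulmxDr, mulNmx, mulmxN).
move: (w *m i2) (w *m w') (i1 *m w') (i1 *m i2) => a b d e.
by apply/matrixP => i j; rewrite !mxE; ring.
Qed.

(** For a skew curvature matrix the mixed products cancel in pairs. *)
Lemma deriv_op_frame_skew (A : 'M[R]_n) : (A *m G)^T = - (A *m G) ->
  deriv_op A = 4^-1 *: \sum_p \sum_q ((E p *m A *m G *m (E q)^T) 0 0)%:C *:
    (ch p *m ch q - c p *m c q).
Proof.
move=> AG; set r := fun p q => (E p *m A *m G *m (E q)^T) 0 0.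
have rC p q : r q p = - r p q.
  transitivity ((E q *m A *m G *m (E p)^T)^T 0 0); first by rewrite [RHS]mxE.
  rewrite -[E q *m A *m G]mulmxA trmx_mul trmxK [(E q *m _)^T]trmx_mul AG mulmxA mulmxN mulNmx.
  by rewrite /r !mulmxA mxE.
have four : 4 != 0 :> C by rewrite pnatr_eq0.
apply: (scalerI four); rewrite scalerA mulfV// scale1r deriv_op_frame.
have W p q : 4 *: (wedge G (E p) *m contr (E q)) =
    (ch p *m ch q - c p *m c q) - (ch p *m c q + ch q *m c p).
  have -> : ch q *m c p = - (c p *m ch q).
    by apply/eqP; rewrite -addr_eq0 addrC (cliff_cliffh_anticomm G_sym).
  exact: expand_products.
apply: etrans (_ : \sum_p \sum_q (r p q)%:C *: (ch p *m ch q - c p *m c q)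
   - \sum_p \sum_q (r p q)%:C *: (ch p *m c q + ch q *m c p) = _).
  rewrite scaler_sumr -sumrB; apply: eq_bigr => p _; rewrite scaler_sumr -sumrB.
  by apply: eq_bigr => q _; rewrite -scalerBr -W !scalerA mulrC.
rewrite [X in _ - X]skew_sum ?subr0// => p q; first by rewrite rC rmorphN.
exact: addrC.
Qed.

End Frames.

Lemma exchange_big3 (V : nmodType) (I J K : finType) (f : I -> J -> K -> V) :
  \sum_i \sum_j \sum_k f i j k = \sum_k \sum_i \sum_j f i j k.
Proof. by under eq_bigr do rewrite exchange_big; rewrite exchange_big. Qed.

Lemma exchange_big4 (V : nmodType) (I J K L : finType) (f : I -> J -> K -> L -> V) :
  \sum_i \sum_j \sum_k \sum_l f i j k l = \sum_k \sum_l \sum_i \sum_j f i j k l.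
Proof.
apply: etrans (exchange_big3 (fun i j k => \sum_l f i j k l)) _.
by apply: eq_bigr => k _; exact: exchange_big3.
Qed.

Section CurvatureInFrame.
Context {R : realType} {n : nat}.
Notation pt := 'rV[R]_n.
Notation C := R[i].
Notation N := (dimL n).
Variable O : set pt.
Hypothesis oO : open O.
Variable g : pt -> 'M[R]_n.
Hypothesis g_smooth : smooth_mx O g.
Hypothesis g_sym : forall x, O x -> (g x)^T = g x.
Hypothesis g_pos : forall x, O x -> pos_def (g x).
Variable e : 'I_n -> pt -> pt.
Hypothesis e_frame : orthonormal_frame g O e.
Implicit Types (i j k l p q : 'I_n) (x : pt).
Notation curv_mx := (curvature_mx g).

Let e_orth x (Ox : O x) i j : (e i x *m g x *m (e j x)^T) 0 0 = (i == j)%:R.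
Proof. by have [_ /(_ i j x Ox)] := e_frame. Qed.

Definition frame_curv_mx x i j : 'M[R]_n :=
  \sum_k \sum_l (e i x 0 k * e j x 0 l) *: curv_mx k l x.
Notation Rf := frame_curv_mx.

Lemma frame_cliff_up k x : O x ->
  \sum_q (e q x 0 k)%:C *: cliff (g x) (e q x) = cliff_up g k x.
Proof.
move=> Ox; rewrite (cliff_up_cliff g_pos)// /ginv -(frame_row (g_unit g_pos Ox) (e_orth Ox)).
by rewrite cliff_lincomb.
Qed.

Lemma riemE i j p q x : O x ->
  riem g e i j p q x = (e p x *m Rf x i j *m g x *m (e q x)^T) 0 0.
Proof.
move=> Ox; rewrite /riem /gip (curvE oO g_smooth g_pos)//;
  try by have [] := e_frame.
congr ((_ *m _ *m _) _ _).
rewrite mulmx_sumr; apply: eq_bigr => k _; rewrite mulmx_sumr; apply: eq_bigr => l _.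
by rewrite scalemxAr.
Qed.

Lemma frame_curv_mx_skew x i j : O x -> (Rf x i j *m g x)^T = - (Rf x i j *m g x).
Proof.
move=> Ox; rewrite !mulmx_suml linear_sum -sumrN; apply: eq_bigr => k _ /=.
rewrite !mulmx_suml linear_sum -sumrN; apply: eq_bigr => l _ /=.
by rewrite -!scalemxAl linearZ /= (curv_mx_skew oO g_smooth g_sym g_pos)// scalerN.
Qed.

Lemma frame_curv_mx_anti x i j : Rf x j i = - Rf x i j.
Proof.
rewrite /Rf exchange_big -sumrN; apply: eq_bigr => k _ /=.
by rewrite -sumrN; apply: eq_bigr => l _; rewrite mulrC curv_mx_anti scalerN.
Qed.

Lemma riem_skew12 i j p q x : O x -> riem g e j i p q x = - riem g e i j p q x.
Proof.
by move=> Ox; rewrite !riemE// frame_curv_mx_anti mulmxN !mulNmx mxE.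
Qed.

Lemma riem_skew34 i j p q x : O x -> riem g e i j q p x = - riem g e i j p q x.
Proof.
move=> Ox; rewrite !riemE//.
transitivity ((e q x *m (Rf x i j *m g x) *m (e p x)^T)^T 0 0).
  by rewrite [RHS]mxE !mulmxA.
rewrite trmx_mul trmxK [(_ *m (_ *m _))^T]trmx_mul frame_curv_mx_skew//.
by rewrite mulNmx mulmxN !mulmxA mxE.
Qed.

Lemma riem_bianchi i j p q x : O x ->
  riem g e i j p q x + riem g e j p i q x + riem g e p i j q x = 0.
Proof.
move=> Ox; rewrite !riemE//.
pose T k l s := \sum_m curv_mx k l x s m * (g x *m (e q x)^T) m 0.
have TB k l s : T k l s + T l s k + T s k l = 0.
  rewrite -!big_split big1 // => m _ /=.
  by rewrite -!mulrDl (bianchi oO g_sym)// mul0r.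
have E a b d : (e d x *m Rf x a b *m g x *m (e q x)^T) 0 0 =
    \sum_k \sum_l \sum_s e a x 0 k * e b x 0 l * e d x 0 s * T k l s.
  rewrite -[_ *m g x *m _]mulmxA mulmx_sumr mulmx_suml summxE; apply: eq_bigr => k _.
  rewrite mulmx_sumr mulmx_suml summxE; apply: eq_bigr => l _.
  rewrite -scalemxAr -scalemxAl mxE -mulmxA mxE mulr_sumr; apply: eq_bigr => s _.
  by rewrite [LHS]mulrA; congr (_ * _); rewrite mxE.
rewrite !E (sum_cyclic (fun k l s => e j x 0 k * e p x 0 l * e i x 0 s * T k l s)).
rewrite (sum_cyclic (fun k l s => e p x 0 k * e i x 0 l * e j x 0 s * T k l s)).
rewrite (sum_cyclic (fun k l s => e p x 0 l * e i x 0 s * e j x 0 k * T l s k)).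
rewrite -!big_split big1 // => k _; rewrite -!big_split big1 // => l _.
rewrite -!big_split big1 // => s _ /=.
apply: etrans (_ : e i x 0 k * e j x 0 l * e p x 0 s * (T k l s + T l s k + T s k l) = _).
  by ring.
by rewrite TB mulr0.
Qed.

Lemma curv_dvec i j k m x : O x ->
  curv g (dvec i) (dvec j) (dvec k) x 0 m = curv_mx i j x k m.
Proof.
move=> Ox; rewrite (curvE oO g_smooth g_pos) //; try exact: smooth_mx_cst.
rewrite (bigD1 i)//= [X in _ + X]big1 => [|a ai]; last first.
  by rewrite big1 // => b _; rewrite /dvec !mxE (negbTE ai) andbF mul0r scale0r.
rewrite (bigD1 j)//= [X in _ + X + _]big1 => [|b bj]; last first.
  by rewrite /dvec !mxE (negbTE bj) andbF mulr0 scale0r.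
by rewrite !addr0 /dvec -rowE !mxE !eqxx mulr1 mul1r.
Qed.

Lemma scal_frame x : O x -> scal g x = \sum_i \sum_j riem g e i j j i x.
Proof.
move=> Ox; have gu := g_unit g_pos Ox.
have fc := frame_coord gu (e_orth Ox).
transitivity (\sum_k \sum_l \sum_a \sum_b (k == b)%:R * ginv g x l a * curv_mx k l x a b).
  rewrite [RHS]exchange_big; apply: eq_bigr => l _; rewrite [RHS]exchange_big.
  apply: eq_bigr => a _; rewrite mulr_sumr; apply: eq_bigr => k _ /=.
  rewrite (bigD1 k)//= big1 => [|b bk]; last by rewrite eq_sym (negbTE bk) !mul0r.
  by rewrite eqxx mul1r addr0 curv_dvec.
have del k b : (k == b)%:R = \sum_p e p x 0 k * (g x *m (e p x)^T) b 0.
  transitivity ((ginv g x *m g x) k b); first by rewrite (mulVg g_pos)// mxE.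
  rewrite mxE; transitivity (\sum_s \sum_p e p x 0 k * e p x 0 s * g x s b).
    by apply: eq_bigr => s _; rewrite -mulr_suml fc.
  rewrite exchange_big; apply: eq_bigr => p _ /=; rewrite mxE mulr_sumr.
  apply: eq_bigr => s _; rewrite mxE -mulrA [e p x 0 s * _]mulrC.
  by rewrite -[in LHS](g_sym Ox) mxE.
transitivity (\sum_k \sum_l \sum_a \sum_b \sum_p \sum_q
    e p x 0 k * e q x 0 l * (e q x 0 a * (curv_mx k l x a b * (g x *m (e p x)^T) b 0))).
  apply: eq_bigr => k _; apply: eq_bigr => l _; apply: eq_bigr => a _; apply: eq_bigr => b _.
  rewrite del -fc mulr_suml mulr_suml; apply: eq_bigr => p _.
  rewrite mulr_sumr mulr_suml; apply: eq_bigr => q _; ring.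
under eq_bigr do under eq_bigr do rewrite exchange_big4.
rewrite exchange_big4; apply: eq_bigr => p _; apply: eq_bigr => q _.
rewrite riemE// -[_ *m g x *m _]mulmxA mulmx_sumr mulmx_suml summxE.
apply: eq_bigr => k _; rewrite mulmx_sumr mulmx_suml summxE; apply: eq_bigr => l _.
rewrite -scalemxAr -scalemxAl [RHS]mxE -mulmxA [X in _ = _ * X]mxE mulr_sumr.
apply: eq_bigr => a _; rewrite [X in _ = _ * (_ * X)]mxE !mulr_sumr.
by [].
Qed.

Let anticommuting_pairs (a b d f : 'M[C]_N) : a *m d = - (d *m a) ->
  a *m f = - (f *m a) -> b *m d = - (d *m b) -> b *m f = - (f *m b) ->
  a *m b *m d *m f = d *m f *m a *m b.
Proof.
move=> ad af bd bf; rewrite -(mulmxA a) bd mulmxN mulNmx (mulmxA a) ad !mulNmx opprK.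
rewrite -(mulmxA _ b) bf mulmxN (mulmxA _ f) -(mulmxA d a) af.
by rewrite mulmxN mulNmx opprK mulmxA.
Qed.

(** The curvature of forms acts by quadratic Clifford expressions of both
   kinds; the one in c alone collapses to the scalar curvature. *)
Lemma weitzenboeck_frame x : O x ->
  weitzenboeck g x = 8^-1 *: curv_term g e x - (4^-1 * scal g x)%:C%:M.
Proof.
move=> Ox; have ga := g_sym Ox; have gu := g_unit g_pos Ox.
rewrite weitzenboeck.unlock.
pose c i := cliff (g x) (e i x); pose ch i := cliffh (g x) (e i x).
have cup k : cliff_up g k x = \sum_i (e i x 0 k)%:C *: c i by rewrite -frame_cliff_up.
have QR i j : deriv_op (Rf x i j) =
    \sum_k \sum_l (e i x 0 k * e j x 0 l)%:C *: deriv_op (curv_mx k l x).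
  rewrite /Rf raddf_sum; apply: eq_bigr => k _; rewrite /= raddf_sum; apply: eq_bigr => l _.
  by rewrite /= deriv_opZ.
have -> : \sum_k \sum_l cliff_up g k x *m cliff_up g l x *m deriv_op (curv_mx k l x) =
    \sum_i \sum_j c i *m c j *m deriv_op (Rf x i j).
  transitivity (\sum_i \sum_j \sum_k \sum_l (e i x 0 k * e j x 0 l)%:C *:
      (c i *m c j *m deriv_op (curv_mx k l x))).
    rewrite exchange_big4; apply: eq_bigr => k _; apply: eq_bigr => l _.
    rewrite !cup !mulmx_suml; apply: eq_bigr => i _.
    rewrite [_ *: c i *m (\sum_(_ <- _ | _) _)]mulmx_sumr mulmx_suml; apply: eq_bigr => j _.
    by rewrite -scalemxAr -scalemxAl -!scalemxAl scalerA rmorphM mulrC.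
  apply: eq_bigr => i _; apply: eq_bigr => j _; rewrite QR [RHS]mulmx_sumr.
  apply: eq_bigr => k _ /=; rewrite [RHS]mulmx_sumr; apply: eq_bigr => l _ /=.
  by rewrite scalemxAr.
have -> : \sum_i \sum_j c i *m c j *m deriv_op (Rf x i j) =
   4^-1 *: (\sum_i \sum_j \sum_p \sum_q (riem g e i j p q x)%:C *: (c i *m c j *m ch p *m ch q)
    - \sum_i \sum_j \sum_p \sum_q (riem g e i j p q x)%:C *: (c i *m c j *m c p *m c q)).
  rewrite -sumrB scaler_sumr; apply: eq_bigr => i _; rewrite -sumrB scaler_sumr.
  apply: eq_bigr => j _; rewrite (deriv_op_frame_skew ga gu (e_orth Ox)); last first.
    exact: frame_curv_mx_skew.
  rewrite -scalemxAr -sumrB; congr (_ *: _); rewrite mulmx_sumr; apply: eq_bigr => p _.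
  rewrite mulmx_sumr -sumrB; apply: eq_bigr => q _.
  by rewrite -scalemxAr mulmxBr !mulmxA scalerBr riemE.
rewrite clifford_curvature_trace; first last.
- by move=> *; exact: riem_bianchi.
- by move=> *; exact: riem_skew34.
- by move=> *; exact: riem_skew12.
- by move=> i j; exact: (frame_cliff ga (e_orth Ox)).
rewrite scal_frame//.
have -> : \sum_i \sum_j \sum_p \sum_q (riem g e i j p q x)%:C *: (c i *m c j *m ch p *m ch q) = curv_term g e x.
  rewrite exchange_big4; apply: eq_bigr => p _; apply: eq_bigr => q _.
  apply: eq_bigr => i _; apply: eq_bigr => j _; congr (_%:C *: _).
    apply: (curvature_pair_sym (r := fun i j p q => riem g e i j p q x)) => *.
    - exact: riem_skew12.
    - exact: riem_skew34.
    - exact: riem_bianchi.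
  have sw a b : c a *m ch b = - (ch b *m c a).
    by apply/eqP; rewrite -addr_eq0 (cliff_cliffh_anticomm ga).
  exact: anticommuting_pairs.
rewrite scalerA scalerBr; congr (_ *: _ - _).
  by rewrite -invfM -natrM.
rewrite scale_scalar_mx; congr (_%:M).
rewrite !rmorphM !rmorph_nat mulrA; congr (_ * _).
by rewrite fmorphV rmorph_nat; field.
Qed.

End CurvatureInFrame.

(** ** The endomorphism attached to a vector field *)

(** The value of [twist_term] in every orthonormal frame, but defined on the whole
   coordinate domain. *)
HB.lock Definition twist_endo {R : realType} {n : nat} (g : 'rV[R]_n -> 'M[R]_n)
    (V : 'rV[R]_n -> 'rV[R]_n) (x : 'rV[R]_n) : 'M[R[i]]_(dimL n) :=
  cliffh (g x) (V x) *m
    \sum_k cliffh (g x) (cov_deriv_row g k V x) *m cliff_up g k x.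

Section TwistEndo.
Context {R : realType} {n : nat}.
Notation pt := 'rV[R]_n.
Notation C := R[i].
Notation N := (dimL n).
Variable O : set pt.
Hypothesis oO : open O.
Variable g : pt -> 'M[R]_n.
Hypothesis g_smooth : smooth_mx O g.
Hypothesis g_sym : forall x, O x -> (g x)^T = g x.
Hypothesis g_pos : forall x, O x -> pos_def (g x).
Variable V : pt -> pt.
Hypothesis V_smooth : smooth_mx O V.
Implicit Types (i j k l p q : 'I_n) (x : pt).
Notation D := (dirac g).
Notation F := (twist_endo g V).

Lemma twist_endoE x : F x = cliffh (g x) (V x) *m
    \sum_k cliffh (g x) (cov_deriv_row g k V x) *m cliff_up g k x.
Proof. by rewrite twist_endo.unlock. Qed.

Lemma twist_endo_smooth : smooth_cmx O F.
Proof.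
rewrite twist_endo.unlock; apply: (smooth_cmxM oO).
  exact: (cliffh_smooth oO g_smooth).
apply: (smooth_cmx_sum oO) => k; apply: (smooth_cmxM oO); last exact: (cliff_up_smooth oO).
by apply: (cliffh_smooth oO g_smooth); exact: (cov_deriv_smooth oO g_smooth g_pos).
Qed.

(** c^(V) anticommutes with the c^k, and its derivative is c^ of the derivative
   of V. *)
Lemma dirac_cliffh (u : pt -> 'cV[C]_N) x : smooth_cmx O u -> O x ->
  D (fun y => cliffh (g y) (V y) *m u y) x =
  - (cliffh (g x) (V x) *m D u x) -
  (\sum_k cliffh (g x) (cov_deriv_row g k V x) *m cliff_up g k x) *m u x.
Proof.
move=> su Ox; rewrite !diracE mulmx_sumr mulmx_suml -!sumrN -big_split.
apply: eq_bigr => k _ /=.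
have sc := cliffh_smooth oO g_smooth V_smooth.
rewrite (form_nablaM oO g k sc su Ox) (endo_nabla_cliffh oO g_smooth g_sym g_pos k V_smooth Ox).
have sw Y : cliff_up g k x *m cliffh (g x) Y = - (cliffh (g x) Y *m cliff_up g k x).
  rewrite (cliff_up_cliff g_pos)//; apply/eqP.
  by rewrite -addr_eq0 (cliff_cliffh_anticomm (g_sym Ox)).
by rewrite mulmxDr !mulmxA !sw !mulNmx addrC.
Qed.

Lemma dirac_eq (u v : pt -> 'cV[C]_N) x : (forall y, O y -> u y = v y) -> O x ->
  D u x = D v x.
Proof.
move=> uv Ox; rewrite !diracE; apply: eq_bigr => k _.
by rewrite (form_nabla_eq oO g k uv Ox).
Qed.

Lemma diracZ (z : C) (u : pt -> 'cV[C]_N) x : smooth_cmx O u -> O x ->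
  D (fun y => z *: u y) x = z *: D u x.
Proof.
move=> su Ox; rewrite !diracE scaler_sumr; apply: eq_bigr => k _.
rewrite (form_nablaZ g k (smooth_cpx_cst O z) su Ox) pderiv_cpx_cst scale0r add0r.
by rewrite scalemxAr.
Qed.

Variable delta : (pt -> 'cV[C]_N) -> pt -> 'cV[C]_N.
Hypothesis delta_adj : formal_adjoint_d g O delta.
Hypothesis V_unit : forall x, O x -> gip g V V x = 1.

Lemma cliffh_sqr x : O x -> cliffh (g x) (V x) *m cliffh (g x) (V x) = 1%:M.
Proof.
move=> Ox; have two : 2 != 0 :> C by rewrite pnatr_eq0.
apply: (scalerI two); rewrite scaler_nat mulr2n (cliffh_anticomm (g_sym Ox)).
have := V_unit Ox; rewrite /gip => ->; rewrite mulr1 rmorph_nat.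
by rewrite scale_scalar_mx mulr1.
Qed.

Lemma DV_dirac (u : pt -> 'cV[C]_N) x : smooth_cmx O u -> O x ->
  DV g delta V u x = (0 +i* 1) *: (cliffh (g x) (V x) *m D u x).
Proof.
by move=> su Ox; rewrite /DV (dR_dirac oO g_smooth g_sym g_pos delta_adj su Ox).
Qed.

Let hDu (u : pt -> 'cV[C]_N) y := cliffh (g y) (V y) *m D u y.

Let hDu_smooth u : smooth_cmx O u -> smooth_cmx O (hDu u).
Proof.
move=> su; apply: (smooth_cmxM oO (cliffh_smooth oO g_smooth V_smooth)).
exact: (dirac_smooth oO g_smooth g_pos).
Qed.

Let i_sqr : (0 +i* 1) * (0 +i* 1) = - 1 :> C.
Proof. by apply/eqP; rewrite eq_complex /= !mul0r !mulr0 mulr1 sub0r addr0 oppr0 !eqxx. Qed.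

Lemma DV_smooth (u : pt -> 'cV[C]_N) : smooth_cmx O u -> smooth_cmx O (DV g delta V u).
Proof.
move=> su.
apply: (smooth_cmx_eq oO _ (smooth_cmxZ oO (smooth_cpx_cst O (0 +i* 1)) (hDu_smooth su))).
by move=> y Oy; rewrite DV_dirac.
Qed.

Lemma DV_DV (u : pt -> 'cV[C]_N) x : smooth_cmx O u -> O x ->
  DV g delta V (DV g delta V u) x = D (D u) x + F x *m D u x.
Proof.
move=> su Ox; rewrite (DV_dirac (DV_smooth su) Ox).
have E y : O y -> DV g delta V u y = (0 +i* 1) *: hDu u y by exact: DV_dirac.
rewrite (dirac_eq E Ox) (diracZ _ (hDu_smooth su) Ox).
rewrite dirac_cliffh//; last exact: (dirac_smooth oO g_smooth g_pos).
rewrite -scalemxAr scalerA i_sqr scaleN1r mulmxBr mulmxN opprB opprK addrC.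
by rewrite [in X in X + _]mulmxA cliffh_sqr// mul1mx twist_endoE mulmxA.
Qed.

Lemma DVstar_DV (u : pt -> 'cV[C]_N) x : smooth_cmx O u -> O x ->
  DVstar g delta V (DV g delta V u) x = D (D u) x.
Proof.
move=> su Ox; have sDu := dirac_smooth oO g_smooth g_pos su.
pose w y := cliffh (g y) (V y) *m DV g delta V u y.
have wE y : O y -> w y = (0 +i* 1) *: D u y.
  by move=> Oy; rewrite /w DV_dirac// -scalemxAr mulmxA cliffh_sqr// mul1mx.
have sw : smooth_cmx O w.
  apply: (smooth_cmxM oO (cliffh_smooth oO g_smooth V_smooth)); exact: DV_smooth.
rewrite /DVstar (dR_dirac oO g_smooth g_sym g_pos delta_adj sw Ox) (dirac_eq wE Ox).
by rewrite (diracZ _ sDu Ox) scalerA i_sqr scaleN1r opprK.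
Qed.

End TwistEndo.

Section TwistInFrame.
Context {R : realType} {n : nat}.
Notation pt := 'rV[R]_n.
Notation C := R[i].
Notation N := (dimL n).
Variable O : set pt.
Hypothesis oO : open O.
Variable g : pt -> 'M[R]_n.
Hypothesis g_sym : forall x, O x -> (g x)^T = g x.
Hypothesis g_pos : forall x, O x -> pos_def (g x).
Variable V : pt -> pt.
Variable e : 'I_n -> pt -> pt.
Hypothesis e_frame : orthonormal_frame g O e.
Implicit Types (i j k l p q : 'I_n) (x : pt).

Let e_orth x (Ox : O x) i j : (e i x *m g x *m (e j x)^T) 0 0 = (i == j)%:R.
Proof. by have [_ /(_ i j x Ox)] := e_frame. Qed.

Lemma twist_term_endo x : O x -> twist_term g V e x = twist_endo g V x.
Proof.
move=> Ox; rewrite twist_endoE /twist_term; congr (_ *m _).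
under [RHS]eq_bigr do rewrite -(frame_cliff_up g_pos e_frame)// mulmx_sumr.
rewrite exchange_big; apply: eq_bigr => q _ /=; rewrite nablaL_cov cliffh_lincomb mulmx_suml.
by apply: eq_bigr => k _; rewrite -scalemxAl scalemxAr.
Qed.

Lemma twist_potential0 x : twist_potential g (fun=> 0) x = 0.
Proof.
have n0 k : endo_nabla g k (fun=> 0) x = 0.
  by rewrite endo_nabla.unlock pderiv_cmx_cst mulmx0 mul0mx subr0 addr0.
rewrite /twist_potential big1 => [|k _]; last by rewrite big1 // => l _; rewrite !mul0mx scaler0.
by rewrite big1 => [|k _]; rewrite ?n0 ?mul0mx// !scaler0 subr0.
Qed.

Lemma twist_potential_frame (F : pt -> 'M[C]_N) x : O x ->
  (forall y, O y -> twist_term g V e y = F y) ->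
  twist_potential g F x =
  4^-1 *: (\sum_i (twist_term g V e x *m cliff (g x) (e i x)
                   *m (twist_term g V e x *m cliff (g x) (e i x))))
  - 2^-1 *: (\sum_j (nablaEnd g (e j) (twist_term g V e) x *m cliff (g x) (e j x))).
Proof.
move=> Ox TF; rewrite (TF x Ox); apply: (congr2 (fun a b => 4^-1 *: a - 2^-1 *: b)).
  rewrite -(frame_contract (g_unit g_pos Ox) (e_orth Ox)); apply: eq_bigr => q _.
  have -> : F x *m cliff (g x) (e q x) =
      \sum_k (e q x 0 k)%:C *: (F x *m cliff (g x) (delta_mx 0 k)).
    by rewrite cliff_coord mulmx_sumr; apply: eq_bigr => k _; rewrite scalemxAr.
  rewrite [RHS]mulmx_suml; apply: eq_bigr => k _.
  rewrite [RHS]mulmx_sumr; apply: eq_bigr => l _.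
  by rewrite -!scalemxAr -scalemxAl scalerA rmorphM mulrC.
transitivity (\sum_k endo_nabla g k F x *m \sum_j (e j x 0 k)%:C *: cliff (g x) (e j x)).
  by apply: eq_bigr => k _; rewrite (frame_cliff_up g_pos e_frame).
under eq_bigr do rewrite mulmx_sumr.
rewrite exchange_big; apply: eq_bigr => j _ /=; rewrite /nablaEnd mulmx_suml.
apply: eq_bigr => k _; rewrite -scalemxAr -scalemxAl; congr (_ *: (_ *m _)).
by rewrite -(endo_nabla_eq oO g k TF Ox) endo_nabla.unlock lcform_conn.
Qed.

End TwistInFrame.
Theorem theorem2p1 (R : realType) (n : nat) (hn : (3 <= n)%N)
    (M : oriented_manifold R n) (compactM : compact [set: M])
    (g : metric M) (V : vector_field M)
    (V1 : forall (a : chart M) x, chart_img a x -> gip (g a) (V a) (V a) x = 1)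
    (delta : chart M ->
       ('rV[R]_n -> 'cV[R[i]]_(dimL n)) -> 'rV[R]_n -> 'cV[R[i]]_(dimL n))
    (deltaP : forall a : chart M, formal_adjoint_d (g a) (chart_img a) (delta a))
    (a : chart M) :
  let U := chart_img a in
  let D := DV (g a) (delta a) (V a) in
  let Dstar := DVstar (g a) (delta a) (V a) in
  [/\ laplace_type (g a) U (Dstar \o D),
      laplace_type (g a) U (D \o D),
      forall omega, canonical_connection (g a) U (Dstar \o D) omega ->
        forall (W : set 'rV[R]_n) (e : 'I_n -> 'rV[R]_n -> 'rV[R]_n),
        open W -> W `<=` U -> orthonormal_frame (g a) W e ->
        forall u x, smooth_cmx U u -> W x ->
          Dstar (D u) x =
            - rough_laplacian (g a) omega u x
            - 8^-1 *: (curv_term (g a) e x *m u x)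
            + (4^-1 * scal (g a) x)%:C *: u x
    & forall omega, canonical_connection (g a) U (D \o D) omega ->
        forall (W : set 'rV[R]_n) (e : 'I_n -> 'rV[R]_n -> 'rV[R]_n),
        open W -> W `<=` U -> orthonormal_frame (g a) W e ->
        forall u x, smooth_cmx U u -> W x ->
          let F := twist_term (g a) (V a) e in
          D (D u) x =
            - rough_laplacian (g a) omega u x
            - 8^-1 *: (curv_term (g a) e x *m u x)
            + (4^-1 * scal (g a) x)%:C *: u x
            + 4^-1 *: ((\sum_(i < n) (F x *m cliff (g a x) (e i x)
                                      *m (F x *m cliff (g a x) (e i x)))) *m u x)
            - 2^-1 *: ((\sum_(j < n) (nablaEnd (g a) (e j) F x
                                      *m cliff (g a x) (e j x))) *m u x)].
Proof.
move=> U D Dstar.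
have oU : open U by exact: chart_img_open.
have g_smooth : smooth_mx U (g a) by exact: gmat_smooth.
have g_sym x : U x -> (g a x)^T = g a x by exact: gmat_sym.
have g_pos x : U x -> pos_def (g a x) by exact: gmat_pos.
have V_smooth : smooth_mx U (V a) by exact: vcomp_smooth.
have adj : formal_adjoint_d (g a) U (delta a) by exact: deltaP.
have Vu x : U x -> gip (g a) (V a) (V a) x = 1 by exact: V1.
have s0 : smooth_cmx U (fun=> 0 : 'M[R[i]]_(dimL n)) by exact: smooth_cmx_cst.
have sF := twist_endo_smooth oU g_smooth g_pos V_smooth.
(* The first operator is the case F = 0 of D^2 + F D. *)
have PE u x : smooth_cmx U u -> U x -> (Dstar \o D) u x =
    dirac (g a) (dirac (g a) u) x + (fun=> 0) x *m dirac (g a) u x.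
  by move=> su Ux; rewrite mul0mx addr0; exact: (DVstar_DV oU).
have [lt1 cc1] := dirac_twisted_canonical oU g_smooth g_sym g_pos s0 PE.
have [lt2 cc2] := @dirac_twisted_canonical R n U oU (g a) g_smooth g_sym g_pos (D \o D) _ sF
  (fun u x su Ux => DV_DV oU g_smooth g_sym g_pos V_smooth adj Vu su Ux).
have weitz W (e : 'I_n -> 'rV[R]_n -> 'rV[R]_n) x (r u : 'cV[R[i]]_(dimL n)) :
    open W -> W `<=` U -> orthonormal_frame (g a) W e -> W x ->
    r - weitzenboeck (g a) x *m u =
    r - 8^-1 *: (curv_term (g a) e x *m u) + (4^-1 * scal (g a) x)%:C *: u.
  move=> oW WU fe Wx.
  have gW : smooth_mx W (g a) by move=> k l; exact: smooth_sub WU (g_smooth k l).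
  rewrite (weitzenboeck_frame oW gW (fun y Wy => g_sym y (WU y Wy))
    (fun y Wy => g_pos y (WU y Wy)) fe Wx).
  by rewrite mulmxBl mul_scalar_mx -scalemxAl opprB addrA addrAC.
split=> // omega.
- move=> /cc1 P W e oW WU fe u x su Wx; have := P u x su (WU x Wx).
  have -> : twist_potential (g a) (fun=> 0) x = 0.
    by rewrite twist_potential0.
  by rewrite mul0mx addr0 (weitz W e)//.
- move=> /cc2 P W e oW WU fe u x su Wx T; have gW y Wy := g_pos y (WU y Wy).
  have TF y (Wy : W y) := twist_term_endo gW (V a) fe Wy.
  have := P u x su (WU x Wx); rewrite (weitz W e)// (twist_potential_frame oW gW fe Wx TF).
  by rewrite mulmxBl -!scalemxAl addrA.
Qed.
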